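(* Let $S$ be a surface of degree $n$ in $\mathbb P^3$ with an ordinary singularity $p$ of multiplicity $m$ and no other singularity. Consider the minimal desingularization $f: S'\longrightarrow S$ of $S$, with the exceptional divisor of $S'$ over $p$ a plane curve $C$ of degree $m$. Let $\delta$ be such that there is a surface $X$ of degree $m$ in $\mathbb P^3$ having $C$ as a plane section and belonging to a regular component of $V^{\mathbb P^3, |\mathcal O_{\mathbb P^3}(m)|}_{\delta}$. Then the point corresponding to $S$ belongs to the closure of a regular component of $V^{\mathbb P^3, |\mathcal O_{\mathbb P^3}(n)|}_{\delta}$.
   Context: We work over $\mathbb C$. A node is an ordinary double point. For $d\geq 1$ and $\delta\geq 1$, $V^{\mathbb P^3, |\mathcal O_{\mathbb P^3}(d)|}_\delta\subset |\mathcal O_{\mathbb P^3}(d)|$ is the Severi variety: the locally closed subvariety parametrizing surfaces of degree $d$ in $\mathbb P^3$ with exactly $\delta$ nodes and no other singularity. An irreducible component $V$ of it is called regular if for the general $[Y]\in V$ one has $h^1(\mathbb P^3,\mathcal O_{\mathbb P^3}(d)\otimes \mathcal I_N)=0$, where $N$ is the reduced scheme of length $\delta$ of the nodes of $Y$. Closures are taken in $|\mathcal O_{\mathbb P^3}(n)|$. Let $S$ be a reduced surface with a point $p$ of multiplicity $m$, and let $f:S'\to S$ be the minimal desingularization of $S$ at $p$, with exceptional divisor $C$ over $p$, a plane curve of degree $m$. The singularity of $S$ at $p$ is ordinary if $C$ is smooth and $S'$ is obtained from $S$ by blowing up only once at $p$. *)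

(* Defs.v *)
From HB Require Import structures.
From mathcomp Require Import all_boot all_order all_algebra.
From mathcomp Require Import boolp classical_sets cardinality topology_structure.
From mathcomp Require Import mpoly.

Set Implicit Arguments.
Unset Strict Implicit.
Unset Printing Implicit Defensive.

Import GRing.Theory.
Local Open Scope classical_set_scope.
Local Open Scope card_scope.
Local Open Scope ring_scope.

Section ProjectiveSpace.
Variables (K : fieldType) (V : vectType K).

(* Points of P(V) are the lines of V; [rep x] is a nonzero vector of the line
   x. Every notion below that uses [rep] is invariant under scaling. *)
Definition pspace := {L : {vspace V} | \dim L == 1%N}.
HB.instance Definition _ := Choice.on pspace.

Definition rep (x : pspace) : V := vpick (val x).

Definition hcoords (x : pspace) : 'I_(\dim (fullv : {vspace V})) -> K :=
  fun i => coord (vbasis fullv) i (rep x).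

Definition homogeneous n : set {mpoly K[n]} := [set f | exists k, f \is k.-homog].
Arguments homogeneous : clear implicits.

Definition zero_locus (I : set {mpoly K[\dim (fullv : {vspace V})]}) :
  set pspace := [set x | forall f, I f -> f.@[hcoords x] = 0].

Definition zariski_open (U : set pspace) : Prop :=
  exists2 I, I `<=` homogeneous _ & U = ~` zero_locus I.

Lemma zariski_openT : zariski_open setT.
Proof.
exists [set 1] => [f ->|]; first by exists 0%N; apply: dhomog1.
apply/seteqP; split=> // x _ /(_ 1 erefl).
by rewrite meval1 => /eqP; rewrite oner_eq0.
Qed.

Lemma zariski_openI (A B : set pspace) :
  zariski_open A -> zariski_open B -> zariski_open (A `&` B).
Proof.
move=> [I hI ->] [J hJ ->].
exists [set h | exists f g, [/\ I f, J g & h = f * g]].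
  move=> _ [f [g [/hI[k hk] /hJ[l hl] ->]]]; exists (k + l)%N.
  exact: dhomogM.
apply/seteqP; split=> x.
- move=> [/existsNP[f /not_implyP[If fx]] /existsNP[g /not_implyP[Jg gx]]] /= h.
  have /eqP := h (f * g) (ex_intro _ f (ex_intro _ g (And3 If Jg erefl))).
  by rewrite mevalM mulf_eq0 => /orP[] /eqP.
- move=> hx; split=> h; apply: hx => _ [f [g [If Jg ->]]]; rewrite mevalM.
    by rewrite (h f If) mul0r.
  by rewrite (h g Jg) mulr0.
Qed.

Lemma zariski_open_bigU (T : Type) (A : T -> set pspace) :
  (forall i, zariski_open (A i)) -> zariski_open (\bigcup_i A i).
Proof.
move=> hA.
exists [set f | homogeneous _ f /\
  forall x, f.@[hcoords x] != 0 -> (\bigcup_i A i) x]; first by move=> f [].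
apply/seteqP; split=> x.
- move=> Ux; have [i _ Aix] := Ux; have [I hI eA] := hA i.
  move: (Aix); rewrite eA => /existsNP[f /not_implyP[If /eqP fx]] h.
  move/eqP: fx; apply; apply: h; split; first exact: hI.
  move=> y fy; exists i => //; rewrite eA => h.
  by move/eqP: fy; apply; apply: h.
- by move=> /existsNP[f /not_implyP[[_ hf] /eqP fx]]; apply: hf.
Qed.

HB.instance Definition _ := isOpenTopological.Build pspace
  zariski_openT zariski_openI zariski_open_bigU.

End ProjectiveSpace.

Section Irreducible.
Variable T : topologicalType.

Definition irreducible_set (A : set T) : Prop :=
  A !=set0 /\ forall Z1 Z2 : set T, closed Z1 -> closed Z2 ->
    A `<=` Z1 `|` Z2 -> A `<=` Z1 \/ A `<=` Z2.

Definition irreducible_component (A W : set T) : Prop :=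
  [/\ W `<=` A, irreducible_set W
    & forall W', W' `<=` A -> irreducible_set W' -> W `<=` W' -> W' `<=` W].

(* "P holds at the general point of W", for W irreducible. *)
Definition general_in (W : set T) (P : T -> Prop) : Prop :=
  exists U : set T,
    [/\ open U, U `&` W !=set0 & forall x, U x -> W x -> P x].

End Irreducible.

Section Hypersurfaces.
Variable K : fieldType.

Definition Proj n := pspace 'rV[K]_n.+1.

(* The linear system |O_{P^n}(d)|. *)
Definition linsys n d := pspace (dhomog n.+1 K d).

Definition pcoords n (p : Proj n) : 'I_n.+1 -> K := fun i => rep p ord0 i.

Definition is_equation n d (Y : linsys n d) (f : {mpoly K[n.+1]}) : Prop :=
  exists2 c : K, c != 0 & f = c *: (rep Y : {mpoly K[n.+1]}).

Definition singular_at n (f : {mpoly K[n]}) (v : 'I_n -> K) : Prop :=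
  f.@[v] = 0 /\ forall i, (f^`M(i)).@[v] = 0.

Definition sing_locus n d (Y : linsys n d) : set (Proj n) :=
  [set p | singular_at (rep Y : {mpoly K[n.+1]}) (pcoords p)].

(* A frame at p: a projective coordinate system in which p = [1:0:0:0]. *)
Definition frame_at (p : Proj 3) (M : 'M[K]_4) : Prop :=
  M \in unitmx /\ <[row ord0 M]>%VS = val p.

(* Equation of Y in the affine chart x |-> [1:x_0:x_1:x_2] M, in which p is the
   origin when M is a frame at p. *)
Definition local_equation d (Y : linsys 3 d) (M : 'M[K]_4) : {mpoly K[3]} :=
  (rep Y : {mpoly K[4]}) \mPo
    [tuple (M ord0 j)%:MP + \sum_(i < 3) M (lift ord0 i) j *: 'X_i | j < 4].

Definition multiplicity_at0 (f : {mpoly K[3]}) (m : nat) : Prop :=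
  pihomog mdeg m f != 0 /\ forall k, (k < m)%N -> pihomog mdeg k f = 0.

(* The i-th chart y |-> (y_i y_0, .., y_i, .., y_i y_2) of the blow-up of A^3 at
   the origin; its exceptional divisor is y_i = 0. *)
Definition blowup_chart (i : 'I_3) : 3.-tuple {mpoly K[3]} :=
  [tuple if j == i then 'X_i else 'X_i * 'X_j | j < 3].

(* For f of multiplicity m at 0, g is the equation of the blow-up at 0 of the
   surface f = 0, i.e. of its strict transform, in the i-th chart. *)
Definition strict_transform (f : {mpoly K[3]}) (m : nat) (i : 'I_3)
    (g : {mpoly K[3]}) : Prop :=
  f \mPo blowup_chart i = 'X_i ^+ m * g.

Definition smooth_blowup (f : {mpoly K[3]}) (m : nat) : Prop :=
  forall i g, strict_transform f m i g ->
  forall y : 'I_3 -> K, y i = 0 -> ~ singular_at g y.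

(* Y has multiplicity m at p, and C is the exceptional divisor of the blow-up
   of Y at p: the curve cut out by the initial form of a local equation of Y in
   the exceptional plane P(T_p P^3), identified with P^2 by means of a frame.
   Thus C is determined up to projective equivalence. *)
Definition exceptional_curve d m (Y : linsys 3 d) (p : Proj 3)
    (C : linsys 2 m) : Prop :=
  exists M, [/\ frame_at p M, multiplicity_at0 (local_equation Y M) m
    & is_equation C (pihomog mdeg m (local_equation Y M))].

(* The exceptional curve over p is smooth and a single blow-up at p
   desingularizes Y there. *)
Definition ordinary_singularity d (Y : linsys 3 d) (p : Proj 3) (m : nat) :
    Prop :=
  (exists2 C : linsys 2 m, exceptional_curve Y p C & sing_locus C = set0) /\
  (exists2 M, frame_at p M & smooth_blowup (local_equation Y M) m).

Definition node d (Y : linsys 3 d) (p : Proj 3) : Prop :=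
  sing_locus Y p /\ ordinary_singularity Y p 2.

(* The rows of A span the plane, with homogeneous coordinates u |-> u A. *)
Definition plane_section d (X : linsys 3 d) (C : linsys 2 d) : Prop :=
  exists A : 'M[K]_(3, 4), row_free A /\
    is_equation C ((rep X : {mpoly K[4]}) \mPo
      [tuple \sum_(i < 3) A i j *: 'X_i | j < 4]).

Definition severi d delta : set (linsys 3 d) :=
  [set Y | sing_locus Y #= `I_delta /\ forall p, sing_locus Y p -> node Y p].
Arguments severi d delta _ : clear implicits.

(* The homogeneous ideal of a reduced subscheme, given by its set of points. *)
Definition vanishing_on n (N : set (Proj n)) (g : {mpoly K[n.+1]}) : Prop :=
  forall p, N p -> g.@[pcoords p] = 0.

(* Sections of O(d) (x) I_N over D_+(f), for f homogeneous of degree e: this is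
   the sheaf associated with I(d), where I is the homogeneous ideal of N, so its
   sections are the elements of degree d of the localization I_f. *)
Definition ideal_sections n d (N : set (Proj n)) (f : {mpoly K[n.+1]}) (e : nat) :
    set {fraction {mpoly K[n.+1]}} :=
  [set s | exists (k : nat) (g : {mpoly K[n.+1]}),
    [/\ g \is (d + k * e).-homog, vanishing_on N g
      & s = tofrac g / tofrac f ^+ k]].

(* h^1(P^n, O(d) (x) I_N) = 0, where H^1 is Cech cohomology for the standard
   affine cover D_+(x_i). The cocycle identity for all i, j, k includes
   s i i = 0 and s j i = - s i j. *)
Definition h1_ideal_zero n d (N : set (Proj n)) : Prop :=
  forall s : 'I_n.+1 -> 'I_n.+1 -> {fraction {mpoly K[n.+1]}},
    (forall i j, ideal_sections d N ('X_i * 'X_j) 2 (s i j)) ->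
    (forall i j k, s i j + s j k = s i k) ->
  exists t : 'I_n.+1 -> {fraction {mpoly K[n.+1]}},
    (forall i, ideal_sections d N 'X_i 1 (t i)) /\
    (forall i j, s i j = t j - t i).

Definition regular_component d delta (W : set (linsys 3 d)) : Prop :=
  irreducible_component (severi d delta) W /\
  general_in W (fun Y => h1_ideal_zero d (sing_locus Y)).

End Hypersurfaces.

Arguments Proj : clear implicits.
Arguments linsys : clear implicits.
Arguments severi {K} d delta _.

(* Main.v *)
From HB Require Import structures.
Require Import Defs.
From mathcomp Require Import all_boot all_order all_algebra.
From mathcomp Require Import complex.
From mathcomp Require Import classical_sets reals topology_structure.
From mathcomp Require Import boolp functions cardinality.
From mathcomp Require Import perm mpoly ring lra zify.

(** Proof idea. Let [Sh] be the equation of [S] in a frame at [p], and [h_j] the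
    part of degree [j] of a form [h] in the last three variables. Put [X] in a
    position where its section by [x_0 = 0] is [C] and let [g] be its equation,
    scaled so that [(x_0^(n-m) g)_m = Sh_m]. The surfaces
      [F_t = \sum_(j <= m) t^(m-j) (x_0^(n-m) g)_j + \sum_(j > m) Sh_j]
    tend to [S] when [t] tends to [0], and [F_t (x_0, t x) = t^m G_t] where
    [G_0 = x_0^(n-m) g] has the nodes of [X]. As [X] is regular, these nodes
    impose independent conditions on forms of degree [m], so that by Newton's
    method they extend to singular points of [G_t], after moving [g].

    Conversely [F_t] has no other singular point. Suitably rescaled, the multiples
    of the partial derivatives of [F_t] in a large degree [k] have a limit at
    [t = 0], which together with [delta] forms spans all forms of degree [k]:
    the parts of high degree in the last three variables come from the partial
    derivatives of [Sh], because [p] is ordinary, and the others from those of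
    [g]. Spanning is an open condition, so the Jacobian ideal of [F_t] has
    codimension at most [delta] in degree [k]; hence its [delta] singular points
    are nodes and are the only ones. Multiplying forms of degree [m] by
    [x_0^(n-m)] shows that they impose independent conditions in degree [n].

    Since [h^1 = 0] is an open condition on the Severi variety and the Zariski
    topology is Noetherian, an irreducible subset of the regular locus has [S] in
    its closure, and it lies in a regular component. *)

(** A regular component satisfies [h^1 = 0] only at its general member, and [X] itself may fail it.
    The nodes are therefore deformed from another member [X'] of the component, whose plane section
    may differ from [C], so that [F_0] need no longer be [S]. For this reason what is needed later
    (spanning in degree [k], lying in a given neighbourhood of [S]) is phrased as the nonvanishing
    of polynomials in [t] and the coefficients of [g]. It is checked at [t = 0] and [X], carried to
    [X'] by irreducibility, and then to some nonzero [t]. Limits are meant in this Zariski sense,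
    and polynomial arcs with the Nullstellensatz stand in for the implicit function theorem.

    The rescaling multiplies the part of degree [j] in the last three variables by [t^(min j e)]. Up
    to degree [e] this is a dilation, under which the derivatives of [F_t] tend to those of
    [x_0^(n-m) g]; beyond [e] it is a constant factor, and they tend to those of [Sh]. The leading
    form of degree [m] belongs to both regimes and links them, and smoothness of [C] makes its
    derivatives reach the intermediate degrees. *)

Set Implicit Arguments.
Unset Strict Implicit.
Unset Printing Implicit Defensive.
Import Order.TTheory GRing.Theory Num.Theory.
Local Open Scope ring_scope.

(** * The Nullstellensatz over an uncountable field *)

(* The form in which the uncountability of the field is used. *)
Definition large_fibers (T : eqType) := forall kappa : T -> nat,
  exists k, forall N, exists s : seq T,
    [/\ uniq s, size s = N & forall x, x \in s -> kappa x = k].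

Lemma many_or_few (T : eqType) (P : T -> Prop) :
  (forall N, exists s : seq T, [/\ uniq s, size s = N & forall x, x \in s -> P x])
  \/ (exists s : seq T, forall x, P x -> x \in s).
Proof.
have [?|/forallNP H] := pselect (exists s : seq T, forall x, P x -> x \in s); [by right|left].
elim=> [|N [s [us ss Ps]]]; first by exists [::].
have /existsNP[x /not_implyP[Px /negP xs]] := H s.
exists (x :: s); split => /=; [by rewrite xs|by rewrite ss|].
by move=> y; rewrite inE => /predU1P[->//|/Ps].
Qed.

Lemma interval_avoiding (R : realType) (s : seq R) (a b : R) : a < b ->
  exists c d, [/\ a <= c, c < d, d <= b & forall x, x \in s -> ~~ (c <= x <= d)].
Proof.
elim: s => [|x s IH] ab; first by exists a, b.
have [c [d [ac cd db H]]] := IH ab.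
(* The outer quarter of [[c, d]] on the other side of the midpoint misses [x]. *)
have [xm|xm] := leP x ((c + d) / 2).
  exists ((c + d * 3) / 4), d; split; [lra|lra|lra|].
  move=> y; rewrite inE => /predU1P[->|/H]; first by apply/negP; lra.
  by move/negP=> ny; apply/negP => hy; apply: ny; lra.
exists c, ((c * 3 + d) / 4); split; [lra|lra|lra|].
move=> y; rewrite inE => /predU1P[->|/H]; first by apply/negP; lra.
by move/negP=> ny; apply/negP => hy; apply: ny; lra.
Qed.

(** Cantor's nested intervals: if every fibre were finite, the [k]-th shrinking could avoid the
    fibre of [k], and the supremum of the left ends would lie in no fibre. *)
Lemma real_large_fibers (R : realType) : large_fibers R.
Proof.
move=> kappa; apply: contrapT => /forallNP H.
have {}H k : exists s : seq R, forall x, kappa x = k -> x \in s.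
  by have [h|//] := many_or_few (fun x => kappa x = k); case: (H k).
have /choice[s Hs] := H.
have /choice[next Hn] : forall kp : nat * (R * R), exists q : R * R, kp.2.1 < kp.2.2 ->
    [/\ kp.2.1 <= q.1, q.1 < q.2, q.2 <= kp.2.2
      & forall x, x \in s kp.1 -> ~~ (q.1 <= x <= q.2)].
  move=> [k [a b]] /=; have [ab|ab] := ltP a b; last by exists (a, b).
  by have [c [d h]] := interval_avoiding (s k) ab; exists (c, d).
pose I := fix I k := if k is k'.+1 then next (k', I k') else (0, 1) : R * R.
have I1 k : (I k).1 < (I k).2.
  by elim: k => [|k IH] /=; [exact: ltr01|have [] := Hn (k, I k) IH].
have IS k : (I k).1 <= (I k.+1).1 /\ (I k.+1).2 <= (I k).2.
  by have [] := Hn (k, I k) (I1 k).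
have mono1 i j : (i <= j)%N -> (I i).1 <= (I j).1.
  by move=> /subnK<-; elim: (j - i)%N => [//|d IH]; rewrite addSn (le_trans IH) ?(IS _).1.
have mono2 i j : (i <= j)%N -> (I j).2 <= (I i).2.
  by move=> /subnK<-; elim: (j - i)%N => [//|d IH]; rewrite addSn (le_trans _ IH) ?(IS _).2.
have lu i j : (I i).1 <= (I j).2.
  have [ij|/ltnW ji] := leqP i j; first exact: le_trans (mono1 _ _ ij) (ltW (I1 j)).
  exact: le_trans (ltW (I1 i)) (mono2 _ _ ji).
pose E : set R := [set r | exists k, r = (I k).1]%classic.
have hE : has_sup E.
  by split; [exists 0, 0%N|exists (I 0%N).2 => _ [k ->]].
have lx k : (I k).1 <= sup E by apply: sup_upper_bound => //; exists k.
have xu k : sup E <= (I k).2 by apply: sup_le_ub; [exists 0, 0%N|move=> _ [j ->]].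
have [_ _ _ /(_ (sup E) (Hs _ _ erefl))] := Hn (kappa (sup E), I (kappa (sup E))) (I1 _).
by rewrite (lx (kappa (sup E)).+1) (xu (kappa (sup E)).+1).
Qed.

Lemma complex_large_fibers (R : realType) : large_fibers R[i].
Proof.
move=> kappa; have [k Hk] := @real_large_fibers R (fun x => kappa x%:C%C).
exists k => N; have [s [us ss Ps]] := Hk N.
exists [seq x%:C%C | x <- s]; split; rewrite ?size_map //.
  by rewrite map_inj_uniq // => x y [].
by move=> _ /mapP[x xs ->]; apply: Ps.
Qed.

Lemma mpoly_ring_ind (n : nat) (A : nzRingType) (P : {mpoly A[n]} -> Prop) :
  (forall c, P c%:MP) -> (forall i, P 'X_i) ->
  (forall p q, P p -> P q -> P (p + q)) -> (forall p q, P p -> P q -> P (p * q)) ->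
  forall p, P p.
Proof.
move=> PC PX PD PM; elim/mpolyind => [|c m p _ _ Pp]; first by rewrite -mpolyC0.
apply: (PD) Pp; rewrite -mul_mpolyC; apply: (PM); first exact: PC.
have P1 : P 1 by rewrite -mpolyC1.
rewrite mpolyXE_id; apply: (big_ind P) => [//|x y Px Py|i _]; first exact: (PM).
by elim: (m i) => [|k IH]; rewrite ?expr0 // exprS; apply: (PM).
Qed.

Definition idealP (A : comNzRingType) (I : set A) : Prop :=
  [/\ I 0, (forall x y, I x -> I y -> I (x + y)) & forall a x, I x -> I (a * x)].

Lemma ideal_sum (A : comNzRingType) (I : set A) (T : Type) (r : seq T) (P : pred T) (F : T -> A) :
  idealP I -> (forall i, P i -> I (F i)) -> I (\sum_(i <- r | P i) F i).
Proof. by case=> I0 ID IM H; apply: (big_ind I). Qed.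

Lemma idealN (A : comNzRingType) (I : set A) x : idealP I -> I x -> I (- x).
Proof. by case=> I0 ID IM /(IM (-1)); rewrite mulN1r. Qed.

Lemma idealB (A : comNzRingType) (I : set A) x y : idealP I -> I x -> I y -> I (x - y).
Proof. by move=> hI Ix Iy; case: (hI) => _ ID _; apply: (ID) => //; apply: idealN. Qed.

(** [P] is maximal among the ideals avoiding the powers of [h]: adding [f] to it produces some
    [h ^+ k], so [f] is invertible modulo [P] once [h] is inverted. *)
Lemma max_ideal_avoiding (A : comNzRingType) (I : set A) (h : A) :
  idealP I -> (forall k, ~ I (h ^+ k)) ->
  exists P : set A, [/\ idealP P, (I `<=` P)%classic, (forall k, ~ P (h ^+ k)) &
    forall f, ~ P f -> exists k q, P (h ^+ k - q * f)].
Proof.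
move=> hI Ih.
(* [Zorn_bigcup] also tests the empty chain, whose union is empty; a property of the union of [I]
   and [B] holds there too. *)
pose Q (B : set A) := idealP (I `|` B)%classic /\ forall k, ~ (I `|` B)%classic (h ^+ k).
have [|B [[hB hBh] Bmax]] := @Zorn_bigcup A Q.
  move=> F FQ tot; split; last first.
    by move=> k [/Ih//|[X FX Xh]]; have [_ /(_ k)] := FQ X FX; apply; right.
  have [I0 ID IM] := hI; split; first by left.
  - move=> x y [Ix|[X FX Xx]] [Iy|[Y FY Yy]]; first by left; apply: (ID).
    + have [[_ YD _] _] := FQ Y FY.
      by case: (YD x y (or_introl Ix) (or_intror Yy)) => h'; [left|right; exists Y].
    + have [[_ YD _] _] := FQ X FX.
      by case: (YD x y (or_intror Xx) (or_introl Iy)) => h'; [left|right; exists X].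
    + wlog XY : x y X Y FX FY Xx Yy / (X `<=` Y)%classic => [hw|].
        by have [XY|XY] := tot X Y FX FY; [|rewrite addrC]; apply: hw XY.
      have [[_ YD _] _] := FQ Y FY.
      by case: (YD x y (or_intror (XY _ Xx)) (or_intror Yy)) => h'; [left|right; exists Y].
  - move=> a x [Ix|[X FX Xx]]; first by left; apply: (IM).
    have [[_ _ XM] _] := FQ X FX.
    by case: (XM a x (or_intror Xx)) => h'; [left|right; exists X].
exists (I `|` B)%classic; split; [exact: hB|by move=> x; left|exact: hBh|].
move=> f nf; have [B0 BD BM] := hB.
pose C := [set x | exists b q, (I `|` B)%classic b /\ x = b + q * f]%classic.
have IBC : (I `|` B `<=` C)%classic by move=> x Ix; exists x, 0; rewrite mul0r addr0.
have Cf : C f by exists 0, 1; rewrite add0r mul1r.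
have BC : (B `<` C)%classic.
  split; first by move=> x Bx; apply: (IBC); right.
  by move=> CB; apply: nf; right; apply: CB.
have IC : (I `|` C = C)%classic.
  by apply/seteqP; split=> [x [Ix|//]|x]; [apply: (IBC); left|right].
have hC : idealP C.
  split; first by apply: (IBC).
  - move=> _ _ [b [q [Bb ->]]] [b' [q' [Bb' ->]]].
    by exists (b + b'), (q + q'); split; [exact: BD|ring].
  - move=> a _ [b [q [Bb ->]]].
    by exists (a * b), (a * q); split; [exact: BM|ring].
have := Bmax C BC; rewrite /Q IC => /not_andP[//|/existsNP[k]].
move/contrapT => -[b [q [Bb hk]]]; exists k, q.
by rewrite hk addrK.
Qed.

Lemma linear_dependence (K : fieldType) (n d : nat) (I : finType) (q : I -> {mpoly K[n]}) :
  (#|{: 'X_{1..n < d}}| < #|I|)%N -> (forall i, (msize (q i) <= d)%N) ->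
  exists c : I -> K, (exists i, c i != 0) /\ \sum_i c i *: q i = 0.
Proof.
move=> hI hq.
pose M := \matrix_(i < #|I|, j < #|{: 'X_{1..n < d}}|) (q (enum_val i))@_(val (enum_val j)).
have : kermx M != 0.
  rewrite kermx_eq0 /row_free; apply: contraL hI => /eqP <-.
  by rewrite -leqNgt rank_leq_col.
case/rowV0Pn => u /sub_kermxP uM u0.
exists (fun i => u 0 (enum_rank i)); split.
  by case/rV0Pn: u0 => j uj; exists (enum_val j); rewrite enum_valK.
apply/mpolyP => m; rewrite mcoeff0 raddf_sum /=.
have [md|md] := ltnP (mdeg m) d; last first.
  apply: big1 => i _; rewrite mcoeffZ memN_msupp_eq0 ?mulr0 //.
  by apply: msize_mdeg_ge; apply: leq_trans (hq i) md.
have := congr1 (fun N : 'rV_ _ => N 0 (enum_rank (BMultinom md))) uM.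
rewrite !mxE => uM0; rewrite -[RHS]uM0 [RHS](reindex_onto enum_rank enum_val) => [|i _]; last exact: enum_valK.
apply: eq_big => [i|i _]; first by rewrite enum_rankK eqxx.
by rewrite mcoeffZ mxE !enum_rankK.
Qed.

Lemma meval_mod_ideal (K : fieldType) (n : nat) (P : set {mpoly K[n]}) (v : 'I_n -> K) :
  idealP P -> (forall i, P ('X_i - (v i)%:MP)) -> forall f, P (f - f.@[v]%:MP).
Proof.
move=> hP hv; have [P0 PD PM] := hP.
elim/mpoly_ring_ind => [c|i|p q Pp Pq|p q Pp Pq].
- by rewrite mevalC subrr.
- by rewrite mevalXU.
- rewrite mevalD mpolyCD (_ : _ - _ = (p - p.@[v]%:MP) + (q - q.@[v]%:MP)); first exact: PD.
  by ring.
- rewrite mevalM mpolyCM.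
  rewrite (_ : _ - _ = q * (p - p.@[v]%:MP) + p.@[v]%:MP * (q - q.@[v]%:MP)).
    by apply: (PD); apply: (PM).
  by ring.
Qed.

(** Modulo [P], inverting [h] gives a field. If [X_i] were congruent to no scalar, every [X_i - a]
    would be invertible there. Arbitrarily many of the inverses share the power of [h] and a degree
    bound, hence are linearly dependent, which makes [X_i] a root of a polynomial over [K]; that
    polynomial splits. *)
Theorem nullstellensatz (K : closedFieldType) (n : nat) :
  large_fibers K -> forall (I : set {mpoly K[n]}) (h : {mpoly K[n]}),
  idealP I -> (forall k, ~ I (h ^+ k)) ->
  exists v, (forall f, I f -> f.@[v] = 0) /\ h.@[v] != 0.
Proof.
move=> Kbig I h hI Ih.
have [P [hP IP Ph Pmax]] := max_ideal_avoiding hI Ih.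
have [P0 PD PM] := hP.
have Pprime f g : P (f * g) -> P f \/ P g.
  move=> Pfg; have [?|/Pmax[k [a Pf]]] := pselect (P f); first by left.
  have [?|/Pmax[l [b Pg]]] := pselect (P g); first by right.
  have [] := Ph (k + l)%N.
  rewrite (_ : h ^+ _ = (h ^+ k - a * f) * h ^+ l +
    (a * f) * (h ^+ l - b * g) + a * b * (f * g)); last by rewrite exprD; ring.
  by apply: (PD); last exact: PM; apply: (PD); [rewrite mulrC|]; apply: (PM).
have main i : exists a, P ('X_i - a%:MP).
  apply: contrapT => /forallNP H.
  have /choice[kq Hkq] : forall a, exists kq : nat * {mpoly K[n]},
      P (h ^+ kq.1 - kq.2 * ('X_i - a%:MP)).
    by move=> a; have [k [q]] := Pmax _ (H a); exists (k, q).
  (* [pickle] packs exponent and size into one number, as [large_fibers] takes a map to [nat];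
     [He 1%N] then serves only to unpack its value. *)
  have [e He] := Kbig (fun a => pickle ((kq a).1, msize (kq a).2)).
  have [s [us ss Hs]] := He 1%N.
  have [k [d ekd]] : exists k d : nat, e = pickle (k, d).
    case: s ss Hs {us} => // a s _ /(_ a); rewrite mem_head => /(_ isT) <-.
    by eexists; eexists.
  move: He; rewrite {}ekd => He.
  have [{}s [{}us {}ss {}Hs]] := He #|{: 'X_{1..n < d}}|.+1.
  have Hs1 j : (kq (tnth (in_tuple s) j)).1 = k.
    by have /(pcan_inj pickleK_inv)[-> _] := Hs _ (mem_tnth j (in_tuple s)).
  have Hs2 j : (msize (kq (tnth (in_tuple s) j)).2 <= d)%N.
    by have /(pcan_inj pickleK_inv)[_ ->] := Hs _ (mem_tnth j (in_tuple s)).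
  pose a := tnth (in_tuple s).
  have ainj : injective a.
    move=> x y; rewrite /a !(tnth_nth 0) => /eqP; rewrite nth_uniq //.
    by move/eqP/val_inj.
  have [|c [[j0 cj0] c0]] := @linear_dependence K n d 'I_(size s) (fun j => (kq (a j)).2) _ Hs2.
    by rewrite card_ord ss.
  (* The relation between the inverses of the [X_i - a_j], with denominators cleared; at [a_j0] only
     the term of [j0] survives. *)
  pose r : {poly K} := \sum_j c j *: \prod_(l | l != j) ('X - (a l)%:P).
  have r0 : r != 0.
    apply: contraNneq cj0 => r0; have := congr1 (fun p => p.[a j0]) r0.
    rewrite horner_sum horner0 (bigD1 j0) //= [X in _ + X]big1 => [|j jj0]; last first.
      by rewrite hornerZ horner_prod (bigD1 j0) 1?eq_sym //= hornerXsubC subrr mul0r mulr0.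
    rewrite addr0 hornerZ horner_prod => /eqP; rewrite mulf_eq0 => /orP[//|].
    case/prodf_eq0 => l lj; rewrite hornerXsubC subr_eq0 => /eqP/ainj ejl.
    by rewrite ejl eqxx in lj.
  pose phi := map_poly (mpolyC n (R := K)).
  pose ev (p : {poly K}) := (phi p).['X_i].
  have evM p q : ev (p * q) = ev p * ev q by rewrite /ev /phi rmorphM hornerM.
  have evD p q : ev (p + q) = ev p + ev q by rewrite /ev /phi rmorphD hornerD.
  have evC b : ev b%:P = b%:MP by rewrite /ev /phi map_polyC hornerC.
  have evX b : ev ('X - b%:P) = 'X_i - b%:MP.
    by rewrite /ev /phi rmorphB /= map_polyX map_polyC hornerXsubC.
  have evprod (J : Type) (t : seq J) (Q : pred J) G :
      ev (\prod_(j <- t | Q j) G j) = \prod_(j <- t | Q j) ev (G j).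
    by apply: (big_morph ev evM); rewrite -[1]/(1%:P) evC.
  have Phr : P (h ^+ k * ev r).
    have -> : h ^+ k * ev r = \sum_j (c j)%:MP * ((\prod_(l | l != j) ('X_i - (a l)%:MP)) *
        (h ^+ k - (kq (a j)).2 * ('X_i - (a j)%:MP))).
      transitivity (\sum_j ((c j)%:MP * (\prod_(l | l != j) ('X_i - (a l)%:MP)) * h ^+ k
          - \prod_l ('X_i - (a l)%:MP) * (c j *: (kq (a j)).2))).
        rewrite sumrB -mulr_sumr c0 mulr0 subr0 -mulr_suml mulrC; congr (_ * _).
        rewrite /r (big_morph ev evD (id1 := 0)); last by rewrite -[0]/(0%:P) evC.
        apply: eq_bigr => j _; rewrite -mul_polyC evM evC evprod.
        by congr (_ * _); apply: eq_bigr => l _; rewrite evX.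
      apply: eq_bigr => j _; rewrite -mul_mpolyC [\prod_l _](bigD1 j) //=; ring.
    apply: ideal_sum => // j _; apply: (PM); apply: (PM).
    by have := Hkq (a j); rewrite Hs1.
  have Pr : P (ev r) by case: (Pprime _ _ Phr) => // /(Ph k).
  have [rs Hr] := closed_field_poly_normal r.
  move: Pr; rewrite Hr -mul_polyC evM evC => /Pprime[].
    move=> /(PM (lead_coef r)^-1%:MP); rewrite -mpolyCM mulVf ?lead_coef_eq0 //.
    by have := Ph 0%N; rewrite expr0 mpolyC1.
  rewrite evprod; elim: rs {Hr} => [|z rs IH]; first by rewrite big_nil; apply: (Ph 0%N).
  by rewrite big_cons evX => /Pprime[/H|].
have /choice[v Hv] := main.
have Pv := meval_mod_ideal hP Hv.
exists v; split=> [f /IP Pf|].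
  apply/eqP; apply/negPn/negP => fv; apply: (Ph 0%N); rewrite expr0.
  rewrite (_ : 1 = (f.@[v])^-1%:MP * (f - (f - f.@[v]%:MP))).
    by apply: (PM); apply: idealB.
  by rewrite opprB addrC subrK -mpolyCM mulVf // mpolyC1.
apply/negP => /eqP hv; apply: (Ph 1%N); rewrite expr1.
by have := Pv h; rewrite hv mpolyC0 subr0.
Qed.

(** * Ideals generated by forms *)

Section RingTools.
Variable K : fieldType.

Definition genby (A : comNzRingType) (I : finType) (J : I -> A) : set A :=
  [set f | exists a : I -> A, f = \sum_i a i * J i]%classic.

Lemma genby_ideal (A : comNzRingType) (I : finType) (J : I -> A) : idealP (genby J).
Proof.
split; first by exists (fun=> 0); rewrite big1 // => i _; rewrite mul0r.
- move=> _ _ [a ->] [b ->]; exists (fun i => a i + b i).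
  by rewrite -big_split; apply: eq_bigr => i _; rewrite mulrDl.
- move=> c _ [a ->]; exists (fun i => c * a i).
  by rewrite mulr_sumr; apply: eq_bigr => i _; rewrite mulrA.
Qed.

Lemma genby_gen (A : comNzRingType) (I : finType) (J : I -> A) i : genby J (J i).
Proof.
exists (fun j => (j == i)%:R); rewrite (bigD1 i) //= eqxx mul1r big1 ?addr0 // => j /negPf ->.
by rewrite mul0r.
Qed.

Lemma genby_min (A : comNzRingType) (I : finType) (J : I -> A) (P : set A) :
  idealP P -> (forall i, P (J i)) -> (genby J `<=` P)%classic.
Proof. by move=> hP PJ _ [a ->]; apply: ideal_sum => // i _; case: hP => _ _; apply. Qed.

Lemma meval_sum (n : nat) (v : 'I_n -> K) (T : Type) (r : seq T) (P : pred T) F :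
  (\sum_(i <- r | P i) F i).@[v] = \sum_(i <- r | P i) (F i).@[v].
Proof. exact: (raddf_sum (meval v)). Qed.

Lemma mderiv_sum (n : nat) (j : 'I_n) (T : Type) (r : seq T) (P : pred T) (F : T -> {mpoly K[n]}) :
  (\sum_(i <- r | P i) F i)^`M(j) = \sum_(i <- r | P i) (F i)^`M(j).
Proof. exact: (raddf_sum (mderiv j)). Qed.

Lemma mderiv_comp (n k : nat) (p : {mpoly K[n]}) (lq : n.-tuple {mpoly K[k]}) i :
  (p \mPo lq)^`M(i) = \sum_j (p^`M(j) \mPo lq) * (tnth lq j)^`M(i).
Proof.
elim/mpoly_ring_ind: p => [c|l|p q Hp Hq|p q Hp Hq].
- by rewrite comp_mpolyC mderivC big1 // => j _; rewrite mderivC comp_mpoly0 mul0r.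
- rewrite comp_mpolyXU -tnth_nth (bigD1 l) //= big1 => [|j jl].
    rewrite addr0 mderivX mnm1E eqxx scale1r.
    have -> : (U_(l) - U_(l) = 0 :> 'X_{1..n})%MM by apply/mnmP=> t; rewrite mnmBE subnn mnm0E.
    by rewrite mpolyX0 comp_mpoly1 mul1r.
  by rewrite mderivX mnm1E eq_sym (negPf jl) scale0r comp_mpoly0 mul0r.
- rewrite comp_mpolyD mderivD Hp Hq -big_split; apply: eq_bigr => j _ /=.
  by rewrite mderivD comp_mpolyD mulrDl.
- rewrite rmorphM mderivM Hp Hq mulr_suml mulr_sumr -big_split; apply: eq_bigr => j _ /=.
  by rewrite mderivM rmorphD !rmorphM /= mulrDl mulrAC mulrA.
Qed.

Lemma mderiv_XU (n : nat) (i j : 'I_n) : ('X_j : {mpoly K[n]})^`M(i) = (i == j)%:R.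
Proof.
rewrite mderivX mnm1E eq_sym; case: (eqVneq i j) => [->|_]; last by rewrite scale0r.
rewrite scale1r (_ : (_ - _ = 0)%MM) ?mpolyX0 //.
by apply/mnmP=> t; rewrite mnmBE subnn mnm0E.
Qed.

Lemma mderiv_homog (n d : nat) (p : {mpoly K[n]}) i :
  p \is d.-homog -> p^`M(i) \is d.-1.-homog.
Proof.
move=> hp; apply/dhomogP => m; rewrite mcoeff_msupp mcoeff_deriv => h.
have : p@_(m + U_(i)) != 0 by apply: contraNneq h => ->; rewrite mul0rn.
by rewrite -mcoeff_msupp => /(dhomog_mf hp) /= <-; rewrite mdegD mdeg1 addn1.
Qed.

Lemma euler_homog (n d : nat) (p : {mpoly K[n]}) :
  p \is d.-homog -> \sum_i 'X_i * p^`M(i) = p *+ d.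
Proof.
move=> hp; apply/mpolyP => m; rewrite raddf_sum mcoeffMn /=.
have -> : p@_m *+ d = p@_m *+ mdeg m.
  have [pm|] := boolP (m \in msupp p); first by rewrite (dhomog_mf hp).
  by move/memN_msupp_eq0 ->; rewrite !mul0rn.
rewrite mdegE -sumrMnr; apply: eq_bigr => i _.
have [mi|mi] := eqVneq (m i) 0%N.
  rewrite mi mulr0n mcoeffM big1 // => -[k1 k2] /= /eqP ek.
  rewrite mcoeffX; case: eqP => [e|]; last by rewrite mul0r.
  by have := congr1 (fun t : 'X_{1..n} => t i) ek; rewrite mi mnmDE -e mnm1E eqxx.
have em : m = (U_(i) + (m - U_(i)))%MM by rewrite addmC submK // lep1mP.
rewrite ['X_i * _]mulrC {1}em mcoeffMX mcoeff_deriv addmC -em; congr (_ *+ _).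
by rewrite mnmBE mnm1E eqxx; lia.
Qed.

Lemma meval_scale (n d : nat) (p : {mpoly K[n]}) (c : K) (v : 'I_n -> K) :
  p \is d.-homog -> p.@[fun i => c * v i] = c ^+ d * p.@[v].
Proof.
move=> /dhomogP hp; rewrite !mevalE mulr_sumr; apply: eq_big_seq => m /hp /= <-.
rewrite mulrCA; congr (_ * _).
under eq_bigr do rewrite exprMn.
by rewrite big_split /= prodrXr mdegE.
Qed.

Lemma pihomogM (n d k : nat) (a p : {mpoly K[n]}) : p \is d.-homog ->
  pihomog mdeg k (a * p) = if (d <= k)%N then pihomog mdeg (k - d) a * p else 0.
Proof.
move=> hp; pose N := (msize a + k).+1.
have {1}-> : a = \sum_(j < N) pihomog mdeg j a.
  by apply: pihomog_partitionE; rewrite /N; lia.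
have hj (j : nat) : pihomog mdeg j a * p \is (j + d).-homog.
  by apply: dhomogM => //; apply: pihomogP.
rewrite mulr_suml raddf_sum /=; case: ifP => dk; last first.
  apply: big1 => j _; apply: pihomog_ne0 (hj j); lia.
have kN : (k - d < N)%N by rewrite /N; lia.
rewrite (bigD1 (Ordinal kN)) //= big1 => [|j jk]; last first.
  apply: pihomog_ne0 (hj j); apply: contraNneq jk => e; apply/eqP/val_inj => /=; lia.
rewrite addr0 pihomog_dE //; have := hj (k - d)%N; rewrite subnK //.
Qed.

(** Only the part of degree [k - d i] of each coefficient contributes. The last clause makes up for
    the truncated subtraction, which would allow a constant coefficient on a generator of degree
    above [k]. *)
Lemma genby_homog (n k : nat) (I : finType) (d : I -> nat) (J : I -> {mpoly K[n]}) f :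
  (forall i, J i \is (d i).-homog) -> f \is k.-homog -> genby J f ->
  exists a : I -> {mpoly K[n]},
    f = \sum_i a i * J i /\ forall i, a i \is (k - d i).-homog /\ ((k < d i)%N -> a i = 0).
Proof.
move=> hJ hf [a ef].
exists (fun i => if (d i <= k)%N then pihomog mdeg (k - d i) (a i) else 0); split.
  rewrite -{1}(pihomog_dE hf) {1}ef raddf_sum; apply: eq_bigr => i _ /=.
  by rewrite (pihomogM _ _ (hJ i)); case: ifP => // _; rewrite mul0r.
move=> i; split; first by case: ifP => _; [exact: pihomogP|exact: dhomog0].
by rewrite ltnNge => /negPf ->.
Qed.

Lemma genby_pihomog (n k : nat) (I : finType) (d : I -> nat) (J : I -> {mpoly K[n]}) f :
  (forall i, J i \is (d i).-homog) -> genby J f -> genby J (pihomog mdeg k f).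
Proof.
move=> hJ [a ->]; rewrite raddf_sum; apply: ideal_sum; first exact: genby_ideal.
move=> i _ /=; rewrite (pihomogM _ _ (hJ i)); have [J0 _ JM] := genby_ideal J.
by case: ifP => // _; apply: JM; apply: genby_gen.
Qed.

Lemma comp_mpoly_diff (n k : nat) (p : {mpoly K[n]}) (Y Z : n.-tuple {mpoly K[k]}) :
  exists A : 'I_n -> {mpoly K[k]},
    (p \mPo Y) - (p \mPo Z) = \sum_l A l * (tnth Y l - tnth Z l).
Proof.
suff: genby (fun l => tnth Y l - tnth Z l) ((p \mPo Y) - (p \mPo Z)) by [].
set G := genby _; have hG : idealP G := genby_ideal _; have [G0 GD GM] := hG.
elim/mpoly_ring_ind: p => [c|l|p q Hp Hq|p q Hp Hq].
- by rewrite !comp_mpolyC subrr.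
- by rewrite !comp_mpolyXU -!tnth_nth; apply: (genby_gen (fun l => tnth Y l - tnth Z l)).
- by rewrite !comp_mpolyD opprD addrACA; apply: GD.
- have E (a b a' b' : {mpoly K[k]}) : a * b - a' * b' = b * (a - a') + a' * (b - b') by ring.
  rewrite !rmorphM /= E.
  by apply: GD; apply: GM.
Qed.

(* [ell_l = q_c x_l - q_l x_c]: these linear forms vanish at q and generate,
   after inverting q_c, the homogeneous ideal of the point q. *)
Lemma homog_point_decomp (n d : nat) (p : {mpoly K[n]}) (q : 'I_n -> K) (c : 'I_n) :
  p \is d.-homog ->
  exists A : 'I_n -> {mpoly K[n]},
    q c ^+ d *: p = p.@[q] *: 'X_c ^+ d + \sum_l A l * (q c *: 'X_l - q l *: 'X_c).
Proof.
move=> hp; have [A HA] := comp_mpoly_diff p [tuple q c *: 'X_l | l < n] [tuple q l *: 'X_c | l < n].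
exists A; move: HA; under eq_bigr do rewrite !tnth_mktuple.
move=> <-; rewrite addrC.
have -> : p \mPo [tuple q c *: 'X_l | l < n] = q c ^+ d *: p.
  rewrite comp_mpolyEX {3}[p]mpolyE scaler_sumr; apply: eq_big_seq => m /(dhomog_mf hp) /= dm.
  rewrite scalerA mulrC -scalerA; congr (_ *: _).
  rewrite comp_mpolyX (eq_bigr (fun l => q c ^+ m l *: 'X_l ^+ m l)) => [|l _].
    by rewrite scaler_prod prodrXr -mdegE dm -mpolyXE_id.
  by rewrite tnth_mktuple exprZn.
have -> : p \mPo [tuple q l *: 'X_c | l < n] = p.@[q] *: 'X_c ^+ d.
  rewrite comp_mpolyEX mevalE scaler_suml; apply: eq_big_seq => m /(dhomog_mf hp) /= dm.
  rewrite -scalerA; congr (_ *: _).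
  rewrite comp_mpolyX (eq_bigr (fun l => q l ^+ m l *: 'X_c ^+ m l)) => [|l _].
    by rewrite scaler_prod prodrXr -mdegE dm.
  by rewrite tnth_mktuple exprZn.
by rewrite subrK.
Qed.

End RingTools.

(** Each variable has a power in [I], and a monomial of degree above the sum of these exponents is
    divisible by one of the powers. *)
Lemma projective_nullstellensatz (K : closedFieldType) (n : nat) (I : set {mpoly K[n]}) :
  large_fibers K -> idealP I ->
  (forall v, (forall f, I f -> f.@[v] = 0) -> forall i, v i = 0) ->
  exists k, forall m : 'X_{1..n}, (k <= mdeg m)%N -> I 'X_[m].
Proof.
move=> Kbig hI Iv.
have /choice[k Hk] : forall i : 'I_n, exists k, I ('X_i ^+ k).
  move=> i; apply: contrapT => /forallNP H.
  have [v [Hv]] := nullstellensatz Kbig hI H.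
  by rewrite mevalXU (Iv v Hv) eqxx.
exists (\sum_i k i).+1 => m hm.
have [i kmi] : exists i, (k i <= m i)%N.
  apply: contrapT => /forallNP H; move: hm; rewrite mdegE ltnNge leq_sum // => i _.
  by have /negP := H i; rewrite -ltnNge => /ltnW.
have -> : m = ((m - U_(i) *+ k i) + U_(i) *+ k i)%MM.
  rewrite submK //; apply/mnm_lepP => j; rewrite mulmnE mnm1E.
  by case: (eqVneq i j) => [<-|_]; rewrite ?mul1n ?mul0n.
by rewrite mpolyXD -mpolyXn; case: hI => _ _; apply.
Qed.

Lemma mpoly_nonzero_eval (K : closedFieldType) (n : nat) (p : {mpoly K[n]}) :
  large_fibers K -> p != 0 -> exists v, p.@[v] != 0.
Proof.
move=> Kbig p0.
have h0 : idealP [set f : {mpoly K[n]} | f = 0]%classic.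
  by split=> // [x y -> ->|a x ->]; rewrite ?addr0 ?mulr0.
have [k /eqP|v [_ hv]] := @nullstellensatz K n Kbig _ p h0; last by exists v.
by rewrite expf_eq0 (negPf p0) andbF.
Qed.

Lemma mpoly_eval_inj (K : closedFieldType) (n : nat) (p q : {mpoly K[n]}) :
  large_fibers K -> (forall v, p.@[v] = q.@[v]) -> p = q.
Proof.
move=> Kbig pq; apply/eqP; rewrite -subr_eq0; apply/negPn/negP.
by case/(mpoly_nonzero_eval Kbig) => v; rewrite mevalB pq subrr eqxx.
Qed.

(** * Hilbert's basis theorem and Noetherian induction on closed sets *)

(** Each chosen index minimises [v] over a whole tail, hence over everything chosen after it. *)
Lemma nondecreasing_subseq (v : nat -> nat) :
  exists phi : nat -> nat, (forall i, phi i < phi i.+1)%N /\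
    forall i j, (i <= j -> v (phi i) <= v (phi j))%N.
Proof.
have /choice[g Hg] : forall N, exists k, (N <= k)%N /\ forall l, (N <= l -> v k <= v l)%N.
  move=> N; have ex : exists x, `[< exists2 l, (N <= l)%N & v l = x >].
    by exists (v N); apply/asboolP; exists N.
  case: (ex_minnP ex) => x /asboolP[k Nk <-] H.
  by exists k; split=> // l Nl; apply: H; apply/asboolP; exists l.
pose phi := fix phi i := if i is i'.+1 then g (phi i').+1 else g 0%N.
have phiS i : (phi i < phi i.+1)%N by have [] := Hg (phi i).+1.
have phimin i : exists N, (N <= phi i)%N /\ forall l, (N <= l -> v (phi i) <= v l)%N.
  by case: i => [|i]; eexists; apply: Hg.
exists phi; split=> // i j /subnK<-; elim: (j - i)%N => // d IH.
apply: leq_trans IH _; rewrite addSn; have [N [Nphi H]] := phimin (d + i)%N.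
by apply: H; apply: leq_trans Nphi (ltnW (phiS _)).
Qed.

Lemma dickson (n : nat) (u : nat -> 'X_{1..n}) : exists i j, (i < j)%N /\ (u i <= u j)%MM.
Proof.
suff H k : exists phi : nat -> nat, (forall i, phi i < phi i.+1)%N /\
    forall l : 'I_n, (l < k)%N -> forall i j, (i <= j -> u (phi i) l <= u (phi j) l)%N.
  have [phi [inc H']] := H n; exists (phi 0%N), (phi 1%N); split=> //.
  by apply/mnm_lepP => l; apply: H'.
elim: k => [|k [phi [inc H]]]; first by exists id.
have [nk|kn] := leqP n k; first by exists phi; split=> // l _; apply: H; apply: leq_trans nk.
have [psi [pinc Hpsi]] := nondecreasing_subseq (fun i => u (phi i) (Ordinal kn)).
have homo (f : nat -> nat) (fi : forall i, (f i < f i.+1)%N) i j : (i <= j)%N -> (f i <= f j)%N.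
  by move=> /subnK<-; elim: (j - i)%N => // d IH; rewrite addSn (leq_trans IH) // ltnW.
have homos (f : nat -> nat) (fi : forall i, (f i < f i.+1)%N) i j : (i < j)%N -> (f i < f j)%N.
  by move=> ij; apply: leq_trans (fi i) (homo f fi _ _ ij).
exists (phi \o psi); split=> [i|l lk i j ij] /=; first exact: homos.
have [ek|nek] := eqVneq (l : nat) k.
  by have -> : l = Ordinal kn; [apply/val_inj|apply: Hpsi].
by apply: H; [rewrite ltn_neqAle nek -ltnS|apply: homo].
Qed.

(** Otherwise choose [g N] congruent to [f N] modulo the ideal of its predecessors, with least
    leading monomial. By Dickson's lemma the leading monomial of some [g i] divides that of a later
    [g j], and subtracting a multiple of [g i] contradicts the choice of [g j]. *)
Lemma hilbert_basis (K : fieldType) (n : nat) (f : nat -> {mpoly K[n]}) :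
  exists N, genby (fun i : 'I_N => f i) (f N).
Proof.
apply: contrapT => /forallNP H.
pose I N := genby (fun i : 'I_N => f i).
have hI N : idealP (I N) := genby_ideal _.
have Imono i j : (i <= j)%N -> (I i `<=` I j)%classic.
  move=> ij; apply: genby_min => // l.
  exact: (genby_gen (fun l : 'I_j => f l) (widen_ord ij l)).
have If i j : (i < j)%N -> I j (f i) by move=> ij; apply: (genby_gen (fun l : 'I_j => f l) (Ordinal ij)).
pose Q N g := I N (g - f N).
have Qnot N g : Q N g -> ~ I N g.
  move=> Qg Ig; apply: (H N); rewrite -[X in genby _ X](subKr g).
  exact: idealB (hI N) Ig Qg.
have /choice[g Hg] : forall N, exists g, Q N g /\ forall g', Q N g' -> (mlead g <= mlead g')%O.
  move=> N; apply: contrapT => /forallNP Hn.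
  suff : forall m g, mlead g = m -> ~ Q N g.
    by move=> /(_ _ (f N) erefl); apply; rewrite /Q subrr; case: (hI N).
  move=> m; elim: m / (@ltom_wf n m) => m _ IH g eg Qg; apply: (Hn g); split=> //.
  by move=> g' Qg'; rewrite leNgt; apply/negP => lt; apply: (IH (mlead g')) Qg'; rewrite -?eg.
have [i [j [ij uij]]] := dickson (fun N => mlead (g N)).
have [Qi mi] := Hg i; have [Qj mj] := Hg j.
have g0 k : g k != 0.
  by apply/negP => /eqP gk; have [Qk _] := Hg k; apply: (Qnot _ _ Qk); rewrite gk; case: (hI k).
have Igi : I j (g i).
  rewrite -[g i](subrK (f i)); have [_ ID _] := hI j; apply: ID; last exact: If.
  by apply: (Imono i) => //; apply: ltnW.
pose c := mleadc (g j) / mleadc (g i).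
pose g' := g j - (c *: 'X_[mlead (g j) - mlead (g i)]) * g i.
have Qg' : Q j g'.
  rewrite /Q /g' addrAC; apply: idealB => //.
  by case: (hI j) => _ _; apply.
have g'0 : g' != 0.
  by apply/negP => /eqP e; apply: (Qnot _ _ Qg'); rewrite e; case: (hI j).
have c0 : c != 0 by rewrite mulf_neq0 ?invr_neq0 ?mleadc_eq0.
have hX : c *: 'X_[mlead (g j) - mlead (g i)] != 0 :> {mpoly K[n]}.
  by rewrite scaler_eq0 negb_or c0 -msupp_eq0 msuppX.
have le : (mlead g' <= mlead (g j))%O.
  apply: le_trans (mleadB_le _ _) _; rewrite leUx lexx /=.
  by rewrite mleadM ?mleadZ ?mleadXm // submK.
have e : mlead g' = mlead (g j) by apply/eqP; rewrite eq_le le mj.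
have eX : ('X_[mlead (g j) - mlead (g i)] * g i)@_(mlead (g j)) = mleadc (g i).
  have eM : mlead (g j) = ((mlead (g j) - mlead (g i)) + mlead (g i))%MM by rewrite submK.
  by rewrite mulrC {1}eM mcoeffMX.
have := g'0; rewrite -mleadc_eq0 e /g' mcoeffB -scalerAl mcoeffZ eX.
by rewrite /c divfK ?mleadc_eq0 // subrr eqxx.
Qed.

(** A strictly decreasing chain of closed sets gives polynomials [f k] vanishing on [C k.+1] but not
    on all of [C k]; then [f N] is not in the ideal of its predecessors, which all vanish on
    [C N]. *)
Lemma pspace_noetherian (K : fieldType) (V : vectType K) (P : set (pspace V) -> Prop) :
  (forall Z, closed Z -> (forall Z', closed Z' -> (Z' `<` Z)%classic -> P Z') -> P Z) ->
  forall Z, closed Z -> P Z.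
Proof.
move=> H Z cZ; apply: contrapT => nPZ.
have /choice[nxt Hn] : forall Z : set (pspace V), exists Z', closed Z -> ~ P Z ->
    [/\ closed Z', (Z' `<` Z)%classic & ~ P Z'].
  move=> Y; apply: contrapT => /forallNP h; have [cY nY] : closed Y /\ ~ P Y.
    by split; apply: contrapT => h'; apply: (h Y) => ? ?.
  apply: nY; apply: (H) => // Z' cZ' Z'Y; apply: contrapT => nZ'.
  by apply: (h Z').
pose C := fix C k := if k is k'.+1 then nxt (C k') else Z.
have CP k : closed (C k) /\ ~ P (C k).
  by elim: k => //= k [c p]; have [] := Hn _ c p.
have CS k : (C k.+1 `<` C k)%classic by have [c p] := CP k; have [] := Hn _ c p.
have Cmono i j : (i <= j)%N -> (C j `<=` C i)%classic.
  move=> /subnK<-; elim: (j - i)%N => // d IH; rewrite addSn; apply: subset_trans IH.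
  by have [] := CS (d + i)%N.
have /choice[f Hf] : forall k, exists f : {mpoly K[\dim (fullv : {vspace V})]},
    (forall x, C k.+1 x -> f.@[hcoords x] = 0) /\ exists2 x, C k x & f.@[hcoords x] != 0.
  move=> k; have [_ /existsNP[x /not_implyP[Cx nCx]]] := CS k.
  have [cl _] := CP k.+1.
  have [I hI eI] : zariski_open (~` C k.+1)%classic by move: cl; rewrite -openC => h; exact: h.
  have : (~` C k.+1)%classic x by [].
  rewrite eI => /existsNP[f /not_implyP[If /eqP fx]]; exists f; split; last by exists x.
  move=> y Cy; apply: contrapT => fy.
  have : (~` C k.+1)%classic y by rewrite eI => /(_ f If).
  by apply.
have [N [a ea]] := hilbert_basis f.
have [_ [x Cx /negP]] := Hf N; apply; rewrite ea.
rewrite raddf_sum big1 //= => i _; rewrite mevalM.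
have [Hfi _] := Hf i; rewrite Hfi ?mulr0 //; exact: (Cmono _ _ (ltn_ord i)) Cx.
Qed.

(** * Nodes and the corank of the Jacobian ideal *)

Lemma kernel_exists (K : fieldType) (I : finType) (d : nat) (A : I -> 'I_d -> K) :
  (d < #|I|)%N -> exists c : I -> K, (exists i, c i != 0) /\ forall l, \sum_i c i * A i l = 0.
Proof.
move=> hI; pose M := \matrix_(i < #|I|, j < d) A (enum_val i) j.
have : kermx M != 0.
  by rewrite kermx_eq0 /row_free; apply: contraL hI => /eqP <-; rewrite -leqNgt rank_leq_col.
case/rowV0Pn => u /sub_kermxP uM u0.
exists (fun i => u 0 (enum_rank i)); split.
  by case/rV0Pn: u0 => j uj; exists (enum_val j); rewrite enum_valK.
move=> l; have := congr1 (fun N : 'rV_ _ => N 0 l) uM; rewrite !mxE => uM0; rewrite -[RHS]uM0.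
rewrite [RHS](reindex_onto enum_rank enum_val) => [|i _]; last exact: enum_valK.
by apply: eq_big => [i|i _]; rewrite ?enum_rankK ?eqxx // mxE enum_rankK.
Qed.

Section Points.
Variables (K : fieldType) (n : nat).
Implicit Types (q v : 'I_n -> K) (p f g h : {mpoly K[n]}).

(** The factor may be [0]: the zero vector is proportional to every [q], and the relation is not
    symmetric. *)
Definition propor q v := exists c, forall i, v i = c * q i.

Definition linform (b : 'I_n -> K) : {mpoly K[n]} := \sum_l b l *: 'X_l.

(** By Euler's formula the Hessian of a form at a singular point [q] kills [q]; at a node its kernel
    is no larger than this line. *)
Definition nodal_at f q :=
  (forall i, f^`M(i).@[q] = 0) /\
  forall v, (forall i, \sum_l f^`M(i)^`M(l).@[q] * v l = 0) -> propor q v.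

(** For a form [f], the part of degree [k] of its Jacobian ring has dimension at most [d]. *)
Definition corank_le f (k d : nat) := exists T : 'I_d -> {mpoly K[n]}, forall g,
  g \is k.-homog -> exists c : 'I_d -> K, genby (fun i => f^`M(i)) (g - \sum_l c l *: T l).

Lemma linform_homog b : linform b \is 1.-homog.
Proof. by apply: rpred_sum => l _; apply: rpredZ; rewrite dhomogX /= mdeg1. Qed.

Lemma meval_linform b v : (linform b).@[v] = \sum_l b l * v l.
Proof. by rewrite raddf_sum; apply: eq_bigr => l _; rewrite /= mevalZ mevalXU. Qed.

Lemma mderiv_linform b i : (linform b)^`M(i) = (b i)%:MP.
Proof.
rewrite raddf_sum /= (bigD1 i) //= big1 => [|l li].
  by rewrite mderivZ mderiv_XU eqxx addr0 -mul_mpolyC mulr1.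
by rewrite mderivZ mderiv_XU eq_sym (negPf li) scaler0.
Qed.

(** The forms [q_c x_l - q_l x_c] vanish at [q], and all of them vanish at [v] only if [v] is
    proportional to [q]. *)
Lemma separating_linform q v : (exists i, q i != 0) -> ~ propor q v ->
  exists b, (linform b).@[q] = 0 /\ (linform b).@[v] != 0.
Proof.
move=> [c qc] nqv; apply: contrapT => /forallNP H; apply: nqv.
exists (v c / q c) => l.
pose b i : K := (i == l)%:R * q c - (i == c)%:R * q l.
have E w : (linform b).@[w] = q c * w l - q l * w c.
  rewrite meval_linform /b; under eq_bigr do rewrite mulrBl -!mulrA.
  rewrite sumrB (bigD1 l) //= eqxx mul1r big1 => [|i /negPf->]; last by rewrite mul0r.
  by rewrite (bigD1 c) //= eqxx mul1r big1 => [|i /negPf->]; rewrite ?mul0r // !addr0.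
have /not_andP[|/negP] := H b; first by rewrite E; case; rewrite mulrC subrr.
rewrite negbK E subr_eq0 => /eqP e.
by apply: (mulfI qc); rewrite e; field.
Qed.

Section Interpolation.
Variables (I : finType) (q : I -> 'I_n -> K).
Hypothesis q0 : forall l, exists i, q l i != 0.
Hypothesis qne : forall l l', l != l' -> ~ propor (q l) (q l').

(** A product of [#|I| - 1] linear forms, each killing one of the other points, is padded with a
    power of a coordinate that is nonzero at [q j]. *)
Lemma partial_separation j k : (#|I| <= k.+1)%N ->
  exists h, [/\ h \is k.-homog, h.@[q j] != 0 & forall l, l != j -> h.@[q l] = 0].
Proof.
move=> Ik; have [c qc] := q0 j.
have /choice[b Hb] : forall l, exists b, l != j ->
    (linform b).@[q l] = 0 /\ (linform b).@[q j] != 0.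
  move=> l; have [->|lj] := eqVneq l j; first by exists (fun=> 0).
  by have [b Hb] := separating_linform (q0 l) (qne lj); exists b.
pose h := \prod_(l | l != j) linform (b l).
have hh : h \is (#|I|.-1).-homog.
  rewrite /h -(cardC1 j) -sum1_card; elim/big_rec2: _ => [|l d p lj Hp]; first exact: dhomog1.
  by apply: dhomogM => //; apply: linform_homog.
exists (h * 'X_c ^+ (k - #|I|.-1)); split.
- have -> : k = (#|I|.-1 + 1 * (k - #|I|.-1))%N by lia.
  apply: dhomogM => //; rewrite -[X in (_ * X)%N]/((k - #|I|.-1)%N) addKn mul1n -{2}[(k - _)%N]mul1n.
  by apply: dhomogMn; rewrite dhomogX /= mdeg1.
- rewrite mevalM mulf_neq0 //; last by rewrite rmorphXn /= mevalXU expf_neq0.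
  by rewrite rmorph_prod; apply/prodf_neq0 => l /Hb[].
- move=> l lj; rewrite mevalM rmorph_prod (bigD1 l) //=.
  by have [-> _] := Hb l lj; rewrite !mul0r.
Qed.

Lemma interpolation j k : (#|I| <= k.+1)%N ->
  exists h, h \is k.-homog /\ forall l, h.@[q l] = (l == j)%:R.
Proof.
move=> Ik; have [h [hk hj hl]] := partial_separation j Ik.
exists ((h.@[q j])^-1 *: h); split; first exact: rpredZ.
move=> l; rewrite mevalZ; case: (eqVneq l j) => [->|lj]; first by rewrite mulVf.
by rewrite (hl _ lj) mulr0.
Qed.

(** A separating form of degree [k - 1] times a linear form that vanishes at [q j] but not at
    [v]. *)
Lemma tangent_interpolation j v k : (#|I| <= k)%N -> ~ propor (q j) v ->
  exists h, [/\ h \is k.-homog, (forall l, h.@[q l] = 0) & \sum_l h^`M(l).@[q j] * v l != 0].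
Proof.
case: k => [|k] Ik nv; first by move: Ik; rewrite leqn0 -[#|I|]prednK // (cardD1 j).
have [h [hk hj hl]] := partial_separation j Ik.
have [b [bq bv]] := separating_linform (q0 j) nv.
exists (linform b * h); split.
- by rewrite -add1n; apply: dhomogM => //; apply: linform_homog.
- move=> l; rewrite mevalM; have [->|lj] := eqVneq l j; first by rewrite bq mul0r.
  by rewrite hl // mulr0.
- under eq_bigr do rewrite mderivM mevalD !mevalM bq mul0r addr0 mderiv_linform mevalC mulrAC.
  by rewrite -mulr_suml mulf_neq0 // -meval_linform.
Qed.

End Interpolation.

(** On forms of degree [k], functionals killing the Jacobian ideal factor through a space of
    dimension at most [d], so more than [d] of them are dependent. *)
Lemma corank_functionals f k d (I : finType) (lam : I -> {linear {mpoly K[n]} -> K^o})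
    (h : I -> {mpoly K[n]}) :
  corank_le f k d -> (d < #|I|)%N ->
  (forall j i a, lam j (a * f^`M(i)) = 0) -> (forall j, h j \is k.-homog) ->
  exists c : I -> K, (exists i, c i != 0) /\ forall j, \sum_i c i * lam i (h j) = 0.
Proof.
move=> [T HT] dI lam0 hk; have [c [c0 Hc]] := kernel_exists (fun i l => lam i (T l)) dI.
exists c; split=> // j; have [a [b Hb]] := HT _ (hk j).
have -> : h j = \sum_i b i * f^`M(i) + \sum_l a l *: T l by rewrite -Hb subrK.
have E i : lam i (\sum_i b i * f^`M(i) + \sum_l a l *: T l) = \sum_l a l * lam i (T l).
  rewrite linearD !linear_sum big1 ?add0r => [|i' _]; last exact: lam0.
  by apply: eq_bigr => l _; rewrite linearZ.
under eq_bigr do rewrite E mulr_sumr.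
rewrite exchange_big big1 //= => l _; under eq_bigr do rewrite mulrCA.
by rewrite -mulr_sumr Hc mulr0.
Qed.

Definition dir_deriv q v p : K^o := \sum_l p^`M(l).@[q] * v l.

Lemma dir_deriv_linear q v : linear (dir_deriv q v).
Proof.
move=> c p p'; rewrite /dir_deriv /GRing.scale /= mulr_sumr -big_split; apply: eq_bigr => l _ /=.
by rewrite mderivD mderivZ mevalD mevalZ mulrDl mulrA.
Qed.

HB.instance Definition _ q v :=
  GRing.isLinear.Build K {mpoly K[n]} K^o _ (dir_deriv q v) (dir_deriv_linear q v).

Definition evalat q p : K^o := p.@[q].

Lemma evalat_linear q : linear (evalat q).
Proof. by move=> c p p'; rewrite /evalat mevalD mevalZ. Qed.

HB.instance Definition _ q :=
  GRing.isLinear.Build K {mpoly K[n]} K^o _ (evalat q) (evalat_linear q).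

Section Criterion.
Variables (f : {mpoly K[n]}) (k d : nat) (q : 'I_d -> 'I_n -> K).
Hypothesis cork : corank_le f k d.
Hypothesis dk : (d < k)%N.
Hypothesis q0 : forall l, exists i, q l i != 0.
Hypothesis qne : forall l l', l != l' -> ~ propor (q l) (q l').
Hypothesis qsing : forall l i, f^`M(i).@[q l] = 0.

(** Evaluations at singular points kill the Jacobian ideal and are independent in degree [k]; a
    further singular point would make [d + 1] of them. *)
Lemma corank_only_sing v : (exists i, v i != 0) -> (forall i, f^`M(i).@[v] = 0) ->
  exists l, propor (q l) v.
Proof.
move=> v0 vs; apply: contrapT => /forallNP H.
pose r (o : option 'I_d) := if o is Some l then q l else v.
have r0 o : exists i, r o i != 0 by case: o => [l|] /=.
have rne o o' : o != o' -> ~ propor (r o) (r o').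
  case: o o' => [l|] [l'|] ll'; [exact: (qne ll')|exact: (H l)| |by rewrite eqxx in ll'].
  move=> [c /= Hc]; apply: (H l'); exists c^-1 => i; rewrite Hc mulKf //.
  by apply/eqP => c0; have [j] := q0 l'; rewrite Hc c0 mul0r eqxx.
have Ik : (#|{: option 'I_d}| <= k.+1)%N by rewrite card_option card_ord; lia.
have /choice[h Hh] := fun o => interpolation r0 rne o Ik.
have [|j i a|j|c [[o co] Hc]] :=
    @corank_functionals f k d _ (fun o => evalat (r o)) h cork; rewrite ?card_option ?card_ord //.
- by rewrite /= /evalat mevalM; case: j => [l|] /=; rewrite ?qsing ?vs mulr0.
- by have [] := Hh j.
- suff E : \sum_i c i * evalat (r i) (h o) = c o by rewrite -E Hc eqxx in co.
  rewrite (bigD1 o) //= big1 => [|i io]; have [_ E] := Hh o; rewrite /evalat E.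
    by rewrite eqxx mulr1 addr0.
  by rewrite (negPf io) mulr0.
Qed.

(** For [v] in the kernel of the Hessian at a singular point, the derivative along [v] kills the
    Jacobian ideal too, and it is independent of the [d] evaluations unless [v] is proportional to
    the point. *)
Lemma corank_nodal l : nodal_at f (q l).
Proof.
split=> // v Hv; apply: contrapT => nv.
have Ik : (#|{: 'I_d}| <= k.+1)%N by rewrite card_ord; lia.
have /choice[h Hh] := fun l => interpolation q0 qne l Ik.
have Ik' : (#|{: 'I_d}| <= k)%N by rewrite card_ord; lia.
have [t [tk tq tv]] := tangent_interpolation q0 qne Ik' nv.
pose lam (o : option 'I_d) : {linear {mpoly K[n]} -> K^o} :=
  if o is Some l' then evalat (q l') else dir_deriv (q l) v.
pose g o := if o is Some l' then h l' else t.
have [|j i a|j|c [[o co] Hc]] := @corank_functionals f k d _ lam g cork;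
    rewrite ?card_option ?card_ord //.
- case: j => [l'|] /=; first by rewrite /evalat mevalM qsing mulr0.
  rewrite /dir_deriv; under eq_bigr do rewrite mderivM mevalD !mevalM qsing mulr0 add0r -mulrA.
  by rewrite -mulr_sumr Hv mulr0.
- by case: j => [l'|] /=; rewrite ?tk //; case: (Hh l').
have cN : c None = 0.
  have := Hc None; rewrite (bigD1 None) //= big1 => [|[l'|] // _]; last first.
    by rewrite /= /evalat tq mulr0.
  by rewrite addr0 => /eqP; rewrite mulf_eq0 (negPf tv) orbF => /eqP.
case: o co => [l'|]; last by rewrite cN eqxx.
have := Hc (Some l'); rewrite (bigD1 (Some l')) //= big1 => [|[l''|] //= ll'].
- by rewrite addr0 /= /evalat; have [_ ->] := Hh l'; rewrite eqxx mulr1 => ->; rewrite eqxx.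
- rewrite /= /evalat; have [_ ->] := Hh l'.
  by case: (eqVneq l'' l') ll' => [->|_ _]; [rewrite eqxx|rewrite mulr0].
- by rewrite cN mul0r.
Qed.

End Criterion.

End Points.

Lemma homog_exp (K : fieldType) (n : nat) (l : {mpoly K[n]}) k : l \is 1.-homog -> l ^+ k \is k.-homog.
Proof. by move=> h; rewrite -{2}[k]mul1n; apply: dhomogMn. Qed.

Section Corank.
Variables (K : closedFieldType) (n : nat).
Hypothesis Kbig : large_fibers K.
Implicit Types (q v : 'I_n -> K) (p f g h : {mpoly K[n]}).

Lemma genby_homog_of_monomials (I : set {mpoly K[n]}) k g : idealP I ->
  (forall m : 'X_{1..n}, mdeg m = k -> I 'X_[m]) -> g \is k.-homog -> I g.
Proof.
move=> hI HI hg; rewrite [g]mpolyE big_seq; apply: ideal_sum => // m /(dhomog_mf hg) /= mk.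
by rewrite -mul_mpolyC; case: (hI) => _ _; apply; apply: HI.
Qed.

Section Nodes.
Variables (I : finType) (J : I -> {mpoly K[n]}) (dJ : I -> nat) (d : nat).
Variables (q : 'I_d -> 'I_n -> K) (ell : {mpoly K[n]}) (a : nat) (e : 'I_d -> {mpoly K[n]}).
Hypothesis hJ : forall i, J i \is (dJ i).-homog.
Hypothesis Jzero : forall v, (forall i, (J i).@[v] = 0) -> (forall i, v i = 0) \/ exists l, propor (q l) v.
Hypothesis Jq : forall l i, (J i).@[q l] = 0.
(** Near [q l] the ideal contains all forms vanishing at [q l]: its zero scheme is reduced there. *)
Hypothesis Jcolon : forall l, exists h, h.@[q l] != 0 /\
  forall b g, g \is b.-homog -> g.@[q l] = 0 -> genby J (h * g).
Hypothesis hell : ell \is 1.-homog.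
Hypothesis ellq : forall l, ell.@[q l] != 0.
Hypothesis he : forall l, e l \is (a).-homog.
Hypothesis eq : forall l l', (e l).@[q l'] = (l == l')%:R.

Lemma genby_vanish l g : genby J g -> g.@[q l] = 0.
Proof.
by move=> [c ->]; rewrite raddf_sum big1 //= => i _; rewrite mevalM Jq mulr0.
Qed.

Lemma homog_colon : exists b (H : 'I_d -> {mpoly K[n]}),
  [/\ forall l, H l \is b.-homog, forall l, (H l).@[q l] != 0,
      forall l l', l != l' -> (H l).@[q l'] = 0
    & forall l k g, g \is k.-homog -> g.@[q l] = 0 -> genby J (H l * g)].
Proof.
have /choice[bh Hb] : forall l, exists bh : nat * {mpoly K[n]},
    [/\ bh.2 \is (fst bh).-homog, bh.2.@[q l] != 0
      & forall k g, g \is k.-homog -> g.@[q l] = 0 -> genby J (bh.2 * g)].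
  move=> l; have [h [hq hg]] := Jcolon l.
  have [b hb] : exists b, (pihomog mdeg b h).@[q l] != 0.
    apply: contrapT => /forallNP H; move/negP: hq; apply.
    rewrite (@pihomog_partitionE _ _ mdeg _ h (leqnn _)) raddf_sum big1 //= => b _.
    by apply/eqP/negPn/negP; apply: H.
  exists (b, pihomog mdeg b h); split=> //=; first exact: pihomogP.
  move=> k g gk gq; have := genby_pihomog (b + k) hJ (hg _ _ gk gq).
  by rewrite (pihomogM _ _ gk) leq_addl addnK.
pose b := \sum_l (bh l).1.
have lb l : ((bh l).1 <= b)%N by rewrite /b (bigD1 l) //= leq_addr.
exists b, (fun l => (bh l).2 * ell ^+ (b - (bh l).1)); split.
- move=> l; rewrite -[X in X.-homog](subnKC (lb l)); have [h1 _ _] := Hb l.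
  exact: dhomogM h1 (homog_exp _ hell).
- move=> l; have [_ h1 _] := Hb l.
  by rewrite mevalM mulf_neq0 // rmorphXn /= expf_neq0.
(* The product with [e l'] lies in the ideal, so it vanishes at [q l'], where [e l'] is [1]. *)
- move=> l l' ll'; have [_ _ h] := Hb l.
  have := genby_vanish l' (h _ _ (he l') _); rewrite !mevalM !eq eqxx mulr1 => ->; rewrite ?mul0r //.
  by rewrite eq_sym (negPf ll').
- move=> l k g gk gq; have [_ _ h] := Hb l.
  rewrite mulrAC mulrC; have [_ _ JM] := genby_ideal J; apply: JM.
  exact: h gk gq.
Qed.

(** With the [H l] added, the ideal has no zero left and contains all forms of large degree. Modulo
    [J] a multiple of [H l] depends only on the value of the multiplier at [q l], so the
    [ell ^+ (k - b) * H l] span. Applied to the [ell ^+ (k - a) * e l], this shows them to be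
    nonzero multiples of the former, so they span as well. *)
Lemma corank_nodes : exists k0, forall k g, (k0 <= k)%N -> g \is k.-homog ->
  exists c : 'I_d -> K, genby J (g - \sum_l c l *: (ell ^+ (k - a) * e l)).
Proof.
have [b [H [Hb Hq H0 HJ]]] := homog_colon.
pose J2 (s : I + 'I_d) := match s with inl i => J i | inr l => H l end.
pose d2 (s : I + 'I_d) := match s with inl i => dJ i | inr l => b end.
have hJ2 s : J2 s \is (d2 s).-homog by case: s.
have [|k1 Hk1] := @projective_nullstellensatz K n _ Kbig (genby_ideal J2).
  move=> v Hv.
  have [//|[l [c Hc]]] : (forall i, v i = 0) \/ exists l, propor (q l) v.
    by apply: Jzero => i; apply: Hv; apply: (genby_gen J2 (inl i)).
  have : (H l).@[v] = 0 by apply: Hv; apply: (genby_gen J2 (inr l)).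
  rewrite (meval_eq _ Hc) (meval_scale _ _ (Hb l)) => /eqP.
  rewrite mulf_eq0 (negPf (Hq l)) orbF expf_eq0 => /andP[_ /eqP c0].
  by move=> i; rewrite Hc c0 mul0r.
have [J0 JD JM] := genby_ideal J.
have ellX k l : (ell ^+ k).@[q l] = ell.@[q l] ^+ k by rewrite rmorphXn.
have step k g : (k1 + b <= k)%N -> g \is k.-homog ->
    exists c : 'I_d -> K, genby J (g - \sum_l c l *: (ell ^+ (k - b) * H l)).
  move=> hk hg.
  have : genby J2 g.
    apply: genby_homog_of_monomials hg; first exact: genby_ideal.
    by move=> m mk; apply: Hk1; rewrite mk; lia.
  case/(genby_homog hJ2 hg) => u [eg hu].
  pose c l := (u (inr l)).@[q l] / ell.@[q l] ^+ (k - b).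
  exists c.
  have -> : g - \sum_l c l *: (ell ^+ (k - b) * H l) = \sum_i u (inl i) * J i +
      \sum_l H l * (u (inr l) - c l *: ell ^+ (k - b)).
    rewrite {1}eg big_sumType /= -addrA -sumrB; congr (_ + _); apply: eq_bigr => l _.
    by rewrite mulrBr -scalerAr ![H l * _]mulrC.
  apply: JD; first by exists (fun i => u (inl i)).
  apply: ideal_sum => [|l _]; first exact: genby_ideal.
  apply: (HJ l (k - b)%N).
    rewrite rpredB ?(hu (inr l)).1 // rpredZ // homog_exp //.
  by rewrite mevalB mevalZ ellX /c divfK ?subrr // expf_neq0.
exists (k1 + b + a)%N => k g hk hg.
have hk' : (k1 + b <= k)%N by lia.
have /choice[s Hs] : forall l, exists s : K, s != 0 /\
    genby J (ell ^+ (k - a) * e l - s *: (ell ^+ (k - b) * H l)).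
  move=> l; have hT : ell ^+ (k - a) * e l \is k.-homog.
    rewrite -[X in X.-homog](_ : k - a + a = k)%N; last by lia.
    exact: dhomogM (homog_exp _ hell) (he l).
  have [c Hc] := step _ _ hk' hT.
  have E l' : c l' * (ell.@[q l'] ^+ (k - b) * (H l').@[q l']) = ell.@[q l'] ^+ (k - a) * (l == l')%:R.
    have := genby_vanish l' Hc; rewrite mevalB mevalM ellX eq [X in _ - X]raddf_sum (bigD1 l') //= [X in _ - (_ + X)]big1 => [|j jl].
      by rewrite addr0 mevalZ mevalM ellX => /eqP; rewrite subr_eq0 => /eqP.
    by rewrite mevalZ mevalM (H0 _ _ jl) !mulr0.
  have c0 l' : l != l' -> c l' = 0.
    move=> /negPf ll'; have /eqP := E l'; rewrite ll' mulr0 mulf_eq0 => /orP[/eqP//|].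
    by rewrite mulf_eq0 expf_eq0 (negPf (ellq _)) andbF (negPf (Hq _)).
  exists (c l); split.
    apply/eqP => cl; have /eqP := E l; rewrite cl mul0r eqxx mulr1 eq_sym expf_eq0.
    by rewrite (negPf (ellq _)) andbF.
  move: Hc; rewrite (bigD1 l) //= big1 ?addr0 // => j jl.
  by rewrite c0 ?scale0r // eq_sym.
have [c Hc] := step _ _ hk' hg.
exists (fun l => c l / s l).
have -> : g - \sum_l (c l / s l) *: (ell ^+ (k - a) * e l) =
    (g - \sum_l c l *: (ell ^+ (k - b) * H l)) -
    \sum_l (c l / s l)%:MP * (ell ^+ (k - a) * e l - s l *: (ell ^+ (k - b) * H l)).
  rewrite -addrA -opprD -big_split; congr (_ - _); apply: eq_bigr => l _ /=.
  have [sl _] := Hs l; rewrite mulrBr mul_mpolyC addrC mul_mpolyC scalerA divfK //.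
  by rewrite subrK.
apply: (idealB (genby_ideal J) Hc).
apply: ideal_sum => [|l _]; first exact: genby_ideal.
by apply: JM; have [] := Hs l.
Qed.

End Nodes.

Lemma left_inverse_exists (m p : nat) (A : 'M[K]_(m, p)) :
  (forall w : 'cV_p, A *m w = 0 -> w = 0) -> exists B, B *m A = 1%:M.
Proof.
move=> Ainj; have /row_fullP[B HB] : row_full A; last by exists B.
rewrite -cokermx_eq0; apply/eqP/matrixP => i j.
have -> : cokermx A i j = (col j (cokermx A)) i 0 by rewrite [RHS]mxE.
have -> : col j (cokermx A) = 0 by apply: Ainj; rewrite colE mulmxA mulmx_coker mul0mx.
by rewrite !mxE.
Qed.

(** The derivatives are combinations of the linear forms [L l] that vanish at [q], and at a node the
    coefficient matrix has a left inverse at [q]. By Cramer's rule [\det C * L l] is in the Jacobian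
    ideal, where [\det C] takes the value [1] at [q]. *)
Lemma nodal_colon f d q : f \is d.-homog -> (exists i, q i != 0) -> nodal_at f q ->
  exists h, h.@[q] != 0 /\
    forall b g, g \is b.-homog -> g.@[q] = 0 -> genby (fun i => f^`M(i)) (h * g).
Proof.
move=> hf [c qc] [fq fhess].
set J := fun i => f^`M(i); have [J0 JD JM] := genby_ideal J.
pose L l : {mpoly K[n]} := q c *: 'X_l - q l *: 'X_c.
have dec b g : g \is b.-homog -> g.@[q] = 0 -> exists A : 'I_n -> {mpoly K[n]},
    q c ^+ b *: g = \sum_l A l * L l.
  by move=> hg gq; have [A ->] := homog_point_decomp q c hg; exists A; rewrite gq scale0r add0r.
have /choice[A HA] := fun i => dec _ _ (mderiv_homog i hf) (fq i).
(* As [L c] is [0], column [c] of [A] is arbitrary; the extra row records [L c = 0] and makes the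
   matrix injective at [q]. *)
pose M : 'M[{mpoly K[n]}]_(n + 1, n) := col_mx (\matrix_(i, l) A i l) (\row_l (l == c)%:R).
pose ev := map_mx (meval q).
have [B HB] : exists B, B *m ev _ _ M = 1%:M.
  apply: left_inverse_exists => w Mw.
  have Aw i : \sum_l (A i l).@[q] * w l 0 = 0.
    have := congr1 (fun N : 'cV_ _ => N (lshift 1 i) 0) Mw; rewrite !mxE => E; rewrite -[RHS]E.
    by apply: eq_bigr => l _; rewrite mxE col_mxEu mxE.
  have wc : w c 0 = 0.
    have := congr1 (fun N : 'cV_ _ => N (rshift n 0) 0) Mw; rewrite !mxE => E; rewrite -[RHS]E.
    rewrite (bigD1 c) //= big1 => [|l lc]; rewrite mxE col_mxEd mxE.
      by rewrite eqxx meval1 mul1r addr0.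
    by rewrite (negPf lc) meval0 mul0r.
  have [|t Ht] := fhess (fun l => w l 0).
    move=> i; apply: (mulfI (expf_neq0 d.-1 qc)); rewrite mulr0 mulr_sumr.
    (* Differentiating the decomposition at [q], where the [L j] vanish, expresses the Hessian
       through the values of [A]. *)
    have E l : q c ^+ d.-1 * (f^`M(i)^`M(l).@[q] * w l 0) =
        \sum_j (A i j).@[q] * (((j == l)%:R * q c - (c == l)%:R * q j) * w l 0).
      rewrite mulrA -mevalZ -mderivZ HA mderiv_sum meval_sum mulr_suml; apply: eq_bigr => j _ /=.
      rewrite mderivM mevalD !mevalM /L mderivB !mderivZ !mderiv_XU !(mevalB, mevalZ).
      have mb (x : bool) : (x%:R : {mpoly K[n]}).@[q] = x%:R by case: x; rewrite ?meval1 ?meval0.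
      rewrite !mevalXU !mb.
      by rewrite [l == j]eq_sym [l == c]eq_sym; ring.
    under eq_bigr do rewrite E.
    rewrite exchange_big /=.
    transitivity (q c * \sum_l (A i l).@[q] * w l 0); last by rewrite Aw mulr0.
    rewrite mulr_sumr; apply: eq_bigr => j _.
    rewrite -mulr_sumr mulrCA; congr (_ * _).
    under eq_bigr do rewrite mulrBl -!mulrA.
    rewrite sumrB (bigD1 j) //= eqxx mul1r big1 => [|l /negPf lj]; last by rewrite eq_sym lj mul0r.
    rewrite (bigD1 c) //= eqxx mul1r big1 => [|l /negPf lc]; last by rewrite eq_sym lc mul0r.
    by rewrite wc !addr0 mulr0 subr0.
  have t0 : t = 0.
    by have /eqP := Ht c; rewrite wc eq_sym mulf_eq0 (negPf qc) orbF => /eqP.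
  by apply/colP => l; rewrite mxE Ht t0 mul0r.
pose BB := map_mx (mpolyC n (R := K)) B.
pose C := BB *m M.
have evC : ev _ _ C = 1%:M.
  rewrite /C /ev map_mxM -HB; congr (_ *m _).
  by apply/matrixP => i j; rewrite /BB !mxE /= mevalC.
have hq : (\det C).@[q] = 1 by rewrite -det_map_mx -/(ev _ _ C) evC det1.
pose Lv : 'cV[{mpoly K[n]}]_n := \col_l L l.
have MLJ i : genby J ((M *m Lv) i 0).
  rewrite mxE; case: (splitP i) => [j|j] ej.
    have -> : i = lshift 1 j by apply/val_inj.
    have -> : \sum_l M (lshift 1 j) l * Lv l 0 = (q c ^+ d.-1)%:MP * J j.
      by rewrite mul_mpolyC HA; apply: eq_bigr => l _; rewrite /M col_mxEu !mxE.
    by apply: JM; apply: genby_gen.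
  have -> : i = rshift n j by apply/val_inj.
  rewrite big1 => [|l _]; first exact: J0.
  rewrite /M col_mxEd !mxE; have [->|_] := eqVneq l c; last by rewrite mul0r.
  by rewrite /L subrr mulr0.
have hL l : genby J (\det C * L l).
  have -> : \det C * L l = (\adj C *m BB *m (M *m Lv)) l 0.
    by rewrite -mulmxA (mulmxA BB) -/C mulmxA mul_adj_mx mul_scalar_mx !mxE.
  by rewrite mxE; apply: ideal_sum => [|j _]; [exact: genby_ideal|apply: JM].
exists (\det C); split; first by rewrite hq oner_eq0.
move=> b g hg gq; have [D HD] := dec _ _ hg gq.
have -> : \det C * g = (q c ^- b)%:MP * \sum_l D l * (\det C * L l).
  have -> : \sum_l D l * (\det C * L l) = \det C * (q c ^+ b *: g).
    by rewrite HD mulr_sumr; apply: eq_bigr => l _; rewrite mulrCA.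
  by rewrite -scalerAr mul_mpolyC scalerA mulVf ?scale1r // expf_neq0.
by apply: (JM); apply: ideal_sum => [|l _]; [exact: genby_ideal|apply: JM].
Qed.

End Corank.

(** * Linear substitutions *)

Section VectorPoints.
Variables (K : fieldType) (V : vectType K).

Lemma rep_neq0 (x : pspace V) : rep x != 0.
Proof.
case: x => L dL; rewrite /rep /= vpick0; apply/eqP => L0.
by move: dL; rewrite L0 dimv0.
Qed.

Lemma mkpoint (v : V) : v != 0 ->
  exists x : pspace V, val x = <[v]>%VS /\ exists2 c, c != 0 & rep x = c *: v.
Proof.
move=> v0; have d1 : \dim <[v]> == 1%N by rewrite dim_vline v0.
exists (exist _ <[v]>%VS d1); split=> //.
have := memv_pick <[v]>%VS => /vlineP[c ec]; exists c => //.
by apply: contraTneq v0 => c0; move: ec; rewrite c0 scale0r => /eqP; rewrite vpick0 -dimv_eq0 (eqP d1).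
Qed.

Lemma rep_line (x : pspace V) : val x = <[rep x]>%VS.
Proof.
apply/esym/eqP; rewrite eqEdim -memvE memv_pick dim_vline rep_neq0.
by rewrite (eqP (valP x)).
Qed.

Lemma pspace_eq (x y : pspace V) c : rep y = c *: rep x -> x = y.
Proof.
move=> e; apply/val_inj; rewrite /= (rep_line x) (rep_line y) e.
have c0 : c != 0 by apply: contraTneq (rep_neq0 y) => c0; rewrite e c0 scale0r eqxx.
apply/eqP; rewrite eqEsubv -!memvE; apply/andP; split.
  by apply/vlineP; exists c^-1; rewrite scalerA mulVf // scale1r.
by apply/vlineP; exists c.
Qed.

End VectorPoints.

Section Substitution.
Variable K : closedFieldType.
Hypothesis Kbig : large_fibers K.

Definition vmul (a b : nat) (v : 'I_a -> K) (N : 'M[K]_(a, b)) : 'I_b -> K :=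
  fun j => \sum_i v i * N i j.

Definition lsubst (a b : nat) (N : 'M[K]_(a, b)) (f : {mpoly K[b]}) : {mpoly K[a]} :=
  f \mPo [tuple \sum_(i < a) N i j *: 'X_i | j < b].

Lemma meval_lsubst a b (N : 'M_(a, b)) f v : (lsubst N f).@[v] = f.@[vmul v N].
Proof.
rewrite /lsubst comp_mpoly_meval; apply: meval_eq => j; rewrite tnth_mktuple meval_sum.
by apply: eq_bigr => i _; rewrite mevalZ mevalXU mulrC.
Qed.

Lemma vmul_mul a b c (v : 'I_a -> K) (M : 'M_(a, b)) (N : 'M_(b, c)) :
  vmul (vmul v M) N =1 vmul v (M *m N).
Proof.
move=> j; rewrite /vmul; under eq_bigr do rewrite mulr_suml.
rewrite exchange_big; apply: eq_bigr => i _ /=; rewrite mxE mulr_sumr.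
by apply: eq_bigr => k _; rewrite mulrA.
Qed.

Lemma vmul1 a (v : 'I_a -> K) : vmul v 1%:M =1 v.
Proof.
move=> j; rewrite /vmul (bigD1 j) //= mxE eqxx mulr1 big1 ?addr0 // => i /negPf ij.
by rewrite mxE ij mulr0.
Qed.

Lemma vmulK a (v : 'I_a -> K) (N : 'M_a) : N \in unitmx -> vmul (vmul v N) (invmx N) =1 v.
Proof. by move=> uN j; rewrite vmul_mul mulmxV // vmul1. Qed.

Lemma vmulKV a (v : 'I_a -> K) (N : 'M_a) : N \in unitmx -> vmul (vmul v (invmx N)) N =1 v.
Proof. by move=> uN j; rewrite vmul_mul mulVmx // vmul1. Qed.

Lemma vmul_ext a b (v w : 'I_a -> K) (N : 'M_(a, b)) : v =1 w -> vmul v N =1 vmul w N.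
Proof. by move=> e j; apply: eq_bigr => i _; rewrite e. Qed.

Lemma vmulZ a b c (v : 'I_a -> K) (N : 'M_(a, b)) :
  vmul (fun i => c * v i) N =1 fun j => c * vmul v N j.
Proof. by move=> j; rewrite /vmul mulr_sumr; apply: eq_bigr => i _; rewrite mulrA. Qed.

Lemma lsubst_mul a b c (M : 'M_(a, b)) (N : 'M_(b, c)) f :
  lsubst M (lsubst N f) = lsubst (M *m N) f.
Proof.
apply: mpoly_eval_inj => // v; rewrite !meval_lsubst; apply: meval_eq; exact: vmul_mul.
Qed.

Lemma lsubst1 a (f : {mpoly K[a]}) : lsubst 1%:M f = f.
Proof. by apply: mpoly_eval_inj => // v; rewrite meval_lsubst; apply: meval_eq; apply: vmul1. Qed.

Lemma lsubstK a (N : 'M_a) f : N \in unitmx -> lsubst N (lsubst (invmx N) f) = f.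
Proof. by move=> uN; rewrite lsubst_mul mulmxV // lsubst1. Qed.

Lemma lsubstKV a (N : 'M_a) f : N \in unitmx -> lsubst (invmx N) (lsubst N f) = f.
Proof. by move=> uN; rewrite lsubst_mul mulVmx // lsubst1. Qed.

Lemma lsubst_linear a b (N : 'M_(a, b)) : linear (lsubst N).
Proof. by move=> c p q; rewrite /lsubst comp_mpolyD comp_mpolyZ. Qed.

HB.instance Definition _ a b (N : 'M_(a, b)) :=
  GRing.isLinear.Build K {mpoly K[b]} {mpoly K[a]} _ (lsubst N) (lsubst_linear N).

Lemma comp_mpoly_homog a b (f : {mpoly K[b]}) (t : b.-tuple {mpoly K[a]}) d :
  (forall j, tnth t j \is 1.-homog) -> f \is d.-homog -> f \mPo t \is d.-homog.
Proof.
move=> ht hf; rewrite comp_mpolyEX big_seq; apply: rpred_sum => m /(dhomog_mf hf) /= <-.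
apply: rpredZ; rewrite comp_mpolyX mdegE.
by elim/big_rec2: _ => [|j k p _ Hp]; [exact: dhomog1|apply: dhomogM => //; apply: homog_exp].
Qed.

Lemma lsubst_homog a b (N : 'M_(a, b)) f d : f \is d.-homog -> lsubst N f \is d.-homog.
Proof.
by apply: comp_mpoly_homog => j; rewrite tnth_mktuple; apply: linform_homog.
Qed.

Lemma mderiv_lsubst a b (N : 'M_(a, b)) f i :
  (lsubst N f)^`M(i) = \sum_j N i j *: lsubst N f^`M(j).
Proof.
rewrite /lsubst mderiv_comp; apply: eq_bigr => j _.
by rewrite tnth_mktuple -/(linform _) mderiv_linform mulrC mul_mpolyC.
Qed.

Lemma lsubst_mderiv a (N : 'M_a) f j : N \in unitmx ->
  lsubst N f^`M(j) = \sum_i invmx N j i *: (lsubst N f)^`M(i).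
Proof.
move=> uN; under eq_bigr do rewrite mderiv_lsubst scaler_sumr.
rewrite exchange_big /= (bigD1 j) //= [X in _ + X]big1 => [|k kj].
  under eq_bigr do rewrite scalerA.
  rewrite -scaler_suml (_ : \sum_i _ = (invmx N *m N) j j); last by rewrite mxE.
  by rewrite mulVmx // mxE eqxx scale1r addr0.
under eq_bigr do rewrite scalerA.
rewrite -scaler_suml (_ : \sum_i _ = (invmx N *m N) j k); last by rewrite mxE.
by rewrite mulVmx // mxE eq_sym (negPf kj) scale0r.
Qed.

Lemma vmul_inj a (N : 'M_a) (v w : 'I_a -> K) : N \in unitmx -> vmul v N =1 vmul w N -> v =1 w.
Proof. by move=> uN e i; rewrite -(vmulK v uN) -(vmulK w uN); apply: vmul_ext. Qed.

Lemma mulmx_col_inj a (N : 'M_a) (w : 'I_a -> K) : N \in unitmx ->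
  (forall i, \sum_j N i j * w j = 0) -> forall j, w j = 0.
Proof.
move=> uN H j; have : N *m \col_j w j = 0.
  by apply/colP => i; rewrite !mxE -[RHS](H i); apply: eq_bigr => k _; rewrite mxE.
move/(congr1 (mulmx (invmx N))); rewrite mulKmx // mulmx0 => /colP/(_ j).
by rewrite !mxE.
Qed.

Lemma sing_lsubst a (N : 'M_a) f q : N \in unitmx ->
  (forall i, f^`M(i).@[vmul q N] = 0) <-> (forall i, (lsubst N f)^`M(i).@[q] = 0).
Proof.
move=> uN; split=> H i.
  rewrite mderiv_lsubst meval_sum big1 // => j _; by rewrite mevalZ meval_lsubst H mulr0.
rewrite -meval_lsubst lsubst_mderiv // meval_sum big1 // => j _.
by rewrite mevalZ H mulr0.
Qed.

Lemma nodal_lsubst a (N : 'M_a) f q : N \in unitmx ->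
  nodal_at f (vmul q N) -> nodal_at (lsubst N f) q.
Proof.
move=> uN [fq fh]; split; first exact/(sing_lsubst _ _ uN).
move=> v Hv.
have [|c Hc] := fh (vmul v N).
  apply: (@mulmx_col_inj _ N (fun i => \sum_l f^`M(i)^`M(l).@[vmul q N] * vmul v N l) uN) => i.
  rewrite -[RHS](Hv i).
  rewrite [RHS](eq_bigr (fun l => \sum_j \sum_k N i j * (f^`M(j)^`M(k).@[vmul q N] * (N l k * v l)))); last first.
    move=> l _; rewrite mderiv_lsubst mderiv_sum meval_sum mulr_suml; apply: eq_bigr => j _.
    rewrite mderivZ mevalZ mderiv_lsubst meval_sum -mulrA mulr_suml mulr_sumr.
    by apply: eq_bigr => k _; rewrite mevalZ meval_lsubst; congr (_ * _); rewrite mulrA [N l k * _]mulrC.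
  rewrite [RHS]exchange_big; apply: eq_bigr => j _ /=.
  rewrite [RHS]exchange_big mulr_sumr; apply: eq_bigr => k _ /=.
  rewrite -!mulr_sumr; congr (_ * (_ * _)); rewrite /vmul.
  by apply: eq_bigr => l _; rewrite mulrC.
exists c; apply: (vmul_inj uN) => j; rewrite Hc vmulZ //.
Qed.

Lemma nodal_scale a (f : {mpoly K[a]}) d q q' c : f \is d.-homog -> c != 0 ->
  q' =1 (fun i => c * q i) -> nodal_at f q -> nodal_at f q'.
Proof.
move=> hf c0 e [fq fh]; split.
  by move=> i; rewrite (meval_eq _ e) (meval_scale _ _ (mderiv_homog i hf)) fq mulr0.
move=> v Hv; have [i|b Hb] := fh v.
  apply: (mulfI (expf_neq0 d.-2 c0)); rewrite mulr0 mulr_sumr -[RHS](Hv i).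
  apply: eq_bigr => l _; rewrite mulrA; congr (_ * _).
  by rewrite (meval_eq _ e) (meval_scale _ _ (mderiv_homog l (mderiv_homog i hf))).
by exists (b / c) => i; rewrite Hb e mulrA divfK.
Qed.

End Substitution.

(** * Nodes in local coordinates *)

Lemma mcoeff_pihomog (K : nzRingType) (n : nat) (mf : measure n) k (p : {mpoly K[n]}) m :
  (pihomog mf k p)@_m = if mf m == k then p@_m else 0.
Proof.
case: eqVneq => [<-|mk]; last by apply: dhomog_nemf_coeff (pihomogP mf k p) mk.
have hN : (mmeasure mf p <= (mmeasure mf p + mf m).+1)%N by lia.
have mN : (mf m < (mmeasure mf p + mf m).+1)%N by lia.
have := congr1 (mcoeff m) (pihomog_partitionE hN); rewrite raddf_sum (bigD1 (Ordinal mN)) //=.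
rewrite [X in _ + X]big1 ?addr0 // => j jm.
apply: dhomog_nemf_coeff (pihomogP mf j p) _; apply: contraNneq jm => e; exact/eqP/val_inj.
Qed.

Lemma pihomog_mderiv (K : fieldType) (n k : nat) (p : {mpoly K[n]}) i :
  (pihomog mdeg k.+1 p)^`M(i) = pihomog mdeg k p^`M(i).
Proof.
apply/mpolyP => m; rewrite mcoeff_deriv !mcoeff_pihomog mcoeff_deriv /= mdegD mdeg1 addn1 eqSS.
by case: ifP => // _; rewrite mul0rn.
Qed.

Lemma pihomog_mdeg0 (K : fieldType) (n : nat) (p : {mpoly K[n]}) :
  pihomog mdeg 0 p = (p.@[fun=> 0])%:MP.
Proof.
have E : p.@[fun=> 0] = p@_0%MM.
  elim/mpolyind: p => [|c m p _ _ IH]; first by rewrite meval0 mcoeff0.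
  rewrite mevalD mevalZ mcoeffD mcoeffZ IH mcoeffX mevalX; congr (_ * _ + _).
  have [->|m0] := eqVneq m 0%MM; first by rewrite big1 // => i _; rewrite mnm0E.
  have /existsP[i mi] : [exists i, m i != 0%N].
    apply: contraNT m0 => /existsPn H; apply/eqP/mnmP => i; rewrite mnm0E.
    exact/eqP/negPn/H.
  by rewrite (bigD1 i) //= expr0n (negPf mi) mul0r.
apply/mpolyP => m; rewrite mcoeff_pihomog mcoeffC /= mdeg_eq0 eq_sym E.
by case: eqP => [<-|_]; rewrite ?mulr1 ?mulr0.
Qed.

Lemma euler_eval (K : fieldType) (n d : nat) (p : {mpoly K[n]}) v :
  p \is d.-homog -> \sum_l p^`M(l).@[v] * v l = p.@[v] *+ d.
Proof.
move=> hp; rewrite -mevalMn -(euler_homog hp) meval_sum; apply: eq_bigr => l _.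
by rewrite mevalM mevalXU mulrC.
Qed.

Section Frames.
Variable K : numClosedFieldType.
Hypothesis Kbig : large_fibers K.

Definition hvec n (c : K) (w : 'I_n -> K) : 'I_n.+1 -> K :=
  fun i => if unlift ord0 i is Some k then w k else c.

Lemma hvec0 n c (w : 'I_n -> K) : hvec c w ord0 = c.
Proof. by rewrite /hvec unlift_none. Qed.

Lemma hvecS n c (w : 'I_n -> K) i : hvec c w (lift ord0 i) = w i.
Proof. by rewrite /hvec liftK. Qed.

Definition affsub (M : 'M[K]_4) (f : {mpoly K[4]}) : {mpoly K[3]} :=
  f \mPo [tuple (M ord0 j)%:MP + \sum_(i < 3) M (lift ord0 i) j *: 'X_i | j < 4].

Lemma meval_affsub M f w : (affsub M f).@[w] = f.@[vmul (hvec 1 w) M].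
Proof.
rewrite /affsub comp_mpoly_meval; apply: meval_eq => j.
rewrite tnth_mktuple mevalD mevalC meval_sum /vmul [RHS]big_ord_recl hvec0 mul1r; congr (_ + _).
by apply: eq_bigr => i _; rewrite mevalZ mevalXU hvecS mulrC.
Qed.

Lemma mderiv_affsub M f i :
  (affsub M f)^`M(i) = \sum_j M (lift ord0 i) j *: affsub M f^`M(j).
Proof.
rewrite /affsub mderiv_comp; apply: eq_bigr => j _.
rewrite tnth_mktuple mderivD mderivC add0r -/(linform (fun i => M (lift ord0 i) j)).
by rewrite mderiv_linform mulrC mul_mpolyC.
Qed.

Lemma vmul_row0 (M : 'M[K]_4) : vmul (hvec 1 (fun=> 0)) M =1 (fun j => M ord0 j).
Proof.
move=> j; rewrite /vmul big_ord_recl hvec0 mul1r big1 ?addr0 // => i _.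
by rewrite hvecS mul0r.
Qed.

Lemma meval_affsub0 M f : (affsub M f).@[fun=> 0] = f.@[fun j => M ord0 j].
Proof. by rewrite meval_affsub; apply: meval_eq; apply: vmul_row0. Qed.

(** Euler's formula for the linear form on the left reduces it to second derivatives at the origin,
    that is, to the Hessian of [f] in the directions of the frame. *)
Lemma quadratic_part M f i w :
  (pihomog mdeg 2 (affsub M f))^`M(i).@[w] =
  \sum_j M (lift ord0 i) j *
    \sum_l f^`M(j)^`M(l).@[fun j => M ord0 j] * vmul (hvec 0 w) M l.
Proof.
have hQ : (pihomog mdeg 2 (affsub M f))^`M(i) \is 1.-homog by apply: mderiv_homog (pihomogP _ _ _).
have := euler_eval w hQ; rewrite mulr1n => <-.
under eq_bigr do rewrite !pihomog_mderiv pihomog_mdeg0 mevalC mderiv_affsub mderiv_sum meval_sum.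
transitivity (\sum_k \sum_j \sum_l M (lift ord0 i) j *
   (f^`M(j)^`M(l).@[fun j => M ord0 j] * (w k * M (lift ord0 k) l))).
  apply: eq_bigr => k _; rewrite mulr_suml; apply: eq_bigr => j _.
  rewrite mderivZ mderiv_affsub mevalZ meval_sum -mulrA mulr_suml mulr_sumr.
  apply: eq_bigr => l _; rewrite mevalZ meval_affsub0; congr (_ * _).
  by ring.
rewrite exchange_big; apply: eq_bigr => j _ /=; rewrite exchange_big mulr_sumr.
apply: eq_bigr => l _ /=; rewrite -!mulr_sumr; congr (_ * (_ * _)).
rewrite /vmul [RHS]big_ord_recl hvec0 mul0r add0r.
by apply: eq_bigr => k _; rewrite hvecS.
Qed.

(** The Hessian applied to the vector of [w] pairs to [0] with the last three rows of the frame by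
    hypothesis, and with the first row, the point itself, by symmetry and Euler's formula. At a node
    that vector is then a multiple of the point. *)
Lemma quadratic_nondeg M f d w : M \in unitmx -> f \is d.-homog ->
  nodal_at f (fun j => M ord0 j) ->
  (forall i, (pihomog mdeg 2 (affsub M f))^`M(i).@[w] = 0) -> forall i, w i = 0.
Proof.
move=> uM hf [fq fh] Hw.
have [i|c Hc] := fh (vmul (hvec 0 w) M).
  apply: (@mulmx_col_inj _ _ M (fun i => \sum_l f^`M(i)^`M(l).@[fun j => M ord0 j] *
    vmul (hvec 0 w) M l) uM) => {}i.
  case: (unliftP ord0 i) => [k ->|->]; first by rewrite -[RHS](Hw k) quadratic_part.
  under eq_bigr do rewrite mulr_sumr.
  rewrite exchange_big big1 //= => l _.
  under eq_bigr do rewrite mulrA mderiv_comm [M _ _ * _]mulrC.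
  by rewrite -mulr_suml (euler_eval _ (mderiv_homog l hf)) fq mul0rn mul0r.
have e : hvec 0 w =1 hvec c (fun=> 0).
  apply: (vmul_inj uM) => j; rewrite Hc /vmul big_ord_recl hvec0 big1 ?addr0 // => i _.
  by rewrite hvecS mul0r.
by move=> i; have := e (lift ord0 i); rewrite !hvecS.
Qed.

Lemma mkvpoint n (v : 'I_n.+1 -> K) : (exists i, v i != 0) ->
  exists x : Proj K n, val x = <[\row_i v i]>%VS /\ exists2 c, c != 0 & pcoords x =1 fun i => c * v i.
Proof.
move=> [i vi]; have v0 : \row_i v i != 0.
  by apply/rV0Pn; exists i; rewrite mxE.
have [x [ex [c c0 hc]]] := mkpoint v0; exists x; split=> //; exists c => // j.
by rewrite /pcoords hc !mxE.
Qed.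

Lemma pcoords_neq0 n (x : Proj K n) : exists i, pcoords x i != 0.
Proof. have : (rep x : 'rV[K]_n.+1) != 0 by exact: rep_neq0.
by case/rV0Pn => i; exists i. Qed.

Lemma singular_at_homog n d (f : {mpoly K[n]}) v : f \is d.-homog -> (0 < d)%N ->
  singular_at f v <-> forall i, f^`M(i).@[v] = 0.
Proof.
move=> hf d0; split=> [[]//|H]; split=> //.
have := euler_eval v hf; rewrite big1 => [|i _]; last by rewrite H mul0r.
by move/esym/eqP; rewrite mulrn_eq0 gtn_eqF //= => /eqP.
Qed.

Lemma frame_row0 (p : Proj K 3) M : frame_at p M ->
  exists2 c, c != 0 & pcoords p =1 fun j => c * M ord0 j.
Proof.
move=> [uM e]; have := memv_pick (val p); rewrite -e => /vlineP[c hc].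
exists c.
  by apply: contraTneq (rep_neq0 p) => c0; move: hc; rewrite e => hc; rewrite /rep hc c0 scale0r eqxx.
by move=> j; rewrite /pcoords /rep -e hc !mxE.
Qed.

Lemma frame_exists (p : Proj K 3) : exists M, frame_at p M /\ forall j, M ord0 j = pcoords p j.
Proof.
have [c pc] := pcoords_neq0 p.
(* The unit vectors other than [e_c], with [c] a nonzero coordinate of [p], complete [p] to a
   basis. *)
pose M : 'M[K]_4 := \matrix_(i, j) if unlift ord0 i is Some k then (j == lift c k)%:R else pcoords p j.
have M0 j : M ord0 j = pcoords p j by rewrite mxE unlift_none.
exists M; split=> //; split; last first.
  by rewrite (rep_line p); congr (<[_]>%VS); apply/rowP => j; rewrite mxE M0.
rewrite -row_free_unit -kermx_eq0; apply/rowV0P => u /sub_kermxP uM.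
have E j : u 0 ord0 * pcoords p j + \sum_k u 0 (lift ord0 k) * (j == lift c k)%:R = 0.
  have := congr1 (fun N : 'rV_ _ => N 0 j) uM; rewrite !mxE big_ord_recl M0 => E; rewrite -[RHS]E.
  by congr (_ + _); apply: eq_bigr => k _; rewrite mxE liftK.
have u0 : u 0 ord0 = 0.
  have := E c; rewrite big1 => [|k _]; last by rewrite (negPf (neq_lift _ _)) mulr0.
  by rewrite addr0 => /eqP; rewrite mulf_eq0 (negPf pc) orbF => /eqP.
apply/rowP => i; rewrite mxE; case: (unliftP ord0 i) => [k ->|->//].
have := E (lift c k); rewrite u0 mul0r add0r (bigD1 k) //= eqxx mulr1 big1 ?addr0 // => l lk.
by rewrite (inj_eq lift_inj) eq_sym (negPf lk) mulr0.
Qed.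

(** A kernel vector of the Hessian, read in the frame modulo the point, would be a singular point of
    the exceptional conic if it were not zero. *)
Lemma node_nodal d (Y : linsys K 3 d) p : node Y p ->
  nodal_at (rep Y : {mpoly K[4]}) (pcoords p).
Proof.
move=> [[fp dfp] [[C [M [frM _ [c c0 eC]]] Csm] _]].
set f : {mpoly K[4]} := rep Y.
have hf : f \is d.-homog := dhomog_is_dhomog (rep Y).
have [uM _] := frM; have [b b0 hb] := frame_row0 frM.
suff : nodal_at f (fun j => M ord0 j) by apply: nodal_scale hf b0 hb.
have fq i : f^`M(i).@[fun j => M ord0 j] = 0.
  have := dfp i; rewrite (meval_eq _ hb) (meval_scale _ _ (mderiv_homog i hf)) => /eqP.
  by rewrite mulf_eq0 expf_eq0 (negPf b0) andbF => /eqP.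
split=> // v Hv.
pose u := vmul v (invmx M); pose w := fun k : 'I_3 => u (lift ord0 k).
have uv : vmul u M =1 v by apply: vmulKV.
have ew l : vmul (hvec 0 w) M l = v l - u ord0 * M ord0 l.
  rewrite -uv /vmul big_ord_recl hvec0 mul0r add0r [in RHS]big_ord_recl addrC addKr.
  by apply: eq_bigr => k _; rewrite hvecS.
have w0 : forall i, w i = 0.
  apply: contrapT => /existsNP[i /eqP wi].
  have [x [_ [a a0 hx]]] := @mkvpoint 2 w (ex_intro _ i wi).
  suff : sing_locus C x by rewrite Csm.
  have CQ : (rep C : {mpoly K[3]}) = c^-1 *: pihomog mdeg 2 (affsub M f).
    by rewrite -[affsub M f]/(local_equation Y M) eC scalerA mulVf // scale1r.
  have hC : (rep C : {mpoly K[3]}) \is 2.-homog := dhomog_is_dhomog (rep C).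
  apply/(singular_at_homog _ hC) => // j.
  rewrite (meval_eq _ hx) (meval_scale _ _ (mderiv_homog j hC)) CQ mderivZ mevalZ.
  rewrite quadratic_part big1 ?mulr0 // => l _.
  under eq_bigr do rewrite ew mulrBr.
  rewrite sumrB Hv sub0r.
  under eq_bigr do rewrite mulrCA.
  by rewrite -mulr_sumr (euler_eval _ (mderiv_homog l hf)) fq mul0rn mulr0 oppr0 mulr0.
exists (u ord0) => l; apply/eqP; rewrite -subr_eq0 -ew; apply/eqP.
rewrite /vmul big_ord_recl hvec0 mul0r add0r big1 // => k _.
by rewrite hvecS w0 mul0r.
Qed.

End Frames.

(** The degree in the last three variables, which measures the order of vanishing at [[1:0:0:0]];
    declared a measure, it makes [pihomog xdeg] available. *)
Definition xdeg (m : 'X_{1..4}) : nat := (\sum_(i < 3) m (lift ord0 i))%N.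

Lemma xdeg_mdeg m : mdeg m = (m ord0 + xdeg m)%N.
Proof. by rewrite mdegE big_ord_recl. Qed.

Lemma xdeg0 : xdeg 0%MM = 0%N.
Proof. by rewrite /xdeg big1 // => i _; rewrite mnm0E. Qed.

Lemma xdegD : {morph xdeg : m1 m2 / (m1 + m2)%MM >-> (m1 + m2)%N}.
Proof. by move=> m1 m2; rewrite /xdeg -big_split; apply: eq_bigr => i _; rewrite mnmDE. Qed.

HB.instance Definition _ := isMeasure.Build 4 xdeg xdeg0 xdegD.

Section Nodes.
Variable K : numClosedFieldType.
Hypothesis Kbig : large_fibers K.

(** On the exceptional divisor the strict transform restricts to the dehomogenised conic [Q]. A
    singular point there kills [Q] and all its derivatives but one, and Euler's formula gives the
    last, against the nondegeneracy of [Q]. *)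
Lemma nodal_node d (Y : linsys K 3 d) p : (0 < d)%N ->
  nodal_at (rep Y : {mpoly K[4]}) (pcoords p) -> node Y p.
Proof.
move=> d0 nod; pose f : {mpoly K[4]} := rep Y.
have hf : f \is d.-homog := dhomog_is_dhomog (rep Y).
have [M [frM M0]] := frame_exists p; have [uM _] := frM.
have nodM : nodal_at f (fun j => M ord0 j).
  by apply: (nodal_scale hf (oner_neq0 _) _ nod) => j; rewrite mul1r M0.
have fM i : f^`M(i).@[fun j => M ord0 j] = 0 by case: nodM.
pose loc := affsub M f; pose Q := pihomog mdeg 2 loc.
have hQ : Q \is 2.-homog := pihomogP _ _ _.
have Qnd w := quadratic_nondeg (w := w) uM hf nodM.
have l0 : pihomog mdeg 0 loc = 0.
  rewrite pihomog_mdeg0 meval_affsub0 -/f.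
  have [_ H] := singular_at_homog (fun j => M ord0 j) hf d0.
  by have [-> _] := H fM; rewrite mpolyC0.
have l1 : pihomog mdeg 1 loc = 0.
  have := euler_homog (pihomogP mdeg 1 loc); rewrite mulr1n => <-.
  rewrite big1 // => i _; rewrite pihomog_mderiv pihomog_mdeg0 mderiv_affsub meval_sum big1.
    by rewrite mpolyC0 mulr0.
  by move=> j _; rewrite mevalZ meval_affsub0 fM mulr0.
have Q0 : Q != 0.
  apply/eqP => Q0; have /eqP : (1 : K) = 0.
    by apply: (Qnd (fun=> 1) _ ord0) => i; rewrite -/Q Q0 mderiv0 meval0.
  by rewrite oner_eq0.
pose Qd : dhomog 3 K 2 := DHomog hQ.
have Qd0 : Qd != 0 by apply: contraNneq Q0 => /(congr1 val) /= ->.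
have [C [_ [c c0 hC]]] := mkpoint Qd0.
have CQ : (rep C : {mpoly K[3]}) = c *: Q by rewrite hC.
split; first by apply/(singular_at_homog _ hf) => //; case: nod.
split.
  exists C.
    exists M; split=> //; first by split=> // -[|[|]].
    by exists c^-1; rewrite ?invr_neq0 // CQ scalerA mulVf // scale1r.
  apply/seteqP; split=> // x [_ Hx] /=; have [ix] := pcoords_neq0 x; move/eqP; apply.
  apply: Qnd => j; apply: (mulfI c0); rewrite mulr0 -(Hx j) CQ mderivZ mevalZ //.
exists M => // i g hg y yi [gy dgy].
pose hat := [tuple if j == i then 1 else 'X_j : {mpoly K[3]} | j < 3].
have chartE p' k : p' \is k.-homog -> p' \mPo blowup_chart K i = 'X_i ^+ k * (p' \mPo hat).
  move=> hp; rewrite !comp_mpolyEX mulr_sumr; apply: eq_big_seq => m' /(dhomog_mf hp) /= dm.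
  rewrite -scalerAr; congr (_ *: _); rewrite !comp_mpolyX -dm mdegE -prodrXr -big_split.
  apply: eq_bigr => j _ /=; rewrite -exprMn; congr (_ ^+ _).
  by rewrite !tnth_mktuple; case: ifP => _; rewrite ?mulr1.
have [h Eg] : exists h, g = (Q \mPo hat) + 'X_i * h.
  pose N := (msize loc).+3.
  exists (\sum_(k < N | (2 < k)%N) 'X_i ^+ (k - 3) * (pihomog mdeg k loc \mPo hat)).
  have X0 : ('X_i : {mpoly K[3]}) ^+ 2 != 0 by rewrite expf_neq0 // -msupp_eq0 msuppX.
  apply: (mulfI X0); rewrite -hg -/(affsub M f) -/loc.
  have -> : loc \mPo blowup_chart K i = \sum_(k < N) 'X_i ^+ k * (pihomog mdeg k loc \mPo hat).
    have hN : (msize loc <= N)%N by rewrite /N; lia.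
    rewrite {1}(pihomog_partitionE hN) (raddf_sum (comp_mpoly (blowup_chart K i))).
    by apply: eq_bigr => k _; apply: chartE; apply: pihomogP.
  rewrite (bigID (fun k : 'I_N => (2 < k)%N)) /= addrC mulrDr; congr (_ + _).
    have N2 : (2 < N)%N by [].
    rewrite (bigD1 (Ordinal N2)) //= big1 ?addr0 // => k /andP[k2 kn].
    have : (k < 2)%N by rewrite ltn_neqAle -(inj_eq val_inj) /= in kn *; rewrite kn leqNgt.
    by case: (k : nat) => [|[|]] // _; rewrite ?l0 ?l1 comp_mpoly0 mulr0.
  rewrite mulrA -exprSr mulr_sumr; apply: eq_bigr => k k2.
  by rewrite mulrA -exprD subnKC.
pose z j := (tnth hat j).@[y].
have Qz : Q.@[z] = 0 by move: gy; rewrite Eg mevalD mevalM mevalXU yi mul0r addr0 comp_mpoly_meval.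
have dQz j : j != i -> Q^`M(j).@[z] = 0.
  move=> ji; rewrite -(dgy j) Eg mderivD mevalD mderivM mevalD !mevalM mevalXU yi mul0r.
  rewrite mderiv_XU (negPf ji) meval0 mul0r !addr0 mderiv_comp [RHS]meval_sum (bigD1 j) //= [X in _ + X]big1.
    rewrite addr0 mevalM comp_mpoly_meval tnth_mktuple (negPf ji) mderiv_XU eqxx.
    by rewrite meval1 mulr1.
  move=> k kj; rewrite mevalM tnth_mktuple; case: ifP => _.
    by rewrite -mpolyC1 mderivC meval0 mulr0.
  by rewrite mderiv_XU eq_sym (negPf kj) meval0 mulr0.
have zi : z i = 1 by rewrite /z tnth_mktuple eqxx meval1.
have := euler_eval z hQ; rewrite Qz mul0rn (bigD1 i) //= big1 => [|j /dQz ->]; last by rewrite mul0r.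
rewrite addr0 zi mulr1 => dQi.
have /eqP : z i = 0 by apply: (Qnd z) => j; have [->|/dQz] := eqVneq j i.
by rewrite zi oner_eq0.
Qed.

Definition dehom (F : {mpoly K[4]}) : {mpoly K[3]} :=
  F \mPo [tuple if unlift ord0 i is Some k then 'X_k else 1 | i < 4].

Lemma meval_dehom F y : (dehom F).@[y] = F.@[hvec 1 y].
Proof.
rewrite comp_mpoly_meval; apply: meval_eq => j; rewrite tnth_mktuple /hvec.
by case: unlift => [k|]; rewrite ?mevalXU ?meval1.
Qed.

Lemma affsub_dehom M f : affsub M f = dehom (lsubst M f).
Proof.
apply: (mpoly_eval_inj Kbig) => v.
by rewrite meval_affsub meval_dehom meval_lsubst.
Qed.

Lemma pihomog_xdeg_eval n F k c y : F \is n.-homog ->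
  (pihomog xdeg k F).@[hvec c y] = c ^+ (n - k) * (pihomog mdeg k (dehom F)).@[y].
Proof.
move=> hF; rewrite /dehom; set T := (X in comp_mpoly X _).
rewrite [F]mpolyE (raddf_sum (pihomog xdeg k)) (raddf_sum (comp_mpoly T)).
rewrite (raddf_sum (pihomog mdeg k)) /= !meval_sum mulr_sumr.
apply: eq_big_seq => m /(dhomog_mf hF) /= dm.
pose t := [multinom m (lift ord0 i) | i < 3].
have dt : mdeg t = xdeg m by rewrite mdegE; apply: eq_bigr => i _; rewrite mnmE.
have -> : (F@_m *: 'X_[m]) \mPo T = F@_m *: 'X_[t] :> {mpoly K[3]}.
  rewrite comp_mpolyZ; congr (_ *: _); rewrite comp_mpolyX big_ord_recl tnth_mktuple unlift_none.
  rewrite expr1n mul1r mpolyXE_id; apply: eq_bigr => i _.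
  by rewrite tnth_mktuple liftK mnmE.
rewrite !linearZ /= !pihomogX /= dt mulrCA; congr (_ * _).
case: eqP => [<-|_]; last by rewrite !meval0 mulr0.
have -> : (n - xdeg m)%N = m ord0 by rewrite -dm xdeg_mdeg addnK.
rewrite !mevalX big_ord_recl hvec0; congr (_ * _); apply: eq_bigr => i _.
by rewrite hvecS mnmE.
Qed.

Lemma pihomog_xdeg_big n (F : {mpoly K[4]}) k : F \is n.-homog -> (n < k)%N -> pihomog xdeg k F = 0.
Proof.
move=> hF nk; apply/mpolyP => m; rewrite mcoeff0 mcoeff_pihomog; case: eqP => //= mk.
apply: dhomog_nemf_coeff hF _; rewrite /= xdeg_mdeg mk; lia.
Qed.

Lemma hvecE n (v : 'I_n.+1 -> K) : v =1 hvec (v ord0) (fun i => v (lift ord0 i)).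
Proof. by move=> i; case: (unliftP ord0 i) => [k ->|->]; rewrite ?hvecS ?hvec0. Qed.

Lemma pihomog_xdeg_sum n (F : {mpoly K[4]}) : F \is n.-homog -> F = \sum_(k < n.+1) pihomog xdeg k F.
Proof.
move=> hF; have h : (mmeasure xdeg F <= n.+1 + mmeasure xdeg F)%N by lia.
rewrite {1}(pihomog_partitionE h) big_split_ord /= [X in _ + X]big1 ?addr0 // => k _.
by apply: pihomog_xdeg_big hF _; rewrite ltn_addr.
Qed.

Lemma homog_expand n F c y : F \is n.-homog ->
  F.@[hvec c y] = \sum_(k < n.+1) c ^+ (n - k) * (pihomog mdeg k (dehom F)).@[y].
Proof.
move=> hF; rewrite {1}(pihomog_xdeg_sum hF) meval_sum; apply: eq_bigr => k _.
exact: pihomog_xdeg_eval.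
Qed.

Lemma pihomog_dehom_big n F k : F \is n.-homog -> (n < k)%N -> pihomog mdeg k (dehom F) = 0.
Proof.
move=> hF nk; apply: mpoly_eval_inj => // y; have := pihomog_xdeg_eval k 1 y hF.
by rewrite (pihomog_xdeg_big hF nk) !meval0 expr1n mul1r.
Qed.

Lemma frame_complete (A : 'M[K]_(3, 4)) : row_free A ->
  exists2 N : 'M[K]_4, N \in unitmx & forall i j, N (lift ord0 i) j = A i j.
Proof.
move=> fA.
have [r hr] : exists r : 'I_4, ~~ (row r 1%:M <= A)%MS.
  apply/existsP; rewrite -negb_forall; apply/negP => /forallP H.
  have : (1%:M <= A)%MS by apply/row_subP.
  by move/mxrankS; rewrite mxrank1 (eqP fA).
exists (\matrix_(i, j) if unlift ord0 i is Some k then A k j else (r == j)%:R); last first.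
  by move=> i j; rewrite mxE liftK.
rewrite -row_free_unit -kermx_eq0; apply/rowV0P => u /sub_kermxP uM.
pose b := \row_k u 0 (lift ord0 k).
have E : u 0 ord0 *: row r 1%:M + b *m A = 0.
  apply/rowP => j; have := congr1 (fun N : 'rV_ _ => N 0 j) uM.
  rewrite !mxE big_ord_recl mxE unlift_none => E; rewrite -[RHS]E; congr (_ + _).
  by apply: eq_bigr => k _; rewrite !mxE liftK.
have u0 : u 0 ord0 = 0.
  apply: contraNeq hr => u0; have -> : row r 1%:M = (- (u 0 ord0)^-1) *: (b *m A).
    move/eqP: E; rewrite addrC addr_eq0 => /eqP ->.
    by rewrite scalerN scaleNr opprK scalerA mulVf // scale1r.
  by apply: scalemx_sub; apply: submxMl.
have b0 : b = 0.
  apply/eqP; have : b *m A == 0 by rewrite -E u0 scale0r add0r.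
  by rewrite mulmx_free_eq0.
apply/rowP => i; rewrite mxE; case: (unliftP ord0 i) => [k ->|->//].
by have := congr1 (fun N : 'rV_ _ => N 0 k) b0; rewrite !mxE.
Qed.

End Nodes.

(** * Regularity and dual forms *)

Lemma mcoeff_mulX (K : nzRingType) (n : nat) (p : {mpoly K[n]}) w b :
  (p * 'X_[w])@_b = if (w <= b)%MM then p@_(b - w)%MM else 0.
Proof.
case: ifP => [wb|wb]; first by rewrite -{1}(submK wb) addmC mcoeffMX.
apply: memN_msupp_eq0; rewrite (perm_mem (msuppMX _ _)); apply/negP => /mapP[m _ e].
by rewrite e lem_addr in wb.
Qed.

Lemma expX (K : nzRingType) (n : nat) (i : 'I_n) k : ('X_i ^+ k = 'X_[U_(i) *+ k] :> {mpoly K[n]}).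
Proof. by rewrite mpolyXn. Qed.

Lemma lem_mulU (n : nat) (i : 'I_n) k (b : 'X_{1..n}) : (U_(i) *+ k <= b)%MM = (k <= b i)%N.
Proof.
apply/mnm_lepP/idP => [/(_ i)|h j]; first by rewrite mulmnE mnm1E eqxx mul1n.
by rewrite mulmnE mnm1E; case: eqVneq => [<-|_]; rewrite ?mul1n ?mul0n.
Qed.

Lemma div_eq_div (L : fieldType) (x y z w : L) : z != 0 -> w != 0 -> x / z = y / w <-> x * w = y * z.
Proof.
by move=> z0 w0; split=> [/eqP|e]; [rewrite eqr_div // => /eqP|apply/eqP; rewrite eqr_div // e].
Qed.

Lemma frac_subXY (L : fieldType) (a b x y : L) k : x != 0 -> y != 0 ->
  b / y ^+ k - a / x ^+ k = (b * x ^+ k - a * y ^+ k) / (x * y) ^+ k.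
Proof.
by move=> x0 y0; rewrite exprMn; field; rewrite !expf_neq0.
Qed.

Lemma frac_subX (L : fieldType) (a b x : L) k e : x != 0 ->
  a / x ^+ k - b / x ^+ e = (a * x ^+ e - b * x ^+ k) / x ^+ (k + e).
Proof. by move=> x0; rewrite exprD; field; rewrite !expf_neq0. Qed.

Lemma sub_swap (L : fieldType) (a b c d : L) : b - a = d - c -> a - c = b - d.
Proof. by move=> e; rewrite -[b](subrK a) e; ring. Qed.

Section Cohomology.
Variable K : fieldType.
Local Notation A := {mpoly K[4]}.
Local Notation F := (@tofrac A).

Lemma tofrac_inj : injective F.
Proof. by move=> x y /eqP; rewrite tofrac_eq => /eqP. Qed.

Lemma X_neq0 (i : 'I_4) : ('X_i : A) != 0.
Proof. by rewrite -msupp_eq0 msuppX. Qed.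

Lemma FX_neq0 (i : 'I_4) : F 'X_i != 0.
Proof. by rewrite tofrac_eq0 X_neq0. Qed.

Lemma frac_eqP (a b c d : A) : c != 0 -> d != 0 ->
  (F a / F c = F b / F d) <-> (a * d = b * c).
Proof.
move=> c0 d0; have Fc : F c != 0 by rewrite tofrac_eq0.
have Fd : F d != 0 by rewrite tofrac_eq0.
apply: (iff_trans (div_eq_div _ _ Fc Fd)); rewrite -!tofracM.
by split=> [/tofrac_inj|->].
Qed.

Lemma X_divides (i j : 'I_4) (a b : A) c e : i != j ->
  a * 'X_j ^+ e = b * 'X_i ^+ c -> exists G, a = G * 'X_i ^+ c.
Proof.
move=> ij E; exists (\sum_(m <- msupp a) a@_m *: 'X_[m - U_(i) *+ c]).
rewrite mulr_suml {1}[a]mpolyE; apply: eq_big_seq => m; rewrite mcoeff_msupp => am.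
rewrite -scalerAl expX -mpolyXD submK // lem_mulU leqNgt; apply: contra am => mc.
have := congr1 (mcoeff (m + U_(j) *+ e)%MM) E; rewrite !expX !mcoeff_mulX lem_addl addmK => ->.
rewrite lem_mulU mnmDE mulmnE mnm1E [j == i]eq_sym (negPf ij) addn0 leqNgt mc.
by [].
Qed.

Variables (d delta : nat) (q : 'I_delta -> Proj K 3).

(** The points impose independent conditions on forms of degree [d]. *)
Definition dual_forms := exists e : 'I_delta -> A, forall j,
  e j \is d.-homog /\ forall l, (e j).@[pcoords (q l)] = (l == j)%:R.

Variable N : set (Proj K 3).
Hypothesis Nq : forall x, N x <-> exists l, x = q l.

(** In the large degree [d + k] some form [h] separates [q j]. The quotients [s i] take, where
    defined, the value [1] at [q j] and [0] at the other points, so their differences form a cocycle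
    of the ideal sheaf. Splitting it corrects the [s i] to one form [G] of degree [d] with the same
    values. *)
Lemma dual_of_h1 : (forall l l', l != l' -> ~ propor (pcoords (q l)) (pcoords (q l'))) ->
  (forall l, exists i, pcoords (q l) i != 0) ->
  h1_ideal_zero d N -> dual_forms.
Proof.
move=> qne q0 h1; suff /choice[e He] : forall j, exists G : A,
    G \is d.-homog /\ forall l, G.@[pcoords (q l)] = (l == j)%:R by exists e.
move=> j; pose k := delta.
have [|h [hh hq]] := interpolation q0 qne j (k := d + k); first by rewrite card_ord; lia.
pose g i : A := (pcoords (q j) i ^+ k) *: h.
have gq i l : (g i).@[pcoords (q l)] = (l == j)%:R * pcoords (q l) i ^+ k.
  by rewrite mevalZ hq mulrC; case: eqVneq => [->|]; rewrite ?mul0r.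
pose s i := F (g i) / F ('X_i) ^+ k.
have [i1 i2|i1 i2 i3|t [Ht Hts]] := h1 (fun i1 i2 => s i2 - s i1).
- exists k, (g i2 * 'X_i1 ^+ k - g i1 * 'X_i2 ^+ k); split.
  + have hgX a b : g a * 'X_b ^+ k \is (d + k * 2).-homog.
      rewrite muln2 -addnn addnA; apply: dhomogM; first exact: rpredZ.
      by apply: homog_exp; rewrite dhomogX /= mdeg1.
    by rewrite rpredB // hgX.
  + move=> x /Nq[l ->]; rewrite mevalB !mevalM !rmorphXn /= !mevalXU !gq.
    by rewrite -!mulrA [X in _ * X - _]mulrC subrr.
  + have -> := frac_subXY (F (g i1)) (F (g i2)) k (FX_neq0 i1) (FX_neq0 i2).
    by rewrite tofracB !tofracM !tofracXn.
- by rewrite addrC addrA subrK.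
have /choice[ka Hka] : forall i, exists ka : nat * A, [/\ ka.2 \is (d + ka.1).-homog,
    vanishing_on N ka.2 & t i = F ka.2 / F 'X_i ^+ ka.1].
  by move=> i; have [k' [a [ha va ta]]] := Ht i; exists (k', a); rewrite /= -{1}[k']muln1.
pose a i := g i * 'X_i ^+ (ka i).1 - (ka i).2 * 'X_i ^+ k.
pose c i := (k + (ka i).1)%N.
have sE i : s i - t i = F (a i) / F 'X_i ^+ c i.
  have [_ _ ->] := Hka i; rewrite /s (frac_subX _ _ _ _ (FX_neq0 i)) /a /c.
  by rewrite tofracB !tofracM !tofracXn.
have cst i i' : s i - t i = s i' - t i'.
  exact: sub_swap (Hts i i').
have aE i i' : a i * 'X_i' ^+ c i' = a i' * 'X_i ^+ c i.
  have n0 l : ('X_l : A) ^+ c l != 0 by rewrite expf_neq0 // X_neq0.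
  have [H _] := frac_eqP (a i) (a i') (n0 i) (n0 i'); apply: H; rewrite !tofracXn -!sE.
  exact: cst.
pose o1 : 'I_4 := lift ord0 ord0.
(* Agreement over [D_+(x_0)] and [D_+(x_1)] already forces the denominator to divide, as [x_0] and
   [x_1] are coprime. *)
have [G EG] := X_divides (i := ord0) (j := o1) isT (aE ord0 o1).
have aG i : a i = G * 'X_i ^+ c i.
  apply: (mulIf (expf_neq0 (c ord0) (X_neq0 ord0))).
  by rewrite -aE EG mulrAC.
have ha : a ord0 \is (d + c ord0).-homog.
  have [h2 _ _] := Hka ord0; rewrite /a /c.
  apply: rpredB; rewrite addnA; last rewrite addnAC; apply: dhomogM => //.
  - exact: rpredZ.
  - by apply: homog_exp; rewrite dhomogX /= mdeg1.
  - by apply: homog_exp; rewrite dhomogX /= mdeg1.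
exists G; split.
  have hX : ('X_ord0 : A) ^+ c ord0 \is (c ord0).-homog.
    by apply: homog_exp; rewrite dhomogX /= mdeg1.
  have := pihomog_dE ha; rewrite aG (pihomogM _ _ hX) leq_addl addnK.
  by move/(mulIf (expf_neq0 (c ord0) (X_neq0 ord0))) => <-; apply: pihomogP.
move=> l; have [i qi] := q0 l; have [_ va _] := Hka i.
have := congr1 (meval (pcoords (q l))) (aG i); rewrite /a mevalB !mevalM !rmorphXn /= !mevalXU gq.
rewrite va; last by apply/Nq; exists l.
rewrite mul0r subr0 -mulrA -exprD => /esym.
by move/(mulIf (expf_neq0 (c i) qi)).
Qed.

(* Cech H^1 of O(d) on P^3 vanishes because a Laurent monomial with two negative
   exponents cannot occur in a cocycle (a third index separates them), and one
   with at most one negative exponent is a coboundary for an explicit reason. *)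
Lemma cech_splitting (k D : nat) (P : 'I_4 -> 'I_4 -> A) :
  (forall i j l, P i j + P j l = P i l) ->
  (forall i j b, (P i j)@_b != 0 -> forall l, l != i -> l != j -> (k <= b l)%N) ->
  (forall i j, P i j \is (D + 3 * k).-homog) ->
  exists U : 'I_4 -> A, (forall i, U i \is D.-homog) /\
    forall i j, P i j = U j * 'X_[(\sum_(l | l != j) U_(l) *+ k)%MM]
                      - U i * 'X_[(\sum_(l | l != i) U_(l) *+ k)%MM].
Proof.
move=> Pc Psupp Phom.
pose w i : 'X_{1..4} := (\sum_(l | l != i) U_(l) *+ k)%MM.
have wE i l : w i l = if l == i then 0%N else k.
  rewrite /w mnm_sumE; case: (eqVneq l i) => [->|li].
    by rewrite big1 // => j ji; rewrite mulmnE mnm1E (negPf ji) mul0n.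
  rewrite (bigD1 l) //= mulmnE mnm1E eqxx mul1n big1 ?addn0 // => j /andP[_ jl].
  by rewrite mulmnE mnm1E (negPf jl) mul0n.
have dw i : mdeg (w i) = (3 * k)%N.
  rewrite mdegE (eq_bigr (fun l => if l != i then k else 0%N)).
    by rewrite -big_mkcond sum_nat_const (cardC1 i) card_ord.
  by move=> l _; rewrite wE; case: eqP.
have wb i b : (w i <= b)%MM <-> forall l, l != i -> (k <= b l)%N.
  split=> [/mnm_lepP h l /negPf li|h]; first by have := h l; rewrite wE li.
  by apply/mnm_lepP => l; rewrite wE; case: eqP => // /eqP /h.
(* Exponents are shifted by [k], so [b i < k] means a negative exponent of [x_i]. The reference
   index is [0], except that such a monomial, which has a pole along [x_i], is split off against an
   index other than [i]. *)
pose sg (i : 'I_4) (b : 'X_{1..4}) : 'I_4 := if (k <= b i)%N then ord0 else lift i ord0.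
pose tau i b := (P (sg i b) i)@_b.
pose U i := \sum_(m : 'X_{1..4 < D.+1}) (if mdeg m == D then tau i (m + w i)%MM else 0) *: 'X_[m].
have Uc i m : (U i)@_m = if mdeg m == D then tau i (m + w i)%MM else 0.
  have [mD|Dm] := leqP (mdeg m) D; first by rewrite (mcoeff_mpoly (fun m => if mdeg m == D then tau i (m + w i)%MM else 0)).
  rewrite gtn_eqF // /U raddf_sum big1 //= => m' _; rewrite mcoeffZ mcoeffX.
  case: (eqVneq (val m') m) => [e|_]; last by rewrite mulr0.
  by have := bmdeg m'; rewrite -[bmnm m']/(val m') e ltnS leqNgt Dm.
exists U; split.
  move=> i; apply/dhomogP => m; rewrite mcoeff_msupp Uc.
  by case: (eqVneq (mdeg m) D) => // _; rewrite eqxx.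
have P0 i : P i i = 0 by apply: (addrI (P i i)); rewrite Pc addr0.
move=> i j; apply/mpolyP => b; rewrite mcoeffB !mcoeff_mulX !Uc -!/(w _).
have [bD|bD] := eqVneq (mdeg b) (D + 3 * k)%N; last first.
  have Pb i' j' : (P i' j')@_b = 0 by apply: dhomog_nemf_coeff (Phom i' j') bD.
  have z i' : (w i' <= b)%MM -> (if mdeg (b - w i')%MM == D then tau i' (b - w i' + w i')%MM else 0) = 0.
    by move=> wib; rewrite submK // /tau Pb; case: ifP.
  rewrite Pb; case: ifP => [/z ->|_]; case: ifP => [/z ->|_]; by rewrite subr0.
have z i' : (w i' <= b)%MM -> (if mdeg (b - w i')%MM == D then tau i' (b - w i' + w i')%MM else 0) = tau i' b.
  move=> wib; rewrite submK //.
  have := mdegD (b - w i') (w i'); rewrite submK // bD dw => /addIn <-.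
  by rewrite eqxx.
have zz (i' : 'I_4) : (if (w i' <= b)%MM then if mdeg (b - w i')%MM == D
    then tau i' (b - w i' + w i')%MM else 0 else 0) = if (w i' <= b)%MM then tau i' b else 0.
  by case: ifP => // /z.
rewrite !zz.
have Pcb i1 i2 i3 : (P i1 i2)@_b + (P i2 i3)@_b = (P i1 i3)@_b by rewrite -mcoeffD Pc.
have P0b i1 : (P i1 i1)@_b = 0 by rewrite P0 mcoeff0.
have Pneg l i1 i2 : (b l < k)%N -> l != i1 -> l != i2 -> (P i1 i2)@_b = 0.
  move=> bl l1 l2; apply/eqP/negPn/negP => /Psupp /(_ l l1 l2).
  by rewrite leqNgt bl.
have Panti i1 i2 : (P i1 i2)@_b = - (P i2 i1)@_b by apply/eqP; rewrite -addr_eq0 Pcb P0b.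
have [[l bl]|/forallNP nneg] := pselect (exists l, (b l < k)%N); last first.
  have ge l : (k <= b l)%N by rewrite leqNgt; apply/negP/nneg.
  have wi i' : (w i' <= b)%MM by apply/wb.
  by rewrite !wi /tau /sg !ge [X in _ - X]Panti opprK addrC Pcb.
have nwl i' : i' != l -> (w i' <= b)%MM = false.
  by move=> il; apply/negP => /wb /(_ l); rewrite eq_sym il => /(_ isT); rewrite leqNgt bl.
have [[l' [l'l bl']]|/forallNP one] := pselect (exists l', l' != l /\ (b l' < k)%N).
  have nw i' : (w i' <= b)%MM = false.
    have [->|/nwl//] := eqVneq i' l.
    by apply/negP => /wb /(_ l' l'l); rewrite leqNgt bl'.
  rewrite !nw subrr.
  have /existsP[x /andP[xl xl']] : [exists x : 'I_4, (x != l) && (x != l')].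
    apply: contraT; rewrite negb_exists => /forallP H.
    have : (size (enum 'I_4) <= size [:: l; l'])%N.
      apply: uniq_leq_size (enum_uniq _) _ => x _.
      by have := H x; rewrite !inE negb_and !negbK.
    by rewrite size_enum_ord.
  have Px i' : (P i' x)@_b = 0.
    have [->|il] := eqVneq i' l; first by apply: (Pneg l') => //; rewrite eq_sym.
    by apply: (Pneg l) => //; rewrite eq_sym.
  by rewrite -(Pcb i x j) [X in _ + X]Panti !Px oppr0 addr0.
have wl : (w l <= b)%MM.
  by apply/wb => l' l'l; rewrite leqNgt; apply/negP => bl'; apply: (one l').
have l0 : lift l ord0 != l by rewrite eq_sym neq_lift.
have taul : tau l b = (P (lift l ord0) l)@_b by rewrite /tau /sg leqNgt bl.
have Pl0 i' : i' != l -> (P i' (lift l ord0))@_b = 0.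
  by move=> il; apply: (Pneg l) => //; rewrite eq_sym.
have [->|il] := eqVneq i l; have [->|jl] := eqVneq j l.
- by rewrite P0b subrr.
- by rewrite wl (nwl _ jl) sub0r taul -(Pcb l (lift l ord0) j) Panti [X in _ + X]Panti Pl0 // oppr0 addr0.
- by rewrite wl (nwl _ il) subr0 taul -(Pcb i (lift l ord0) l) Pl0 // add0r.
- by rewrite !nwl // subrr (Pneg l) // eq_sym.
Qed.

Hypothesis d0 : (forall l, exists i, pcoords (q l) i != 0).

(** The cocycle splits for [O(d)] itself. Differences of the pieces vanish at the points, so the
    pieces have common values [c l] there, and subtracting the form of degree [d] with these values
    brings them into the ideal. *)
Lemma h1_of_dual : dual_forms -> h1_ideal_zero d N.
Proof.
move=> [e He] s Hs Hc.
have /choice[kg Hkg] : forall ij : 'I_4 * 'I_4, exists kg : nat * A,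
    [/\ kg.2 \is (d + kg.1 * 2).-homog, vanishing_on N kg.2
      & s ij.1 ij.2 = F kg.2 / F ('X_ij.1 * 'X_ij.2) ^+ kg.1].
  by move=> [i j]; have [k [g h]] := Hs i j; exists (k, g).
pose k := \max_ij (kg ij).1.
have kle i j : ((kg (i, j)).1 <= k)%N by apply: (leq_bigmax (i, j)).
have sii i : s i i = 0 by apply: (addrI (s i i)); rewrite Hc addr0.
pose g i j : A := if i == j then 0 else (kg (i, j)).2 * ('X_i * 'X_j) ^+ (k - (kg (i, j)).1).
have hXX i j c : ('X_i * 'X_j : A) ^+ c \is (c * 2).-homog.
  rewrite mulnC; apply: dhomogMn; rewrite -[2%N]/(1 + 1)%N; apply: dhomogM; rewrite dhomogX /= mdeg1 //.
have gh i j : g i j \is (d + k * 2).-homog.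
  rewrite /g; case: eqP => _; first exact: dhomog0.
  have [h1 _ _] := Hkg (i, j); rewrite -(subnKC (kle i j)) addKn mulnDl addnA.
  exact: dhomogM h1 (hXX _ _ _).
have gv i j : vanishing_on N (g i j).
  move=> x Nx; rewrite /g; case: eqP => _; first by rewrite meval0.
  by have [_ h2 _] := Hkg (i, j); rewrite mevalM h2 // mul0r.
have gs i j : s i j * F ('X_i * 'X_j) ^+ k = F (g i j).
  rewrite /g; case: eqP => [->|_]; first by rewrite sii mul0r tofrac0.
  have [_ _ /= ->] := Hkg (i, j).
  have y0 : F ('X_i * 'X_j) ^+ (kg (i, j)).1 != 0.
    by rewrite expf_neq0 // tofrac_eq0 mulf_neq0 // X_neq0.
  rewrite -{1}(subnKC (kle i j)) exprD mulrA divfK //.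
  by rewrite -tofracXn -tofracM.
pose w i : 'X_{1..4} := (\sum_(l | l != i) U_(l) *+ k)%MM.
pose w2 i j : 'X_{1..4} := (\sum_(l | (l != i) && (l != j)) U_(l) *+ k)%MM.
(* The numerator of [s i j] over the common denominator [XX]. *)
pose P i j := g i j * 'X_[w2 i j].
pose XX : A := 'X_[(\sum_l U_(l) *+ k)%MM].
have XX0 : XX != 0 by rewrite -msupp_eq0 msuppX.
have wX i : 'X_i ^+ k * 'X_[w i] = XX :> A.
  by rewrite expX -mpolyXD /XX; congr 'X_[_]; rewrite [in RHS](bigD1 i).
have w2X i j : i != j -> 'X_[w i] = 'X_j ^+ k * 'X_[w2 i j] :> A.
  move=> ij; rewrite expX -mpolyXD; congr 'X_[_]; rewrite /w (bigD1 j) //= eq_sym //.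
have w2C i j : w2 i j = w2 j i by apply: eq_bigl => l; rewrite andbC.
have PE i j : F (P i j) = s i j * F XX.
  have [->|ij] := eqVneq i j; first by rewrite sii mul0r /P /g eqxx mul0r tofrac0.
  by rewrite /P tofracM -gs -mulrA -tofracXn -tofracM -(wX i) (w2X _ _ ij) exprMn mulrA.
have [||i j|U [hU EU]] := @cech_splitting k (d + k) P.
- by move=> i j l; apply: tofrac_inj; rewrite tofracD !PE -mulrDl Hc.
- move=> i j b Pb l li lj; move: Pb; rewrite /P mcoeff_mulX; case: ifP; last by rewrite eqxx.
  move=> /mnm_lepP/(_ l) + _; rewrite /w2 mnm_sumE (bigD1 l) ?li //= mulmnE mnm1E eqxx mul1n.
  by apply: leq_trans; rewrite leq_addr.
- rewrite /P; have [->|ij] := eqVneq i j; first by rewrite /g eqxx mul0r dhomog0.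
  have -> : (d + k + 3 * k = d + k * 2 + 2 * k)%N by lia.
  apply: dhomogM => //; rewrite dhomogX /= mdeg_sum (eq_bigr (fun=> k)).
    rewrite sum_nat_const; apply/eqP.
    have C : #|predC (pred2 i j)| = 2%N.
      by apply: (@addnI #|pred2 i j|); rewrite cardC card_ord card2 ij.
    congr (_ * _)%N; apply: etrans C.
    by apply: eq_card => l; rewrite !inE negb_or.
  by move=> l _; rewrite mdegMn mdeg1 mul1n.
have gU i j : g i j = U j * 'X_i ^+ k - U i * 'X_j ^+ k.
  have [->|ij] := eqVneq i j; first by rewrite subrr /g eqxx.
  have w20 : 'X_[w2 i j] != 0 :> A by rewrite -msupp_eq0 msuppX.
  apply: (mulIf w20); rewrite -[LHS]/(P i j) EU -!/(w _) (w2X i j ij) (w2X j i) 1?eq_sym // (w2C j i).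
  by rewrite mulrBl !mulrA.
have [c Hc2] : exists c : 'I_delta -> K, forall l i,
    pcoords (q l) i != 0 -> (U i).@[pcoords (q l)] = c l * pcoords (q l) i ^+ k.
  suff /choice[c H] : forall l, exists c, forall i,
      pcoords (q l) i != 0 -> (U i).@[pcoords (q l)] = c * pcoords (q l) i ^+ k by exists c.
  move=> l; have [j qj] := d0 l; exists ((U j).@[pcoords (q l)] / pcoords (q l) j ^+ k) => i qi.
  have := gv i j (q l); rewrite gU mevalB !mevalM !rmorphXn /= !mevalXU => H.
  have /eqP : (U j).@[pcoords (q l)] * pcoords (q l) i ^+ k
      - (U i).@[pcoords (q l)] * pcoords (q l) j ^+ k = 0 by apply: H; apply/Nq; exists l.
  by rewrite subr_eq0 => /eqP E; rewrite mulrAC E mulfK // expf_neq0.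
pose G := \sum_l c l *: e l.
have hG : G \is d.-homog by apply: rpred_sum => l _; apply: rpredZ; have [] := He l.
have Gq l : G.@[pcoords (q l)] = c l.
  rewrite /G meval_sum (bigD1 l) //= big1 => [|j jl]; rewrite mevalZ.
    by have [_ ->] := He l; rewrite eqxx mulr1 addr0.
  by have [_ ->] := He j; rewrite eq_sym (negPf jl) mulr0.
pose v i := U i - G * 'X_i ^+ k.
have hX i a : ('X_i : A) ^+ a \is (a).-homog by apply: homog_exp; rewrite dhomogX /= mdeg1.
exists (fun i => F (v i) / F 'X_i ^+ k); split.
  (* The additional factor [x_i] above and below makes the numerator vanish also at the points of
     [N] on [x_i = 0]. *)
  move=> i; exists k.+1, (v i * 'X_i); split.
  - rewrite -[X in X.-homog](_ : d + k + 1 = _)%N; last by rewrite muln1 -addnA addn1.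
    apply: dhomogM; last by rewrite dhomogX /= mdeg1.
    by rewrite /v rpredB // dhomogM.
  - move=> x /Nq[l ->]; rewrite mevalM mevalXU mevalB mevalM rmorphXn /= mevalXU Gq.
    have [->|qi] := eqVneq (pcoords (q l) i) 0; first by rewrite mulr0.
    by rewrite (Hc2 _ _ qi) subrr mul0r.
  - by rewrite tofracM exprSr -mulf_div divff ?FX_neq0 // mulr1.
move=> i j.
have -> := frac_subXY (F (v i)) (F (v j)) k (FX_neq0 i) (FX_neq0 j).
rewrite -!tofracXn -!tofracM -!tofracXn -tofracB.
have -> : v j * 'X_i ^+ k - v i * 'X_j ^+ k = g i j.
  rewrite gU /v !mulrBl; have E (a b x y z : A) : a - x * y * z - (b - x * z * y) = a - b by ring.
  exact: E.
by rewrite -gs -tofracXn mulfK // tofrac_eq0 expf_neq0 // mulf_neq0 // X_neq0.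
Qed.

End Cohomology.

(** * Polynomial families *)

Lemma exists_nonroot (K : numFieldType) (p : {poly K}) : p != 0 -> exists c, p.[c] != 0.
Proof.
move=> p0; apply: contrapT => /forallNP H.
have rs : all (root p) [seq i%:R | i <- iota 0 (size p)].
  by apply/allP => x _; apply/negPn/negP/H.
have us : uniq [seq i%:R : K | i <- iota 0 (size p)].
  by rewrite map_inj_uniq ?iota_uniq // => i j /eqP; rewrite eqr_nat => /eqP.
by have := max_poly_roots p0 rs us; rewrite size_map size_iota ltnn.
Qed.

Section PolynomialFunctions.
Variables (K : numFieldType) (P : nat).
Implicit Types (phi psi : ('I_P -> K) -> K).

Definition polyfn phi := exists c : {mpoly K[P]}, forall v, phi v = c.@[v].

Lemma polyfn_const a : polyfn (fun=> a).
Proof. by exists a%:MP => v; rewrite mevalC. Qed.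

Lemma polyfn_var i : polyfn (fun v => v i).
Proof. by exists 'X_i => v; rewrite mevalXU. Qed.

Lemma polyfnM phi psi : polyfn phi -> polyfn psi -> polyfn (fun v => phi v * psi v).
Proof. by move=> [a Ha] [b Hb]; exists (a * b) => v; rewrite mevalM Ha Hb. Qed.

Lemma polyfnX phi k : polyfn phi -> polyfn (fun v => phi v ^+ k).
Proof. by move=> [a Ha]; exists (a ^+ k) => v; rewrite Ha rmorphXn. Qed.

Lemma polyfn_sum (I : Type) (r : seq I) (Q : pred I) (F : I -> ('I_P -> K) -> K) :
  (forall i, polyfn (F i)) -> polyfn (fun v => \sum_(i <- r | Q i) F i v).
Proof.
move=> /choice[c Hc]; exists (\sum_(i <- r | Q i) c i) => v.
by rewrite meval_sum; apply: eq_bigr => i _.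
Qed.

Lemma polyfn_prod (I : Type) (r : seq I) (Q : pred I) (F : I -> ('I_P -> K) -> K) :
  (forall i, polyfn (F i)) -> polyfn (fun v => \prod_(i <- r | Q i) F i v).
Proof.
move=> /choice[c Hc]; exists (\prod_(i <- r | Q i) c i) => v.
by rewrite rmorph_prod; apply: eq_bigr => i _.
Qed.

Lemma polyfn_ext phi psi : (forall v, phi v = psi v) -> polyfn psi -> polyfn phi.
Proof. by move=> e [c Hc]; exists c => v; rewrite e. Qed.

Definition mpolyfn n (F : ('I_P -> K) -> {mpoly K[n]}) := forall m, polyfn (fun v => (F v)@_m).

Lemma mpolyfn_const n (a : {mpoly K[n]}) : mpolyfn (fun=> a).
Proof. by move=> m; apply: polyfn_const. Qed.

Lemma mpolyfnZ n phi (F : ('I_P -> K) -> {mpoly K[n]}) :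
  polyfn phi -> mpolyfn F -> mpolyfn (fun v => phi v *: F v).
Proof.
by move=> hphi hF m; apply: polyfn_ext (polyfnM hphi (hF m)) => v; rewrite mcoeffZ.
Qed.

Lemma mpolyfn_sum n (I : Type) (r : seq I) (Q : pred I) (F : I -> ('I_P -> K) -> {mpoly K[n]}) :
  (forall i, mpolyfn (F i)) -> mpolyfn (fun v => \sum_(i <- r | Q i) F i v).
Proof.
move=> h m; apply: polyfn_ext (polyfn_sum r Q (fun i => h i m)) => v.
exact: (raddf_sum (mcoeff m)).
Qed.

Lemma mpolyfn_linear n k (L : {linear {mpoly K[n]} -> {mpoly K[k]}}) d
    (F : ('I_P -> K) -> {mpoly K[n]}) :
  (forall v, (msize (F v) <= d)%N) -> mpolyfn F -> mpolyfn (fun v => L (F v)).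
Proof.
move=> hd hF m.
apply: (@polyfn_ext _ (fun v => \sum_(b : 'X_{1..n < d}) (F v)@_b * (L 'X_[b])@_m)).
  move=> v; rewrite {1}(mpolywE (hd v)) !raddf_sum /=; apply: eq_bigr => b _.
  by rewrite linearZ mcoeffZ.
by apply: polyfn_sum => b; apply: polyfnM => //; apply: polyfn_const.
Qed.

(** A family spanning at [v0] has a nonzero maximal minor there, and this minor is polynomial in the
    parameters. *)
Lemma polyfn_span n k (I : finType) (W : I -> ('I_P -> K) -> {mpoly K[n]}) v0 :
  (forall i v, W i v \is k.-homog) -> (forall i, mpolyfn (W i)) ->
  (forall g, g \is k.-homog -> exists c : I -> K, g = \sum_i c i *: W i v0) ->
  exists D : {mpoly K[P]}, D.@[v0] != 0 /\ forall v, D.@[v] != 0 ->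
    forall g, g \is k.-homog -> exists c : I -> K, g = \sum_i c i *: W i v.
Proof.
move=> Wk Wp Wspan; pose B := {m : 'X_{1..n < k.+1} | mdeg m == k}.
pose b := #|{: B}|; pose mon (j : 'I_b) : 'X_{1..n} := val (val (enum_val j)).
have dmon j : mdeg (mon j) = k by apply/eqP; exact: (valP (enum_val j)).
have monP m : mdeg m = k -> exists j, m = mon j.
  move=> mk; have lt : (mdeg m < k.+1)%N by rewrite mk.
  have mk' : mdeg (BMultinom lt) == k by apply/eqP.
  by exists (enum_rank (exist _ (BMultinom lt) mk' : B)); rewrite /mon enum_rankK.
have homP f g : f \is k.-homog -> g \is k.-homog -> (forall j, f@_(mon j) = g@_(mon j)) -> f = g.
  move=> hf hg e; apply/mpolyP => m; have [/monP[j ->]//|mk] := eqVneq (mdeg m) k.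
  by rewrite (dhomog_nemf_coeff hf mk) (dhomog_nemf_coeff hg mk).
pose A v : 'M[K]_(#|I|, b) := \matrix_(i, j) (W (enum_val i) v)@_(mon j).
have full : row_full (A v0).
  rewrite -sub1mx; apply/row_subP => j.
  have [|c Hc] := Wspan 'X_[mon j]; first by rewrite dhomogX /= dmon.
  apply/submxP; exists (\row_i c (enum_val i)); apply/rowP => l.
  rewrite !mxE; have := congr1 (mcoeff (mon l)) Hc; rewrite mcoeffX raddf_sum /=.
  rewrite (reindex (@enum_val I (fun=> true))) /=; last first.
    by exists enum_rank => x _; rewrite ?enum_valK ?enum_rankK.
  have -> : (mon j == mon l) = (j == l).
    by apply/eqP/eqP => [|->//] /val_inj/val_inj/enum_val_inj.
  by move=> ->; apply: eq_bigr => i _; rewrite !mxE mcoeffZ.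
pose r := fullrankfun full.
have /choice[c Hc] : forall ij : 'I_b * 'I_b, exists c : {mpoly K[P]},
    forall v, (W (enum_val (r ij.1)) v)@_(mon ij.2) = c.@[v] by move=> [i j]; apply: Wp.
pose C : 'M[{mpoly K[P]}]_b := \matrix_(i, j) c (i, j).
have evC v : (\det C).@[v] = \det (rowsub r (A v)).
  rewrite -det_map_mx; congr (\det _); apply/matrixP => i j; rewrite !mxE /=.
  by rewrite -(Hc (i, j)).
exists (\det C); split; first by rewrite evC -unitfE -unitmxE fullrowsub_unit.
move=> v; rewrite evC -unitfE -unitmxE => uA g hg.
pose rg : 'rV_b := \row_j g@_(mon j); pose u := rg *m invmx (rowsub r (A v)).
exists (fun i => \sum_(j | enum_val (r j) == i) u 0 j).
have -> : \sum_i (\sum_(j | enum_val (r j) == i) u 0 j) *: W i v = \sum_j u 0 j *: W (enum_val (r j)) v.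
  rewrite [RHS](partition_big (fun j => enum_val (r j)) xpredT) //=; apply: eq_bigr => i _.
  by rewrite scaler_suml; apply: eq_bigr => j /eqP ->.
apply: homP => // [|j]; first by apply: rpred_sum => j _; apply: rpredZ.
have : u *m rowsub r (A v) = rg by rewrite /u mulmxKV.
move/(congr1 (fun N : 'rV_ _ => N 0 j)); rewrite !mxE raddf_sum => <- /=.
by apply: eq_bigr => l _; rewrite !mxE mcoeffZ.
Qed.

(** Open sets of [pspace] are given by forms, while conditions such as those of [polyfn_span] need
    not be homogeneous. Where a homogeneous part of [D] is nonzero, [D] is nonzero somewhere on the
    line. *)
Lemma homog_component (D : {mpoly K[P]}) v0 : D.@[v0] != 0 -> exists k,
  (pihomog mdeg k D).@[v0] != 0 /\
  forall v, (pihomog mdeg k D).@[v] != 0 -> exists c, c != 0 /\ D.@[fun i => c * v i] != 0.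
Proof.
move=> Dv0; pose N := msize D.
have DE : D = \sum_(k < N) pihomog mdeg k D by apply: pihomog_partitionE.
have [k Hk] : exists k : 'I_N, (pihomog mdeg k D).@[v0] != 0.
  apply: contrapT => /forallNP H; move/negP: Dv0; apply; rewrite DE meval_sum big1 // => k _.
  by apply/eqP/negPn/negP/H.
exists k; split=> // v Dv.
pose p : {poly K} := \poly_(j < N) (pihomog mdeg j D).@[v].
(* The factor ['X] rules out [c = 0]. *)
have p0 : 'X * p != 0.
  rewrite mulf_neq0 ?polyX_eq0 //; apply: contraNneq Dv => p0.
  by have := congr1 (fun q : {poly K} => q`_k) p0; rewrite coef_poly ltn_ord coef0 => ->.
have [c] := exists_nonroot p0; rewrite hornerM hornerX mulf_eq0 negb_or => /andP[c0 pc].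
exists c; split=> //; rewrite DE meval_sum; move: pc; rewrite horner_poly.
congr (_ != 0); apply: eq_bigr => j _.
by rewrite (meval_scale _ _ (pihomogP _ _ _)) mulrC.
Qed.

End PolynomialFunctions.

(** * Singular points of the members of a Severi variety *)

Section Severi.
Variable K : numClosedFieldType.
Hypothesis Kbig : large_fibers K.

Lemma pcoords_propor n (x y : Proj K n) : propor (pcoords x) (pcoords y) -> x = y.
Proof.
move=> [c Hc]; apply: (@pspace_eq _ _ x y c); apply/rowP => i.
by rewrite [LHS]Hc mxE.
Qed.

Lemma severi_points d delta (Y : linsys K 3 d) : severi d delta Y ->
  exists q : 'I_delta -> Proj K 3,
    [/\ forall l l', l != l' -> ~ propor (pcoords (q l)) (pcoords (q l')),
        forall x, sing_locus Y x <-> exists l, x = q l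
      & forall l, nodal_at (rep Y : {mpoly K[4]}) (pcoords (q l))].
Proof.
move=> [/card_set_bijP[f [fim finj fsurj]] nodes].
have /choice[q Hq] : forall l : 'I_delta, exists x, sing_locus Y x /\ f x = l.
  by move=> l; have [x sx fx] := fsurj l (ltn_ord l); exists x.
exists q; split.
- move=> l l' ll' /pcoords_propor e; move/negP: ll'; apply; apply/eqP/val_inj.
  have [_ e1] := Hq l; have [_ e2] := Hq l'.
  by rewrite -[LHS]e1 -[RHS]e2 e.
- move=> x; split=> [sx|[l ->]]; last by have [] := Hq l.
  have fx : (f x < delta)%N by apply: fim.
  exists (Ordinal fx); have [s1 e1] := Hq (Ordinal fx).
  by apply: finj; rewrite ?inE // e1.
- by move=> l; apply: node_nodal; apply: nodes; have [] := Hq l.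
Qed.

Lemma severi_of_points d delta (Y : linsys K 3 d) (q : 'I_delta -> Proj K 3) : (0 < d)%N ->
  injective q -> (forall x, sing_locus Y x <-> exists l, x = q l) ->
  (forall l, nodal_at (rep Y : {mpoly K[4]}) (pcoords (q l))) -> severi d delta Y.
Proof.
move=> d0 qinj Hq nod; split; last first.
  by move=> p /Hq[l ->]; apply: nodal_node.
have /choice[f Hf] : forall x, exists k : nat, sing_locus Y x -> exists l : 'I_delta, k = l /\ x = q l.
  move=> x; have [/Hq[l ->]|nx] := pselect (sing_locus Y x); last by exists 0%N.
  by exists l => _; exists l.
apply/card_set_bijP; exists f; split.
- by move=> x sx; have [l [e _]] := Hf x sx; rewrite /= e ltn_ord.
- move=> x y; rewrite !inE => /Hf[l [-> ->]] /Hf[l' [-> ->]] e.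
  by congr (q _); apply: val_inj.
- move=> k kd; exists (q (Ordinal kd)); first by apply/Hq; exists (Ordinal kd).
  have sq : sing_locus Y (q (Ordinal kd)) by apply/Hq; exists (Ordinal kd).
  by have [l [-> /qinj <-]] := Hf _ sq.
Qed.

Lemma exists_linform_nonvanishing n delta (q : 'I_delta -> 'I_n -> K) :
  (forall l, exists i, q l i != 0) -> exists b, forall l, (linform b).@[q l] != 0.
Proof.
move=> q0; pose p := \prod_l linform (q l).
have p0 : p != 0.
  apply/prodf_neq0 => l _; have [c qc] := q0 l; apply: contraNneq qc => e.
  have := meval_linform (q l) (fun i => (i == c)%:R); rewrite e meval0 (bigD1 c) //= eqxx mulr1.
  by rewrite big1 ?addr0 => [/esym->//|i /negPf->]; rewrite mulr0.
have [b Hb] := mpoly_nonzero_eval Kbig p0; exists b => l.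
move: Hb; rewrite rmorph_prod => /prodf_neq0 /(_ l isT); rewrite /= !meval_linform.
by under eq_bigr do rewrite mulrC.
Qed.

Lemma sing_point_of d (Y : linsys K 3 d) v : (0 < d)%N -> (exists i, v i != 0) ->
  (forall i, (rep Y : {mpoly K[4]})^`M(i).@[v] = 0) ->
  exists x, sing_locus Y x /\ propor (pcoords x) v.
Proof.
move=> d0 v0 Hv; have [x [_ [c c0 Hx]]] := mkvpoint v0; exists x.
have hf := dhomog_is_dhomog (rep Y).
split; last by exists c^-1 => i; rewrite Hx mulKf.
apply/(singular_at_homog _ hf) => // i.
by rewrite (meval_eq _ Hx) (meval_scale _ _ (mderiv_homog i hf)) Hv mulr0.
Qed.

End Severi.

(** * The regular locus of a Severi variety *)

Section Equations.
Variables (K : numClosedFieldType) (d : nat).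
Local Notation E := (dhomog 4 K d).

Definition hform (v : 'I_(\dim (fullv : {vspace E})) -> K) : E :=
  \sum_p v p *: (vbasis fullv)`_p.

Lemma hform_hcoords (Y : linsys K 3 d) : hform (hcoords Y) = rep Y.
Proof. by rewrite /hform /hcoords -coord_vbasis // memvf. Qed.

Lemma hformZ c v : hform (fun p => c * v p) = c *: hform v.
Proof. by rewrite /hform scaler_sumr; apply: eq_bigr => p _; rewrite scalerA. Qed.

Lemma hform_coord (g : E) : hform (fun p => coord (vbasis fullv) p g) = g.
Proof. by rewrite /hform -coord_vbasis // memvf. Qed.

Lemma hform_mpoly v : (hform v : {mpoly K[4]}) = \sum_p v p *: (((vbasis fullv)`_p : E) : {mpoly K[4]}).
Proof. by rewrite /hform raddf_sum; apply: eq_bigr => p _ /=. Qed.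

Lemma open_nonvanishing (D : {mpoly K[\dim (fullv : {vspace E})]}) k : D \is k.-homog ->
  open ([set Y : linsys K 3 d | D.@[hcoords Y] != 0]%classic : set (linsys K 3 d)).
Proof.
move=> hD; suff : zariski_open ([set Y : linsys K 3 d | D.@[hcoords Y] != 0]%classic) by [].
exists [set D]%classic; first by move=> _ ->; exists k.
apply/seteqP; split=> Y /=.
  by move=> DY /(_ D erefl) /eqP; rewrite (negPf DY).
by move=> /existsNP[_ /not_implyP[-> /eqP]].
Qed.

Lemma open_nonvanishingP (U : set (linsys K 3 d)) Y : open U -> U Y ->
  exists (D : {mpoly K[\dim (fullv : {vspace E})]}) (k : nat), [/\ D \is k.-homog, D.@[hcoords Y] != 0
    & forall Y', D.@[hcoords Y'] != 0 -> U Y'].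
Proof.
move=> oU UY; have [I hI eU] : zariski_open U by exact: oU.
move: UY; rewrite eU => /existsNP[D /not_implyP[ID /eqP DY]].
have [k hk] := hI _ ID; exists D, k; split=> // Y' DY' H.
by move/eqP: DY'; apply; apply: H.
Qed.

End Equations.

Section Family.
Variables (K : fieldType) (n k d : nat) (J : 'I_n -> {mpoly K[n]}) (r : 'I_n -> nat).
Variable T : 'I_d -> {mpoly K[n]}.
Hypothesis rk : forall i, (r i <= k)%N.
Hypothesis hJ : forall i, J i \is (r i).-homog.
Hypothesis hT : forall l, T l \is k.-homog.

(** Indices of the wrong degree contribute [0], which keeps the index type finite and independent of
    the [r i]. *)
Definition fam (s : ('I_n * 'X_{1..n < k.+1}) + 'I_d) : {mpoly K[n]} :=
  match s with
  | inl im => if mdeg im.2 == (k - r im.1)%N then 'X_[im.2] * J im.1 else 0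
  | inr l => T l
  end.

Lemma fam_homog s : fam s \is k.-homog.
Proof.
case: s => [[i m]|l] //=; case: eqP => [e|_]; last exact: dhomog0.
rewrite -[X in X.-homog](subnK (rk i)); apply: dhomogM => //.
by rewrite dhomogX /= e.
Qed.

Lemma fam_span g c : g \is k.-homog -> genby J (g - \sum_l c l *: T l) ->
  exists c', g = \sum_s c' s *: fam s.
Proof.
move=> hg; have hgT : g - \sum_l c l *: T l \is k.-homog.
  apply: rpredB; first exact: hg.
  by apply: rpred_sum => l _; apply: rpredZ; apply: hT.
case/(genby_homog hJ hgT) => a [ea ha].
exists (fun s => match s with inl im => (a im.1)@_(val im.2) | inr l => c l end).
rewrite big_sumType /= -[LHS](subrK (\sum_l c l *: T l)); congr (_ + _).
rewrite ea -(pair_bigA _ (fun i (m : 'X_{1..n < k.+1}) => (a i)@_m *: (if mdeg m == (k - r i)%N then 'X_[m] * J i else 0))) /=.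
apply: eq_bigr => i _; have [hai _] := ha i.
have sz : (msize (a i) <= k.+1)%N.
  rewrite msizeE big_seq; apply: (big_ind (fun N => N <= k.+1)%N) => [//|x y hx hy|m].
    by rewrite geq_max hx.
  by move=> /(dhomog_mf hai) /= ->; rewrite ltnS leq_subr.
rewrite {1}(mpolywE sz) mulr_suml; apply: eq_bigr => m _; rewrite -scalerAl.
have [//|mk] := eqVneq (mdeg m) (k - r i)%N.
by rewrite (dhomog_nemf_coeff hai mk) !scale0r.
Qed.

Lemma span_fam g c : g = \sum_s c s *: fam s -> genby J (g - \sum_l c (inr l) *: T l).
Proof.
rewrite big_sumType /= => ->; rewrite addrK; apply: ideal_sum => [|[i m] _ /=]; first exact: genby_ideal.
have [J0 _ JM] := genby_ideal J; rewrite -mul_mpolyC; apply: (JM).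
by case: ifP => // _; apply: JM; apply: genby_gen.
Qed.

End Family.

Lemma mpolyfn_ext (K : numFieldType) P n (F G : ('I_P -> K) -> {mpoly K[n]}) :
  (forall v, F v = G v) -> mpolyfn G -> mpolyfn F.
Proof. by move=> e h m; apply: polyfn_ext (h m) => v; rewrite e. Qed.

Section Openness.
Variable K : numClosedFieldType.
Hypothesis Kbig : large_fibers K.

Lemma nodal_corank n delta (f : {mpoly K[n]}) d (q : 'I_delta -> 'I_n -> K)
    (ell : {mpoly K[n]}) a (e : 'I_delta -> {mpoly K[n]}) :
  f \is d.-homog -> (forall l, exists i, q l i != 0) ->
  (forall l, nodal_at f (q l)) ->
  (forall v, (exists i, v i != 0) -> (forall i, f^`M(i).@[v] = 0) -> exists l, propor (q l) v) ->
  ell \is 1.-homog -> (forall l, ell.@[q l] != 0) ->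
  (forall l, e l \is (a).-homog) -> (forall l l', (e l).@[q l'] = (l == l')%:R) ->
  exists k0, forall k g, (k0 <= k)%N -> g \is k.-homog ->
    exists c : 'I_delta -> K, genby (fun i => f^`M(i)) (g - \sum_l c l *: (ell ^+ (k - a) * e l)).
Proof.
move=> hf q0 nod only hell ellq he eq.
apply: (@corank_nodes _ _ Kbig _ _ (fun=> d.-1) _ q) => //.
- by move=> i; apply: mderiv_homog.
- move=> v Hv; have [v0|] := pselect (exists i, v i != 0); first by right; apply: only.
  by move/forallNP => v0; left=> i; apply/eqP/negPn/negP/v0.
- by move=> l i; case: (nod l).
- by move=> l; apply: (nodal_colon hf (q0 l) (nod l)).
Qed.

(** Evaluation at the singular points kills the Jacobian ideal, so the identity matrix of values of
    the [h j] factors through the matrix of values of the [e l], which is therefore invertible. *)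
Lemma dual_transfer n delta k a (ell : {mpoly K[n]}) (q : 'I_delta -> 'I_n -> K)
    (f : {mpoly K[n]}) (e : 'I_delta -> {mpoly K[n]}) :
  (delta <= k.+1)%N ->
  (forall l, exists i, q l i != 0) -> (forall l l', l != l' -> ~ propor (q l) (q l')) ->
  (forall l i, f^`M(i).@[q l] = 0) -> (forall l, e l \is (a).-homog) ->
  (forall g, g \is k.-homog -> exists c : 'I_delta -> K,
     genby (fun i => f^`M(i)) (g - \sum_l c l *: (ell ^+ (k - a) * e l))) ->
  exists e' : 'I_delta -> {mpoly K[n]}, forall j,
    e' j \is (a).-homog /\ forall l, (e' j).@[q l] = (l == j)%:R.
Proof.
move=> dk q0 qne sing he H.
have Ik : (#|{: 'I_delta}| <= k.+1)%N by rewrite card_ord.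
have /choice[h Hh] := fun j => interpolation q0 qne j Ik.
have /choice[c Hc] : forall j, exists c : 'I_delta -> K,
    genby (fun i => f^`M(i)) (h j - \sum_l c l *: (ell ^+ (k - a) * e l)).
  by move=> j; apply: H; case: (Hh j).
pose C : 'M[K]_delta := \matrix_(j, l) c j l.
pose B : 'M[K]_delta := \matrix_(l, i) ((ell.@[q i] ^+ (k - a)) * (e l).@[q i]).
have CB : C *m B = 1%:M.
  apply/matrixP => j i; rewrite !mxE.
  have [b Hb] := Hc j; have [_ hji] := Hh j.
  have Z : (\sum_i b i * f^`M(i)).@[q i] = 0.
    by rewrite meval_sum big1 // => i' _; rewrite mevalM sing mulr0.
  rewrite -Hb mevalB hji in Z; rewrite eq_sym.
  move/eqP: Z; rewrite subr_eq0 => /eqP ->; rewrite meval_sum.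
  by apply: eq_bigr => l _; rewrite !mxE mevalZ mevalM rmorphXn.
have BC : B *m C = 1%:M by apply: mulmx1C.
pose G : 'M[K]_delta := \matrix_(l, i) (e l).@[q i].
have BE : B = G *m diag_mx (\row_i ell.@[q i] ^+ (k - a)).
  by apply/matrixP => l i; rewrite mul_mx_diag !mxE mulrC.
have uG : G \in unitmx.
  have : B \in unitmx by have [] := mulmx1_unit BC.
  by rewrite BE unitmx_mul => /andP[].
exists (fun j => \sum_l (invmx G) j l *: e l) => j; split.
  by apply: rpred_sum => l _; apply: rpredZ.
move=> i; rewrite meval_sum eq_sym.
have := congr1 (fun N : 'M_ _ => N j i) (mulVmx uG); rewrite !mxE => <-.
by apply: eq_bigr => l _; rewrite mevalZ mxE.
Qed.

Lemma sing_only d (Y : linsys K 3 d) delta (q : 'I_delta -> Proj K 3) : (0 < d)%N ->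
  (forall x, sing_locus Y x <-> exists l, x = q l) ->
  forall v, (exists i, v i != 0) -> (forall i, (rep Y : {mpoly K[4]})^`M(i).@[v] = 0) ->
  exists l, propor (pcoords (q l)) v.
Proof.
move=> d0 Hq v v0 Hv; have [x [/Hq[l ->] h]] := sing_point_of d0 v0 Hv.
by exists l.
Qed.

(** That the Jacobian ideal and the fixed forms [T l] span degree [k] is an open condition. On the
    Severi variety it implies, by [dual_transfer], that the [e l] chosen for [Y0] still separate the
    nodes. *)
Lemma regular_locus_open n delta (Y0 : linsys K 3 n) : (0 < n)%N ->
  severi n delta Y0 -> h1_ideal_zero n (sing_locus Y0) ->
  exists U : set (linsys K 3 n), [/\ open U, U Y0 &
    forall Y, U Y -> severi n delta Y -> h1_ideal_zero n (sing_locus Y)].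
Proof.
move=> n0 sY h1Y; have [q [qne Hq nod]] := severi_points sY.
have q0 l := pcoords_neq0 (q l).
have [e He] := dual_of_h1 Hq qne q0 h1Y.
have [b Hb] := exists_linform_nonvanishing Kbig q0.
set ell := linform b in Hb.
have hell : ell \is 1.-homog := linform_homog b.
have he l : e l \is n.-homog by case: (He l).
have eq l l' : (e l).@[pcoords (q l')] = (l == l')%:R by have [_ ->] := He l; rewrite eq_sym.
have [k0 Hk0] := nodal_corank (dhomog_is_dhomog (rep Y0)) q0 nod (sing_only n0 Hq) hell Hb he eq.
(* [k0] is for the corank, [n] keeps [k - n] from truncating, and [delta] leaves room for
   interpolation at the nodes. *)
pose k := (k0 + n + delta)%N.
have k0k : (k0 <= k)%N by rewrite /k; lia.
have nk : (n <= k)%N by rewrite /k; lia.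
pose T l := ell ^+ (k - n) * e l.
have hT l : T l \is k.-homog.
  by rewrite -(subnK nk); apply: dhomogM => //; apply: homog_exp.
pose J (v : 'I_(\dim (fullv : {vspace dhomog 4 K n})) -> K) i := (hform v : {mpoly K[4]})^`M(i).
have hJ v i : J v i \is (n.-1).-homog := mderiv_homog i (dhomog_is_dhomog (hform v)).
have rk (i : 'I_4) : (n.-1 <= k)%N by lia.
pose W s v := fam (k := k) (J v) (fun=> n.-1) T s.
have [|||D [D0 HD]] := @polyfn_span K _ 4 k _ W (hcoords Y0).
- by move=> s v; apply: fam_homog.
- move=> [[i m]|l]; last exact: mpolyfn_const.
  rewrite /W /=; case: (mdeg m == (k - n.-1)%N); last exact: mpolyfn_const.
  pose B p : {mpoly K[4]} := 'X_[m] * (((vbasis fullv)`_p : dhomog 4 K n) : {mpoly K[4]})^`M(i).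
  apply: (@mpolyfn_ext _ _ _ _ (fun v => \sum_p v p *: B (nat_of_ord p))).
    move=> v; rewrite /J hform_mpoly mderiv_sum mulr_sumr; apply: eq_bigr => p _.
    by rewrite mderivZ scalerAr.
  by apply: mpolyfn_sum => p; apply: mpolyfnZ; [apply: polyfn_var|apply: mpolyfn_const].
- move=> g hg; have [c Hc] := Hk0 _ _ k0k hg.
  apply: (fam_span (hJ _) hT hg (c := c)).
  by rewrite /J hform_hcoords.
have [j [Dj HDj]] := homog_component D0.
exists [set Y : linsys K 3 n | (pihomog mdeg j D).@[hcoords Y] != 0]%classic; split=> //.
  exact: open_nonvanishing (pihomogP _ _ _).
move=> Y /HDj[c [c0 /HD span]] sY'.
have [q' [qne' Hq' nod']] := severi_points sY'.
have q0' l := pcoords_neq0 (q' l).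
have [|||e' He'] := @dual_transfer _ delta k n ell (fun l => pcoords (q' l))
    (c *: (rep Y : {mpoly K[4]})) e _ q0' qne' _ he.
- by rewrite /k; lia.
- by move=> l i; rewrite mderivZ mevalZ; have [-> _] := nod' l; rewrite mulr0.
- move=> g /span[c' Hc']; exists (fun l => c' (inr l)).
  have := span_fam Hc'; rewrite /J hformZ hform_hcoords.
  by [].
by apply: (h1_of_dual Hq' q0'); exists e'.
Qed.

End Openness.

(** * Irreducible subsets and components *)

Section Components.
Variables (K : fieldType) (V : vectType K).
Local Notation T := (pspace V).

(** Noetherian induction on a closed [Z] whose intersection with [A] has [S] in its closure: if the
    intersection is reducible, one of the two pieces keeps [S] in its closure. *)
Lemma irreducible_in_closure (A : set T) (S : T) : closure A S ->
  exists B : set T, [/\ (B `<=` A)%classic, irreducible_set B & closure B S].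
Proof.
suff H : forall Z : set T, closed Z -> closure (A `&` Z)%classic S ->
    exists B : set T, [/\ (B `<=` A)%classic, irreducible_set B & closure B S].
  by move=> cS; apply: (H setT); [exact: closedT|rewrite setIT].
apply: pspace_noetherian => Z cZ IH cS.
have [irr|nirr] := pselect (irreducible_set (A `&` Z)%classic).
  by exists (A `&` Z)%classic; split=> // x [].
have ne : (A `&` Z !=set0)%classic.
  apply: contrapT => /set0P/negP; rewrite negbK => /eqP e.
  by move: cS; rewrite e closure0.
move/not_andP: nirr => [//|/existsNP[Z1 /existsNP[Z2]]].
move/not_implyP => [c1 /not_implyP[c2 /not_implyP[sub /not_orP[n1 n2]]]].
have strict Zi : ~ (A `&` Z `<=` Zi)%classic -> (Z `&` Zi `<` Z)%classic.
  by move=> ni; split=> [x []//|ZZ]; apply: ni => x [_ /ZZ[]].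
have e : (A `&` Z = (A `&` (Z `&` Z1)) `|` (A `&` (Z `&` Z2)))%classic.
  apply/seteqP; split=> [x [Ax Zx]|x [[Ax [Zx _]]|[Ax [Zx _]]]] //.
  by have [z1|z2] := sub x (conj Ax Zx); [left|right].
move: cS; rewrite e closureU => -[cS|cS].
  by apply: (IH (Z `&` Z1)%classic) => //; [apply: closedI|apply: strict].
by apply: (IH (Z `&` Z2)%classic) => //; [apply: closedI|apply: strict].
Qed.

Lemma irreducible_component_exists (A B : set T) : (B `<=` A)%classic -> irreducible_set B ->
  exists W, irreducible_component A W /\ (B `<=` W)%classic.
Proof.
move=> BA irrB.
(* Again the empty chain has to satisfy the property, so it concerns [B] together with [X]. *)
pose Q (X : set T) := (B `|` X `<=` A)%classic /\ irreducible_set (B `|` X)%classic.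
have [|X [[XA irrX] Xmax]] := @Zorn_bigcup T Q.
  move=> F FQ tot; split.
    by move=> x [/BA//|[X FX Xx]]; have [h _] := FQ X FX; apply: h; right.
  split; first by have [[x Bx] _] := irrB; exists x; left.
  move=> Z1 Z2 c1 c2 sub.
  have [Bne Birr] := irrB.
  have alt X : F X -> (B `|` X `<=` Z1)%classic \/ (B `|` X `<=` Z2)%classic.
    move=> FX; have [_ [_ h]] := FQ X FX; apply: h => // x [Bx|Xx]; apply: sub; first by left.
    by right; exists X.
  have [all1|/existsNP[X0 /not_implyP[FX0 n1]]] :=
      pselect (forall X, F X -> (B `|` X `<=` Z1)%classic).
    have [B1|B2] := Birr Z1 Z2 c1 c2 (fun x Bx => sub x (or_introl Bx)).
      by left=> x [/B1//|[X FX Xx]]; apply: (all1 X FX); right.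
    have [[X FX]|noF] := pselect (exists X, F X).
      left=> x [Bx|[Y FY Yx]]; first by apply: (all1 X FX); left.
      by apply: (all1 Y FY); right.
    by right=> x [/B2//|[X FX _]]; case: noF; exists X.
  right; have X02 : (B `|` X0 `<=` Z2)%classic by case: (alt X0 FX0).
  move=> x [Bx|[X FX Xx]]; first by apply: X02; left.
  have [XX0|X0X] := tot X X0 FX FX0; first by apply: X02; right; apply: XX0.
  have [h|h] := alt X FX; last by apply: h; right.
  by case: n1 => y [By|X0y]; apply: h; [left|right; apply: X0X].
exists (B `|` X)%classic; split; last by move=> x; left.
split=> // W' W'A irrW' sub.
have [eX|nX] := pselect (W' `<=` X)%classic; first by move=> x /eX; right.
have eW : (B `|` W' = W')%classic by apply/seteqP; split=> [x [Bx|//]|x]; [apply: sub; left|right].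
case: (Xmax W').
  by split=> // x Xx; apply: sub; right.
by split; rewrite eW.
Qed.

End Components.

(** * The degenerating family *)

Definition xo (i : 'I_4) : nat := (i != ord0).

Lemma xdegU (i : 'I_4) : xdeg U_(i)%MM = xo i.
Proof.
rewrite /xdeg /xo; case: (unliftP ord0 i) => [k ->|->].
  rewrite eq_sym neq_lift (bigD1 k) //= mnm1E eqxx big1 ?addn0 // => l lk.
  by rewrite mnm1E (inj_eq lift_inj) eq_sym (negPf lk).
by rewrite eqxx big1 // => l _; rewrite mnm1E (negPf (neq_lift _ _)).
Qed.

(** In [x^b d_i F_t], with [s = xdeg b], the part from [phi g j] carries [t^(m - j)] and, after
    rescaling, also [t^(minn (s + j - xo i) e)]. The total exponent is least at [j = m], and [wexp]
    is its excess over that minimum. *)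
Definition wexp (e m : nat) (i : 'I_4) (s j : nat) : nat :=
  ((m - j) + minn (s + j - xo i) e - ((m - xo i) + minn s (e - m + xo i)))%N.

(** The condition on [j] excludes [j = 0] with [i] nonzero, where [s + j - xo i] may truncate; the
    derivative of [phi g 0] is [0] in that case. *)
Lemma wexpE e m i s j : (0 < m)%N -> (m <= e)%N -> (0 < j + (i == ord0))%N ->
  (wexp e m i s j + ((m - xo i) + minn s (e - m + xo i)) = (m - j) + minn (s + j - xo i) e)%N.
Proof. rewrite /wexp /xo; case: eqP => _ /=; lia. Qed.

(** What survives at [t = 0]: below the threshold for [s] the parts [j <= m], which make up
    [x_0^(n-m) g]; above it the parts [j >= m], which will make up [Sh]; at the threshold all
    parts. *)
Lemma wexp_eq0 e m i s j : (0 < m)%N -> (m <= e)%N -> (0 < j + (i == ord0))%N ->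
  (wexp e m i s j == 0%N) = [|| (s < e - m + xo i)%N && (j <= m)%N, s == (e - m + xo i)%N
     | (e - m + xo i < s)%N && (m <= j)%N].
Proof. rewrite /wexp /xo; case: eqP => _ /=; lia. Qed.

Section Family.
Variable K : numClosedFieldType.
Local Notation A := {mpoly K[4]}.

Lemma mderiv_xhomog k (p : A) i : p \is k.-homog for xdeg -> p^`M(i) \is (k - xo i).-homog for xdeg.
Proof.
move=> hp; apply/dhomogP => m; rewrite mcoeff_msupp mcoeff_deriv => h.
have : p@_(m + U_(i)) != 0 by apply: contraNneq h => ->; rewrite mul0rn.
by rewrite -mcoeff_msupp => /(dhomog_mf hp) /= <-; rewrite xdegD xdegU addnK.
Qed.

Lemma mderiv_xhomog0 (p : A) i : p \is 0.-homog for xdeg -> i != ord0 -> p^`M(i) = 0.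
Proof.
move=> hp i0; apply/mpolyP => m; rewrite mcoeff_deriv mcoeff0.
rewrite (dhomog_nemf_coeff hp) ?mul0rn //= xdegD xdegU /xo i0; lia.
Qed.

Variables (k e : nat).

(** The range includes [k + 1] because the nominal degree [xdeg b + j] of [x^b d_0 phi_j] can reach
    it when [j = n], although that derivative is [0]. *)
Definition xweight (a : nat -> K) (h : A) : A := \sum_(j < k.+2) a j *: pihomog xdeg j h.

Lemma xweight_linear a : linear (xweight a).
Proof.
move=> c p q; rewrite /xweight scaler_sumr -big_split; apply: eq_bigr => j _ /=.
by rewrite linearP scalerDr !scalerA mulrC.
Qed.

HB.instance Definition _ a := GRing.isLinear.Build K A A _ (xweight a) (xweight_linear a).

Lemma xweight_homog a j h : (j <= k.+1)%N -> h \is j.-homog for xdeg -> xweight a h = a j *: h.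
Proof.
move=> jk hh; have jk' : (j < k.+2)%N by [].
rewrite /xweight (bigD1 (Ordinal jk')) //= pihomog_dE // big1 ?addr0 // => l lj.
by rewrite (pihomog_ne0 _ hh) ?scaler0 //; apply: contraNneq lj => e'; apply/eqP/val_inj.
Qed.

Lemma xweight_mul a b h : xweight a (xweight b h) = xweight (fun j => a j * b j) h.
Proof.
rewrite {2}/xweight linear_sum; apply: eq_bigr => j _; rewrite linearZ /=.
by rewrite (xweight_homog _ _ (pihomogP _ _ _)) -1?ltnS // scalerA mulrC.
Qed.

Lemma xweight1 a h : h \is k.-homog -> (forall j, a j = 1) -> xweight a h = h.
Proof.
move=> hh a1; rewrite [RHS](pihomog_xdeg_sum hh) /xweight big_ord_recr /=.
rewrite (pihomog_xdeg_big hh) // scaler0 addr0; apply: eq_bigr => j _.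
by rewrite a1 scale1r.
Qed.

Variables (n m : nat) (Sh : A).
Hypothesis mn : (m <= n)%N.
Hypothesis m0 : (0 < m)%N.
Hypothesis hS : Sh \is n.-homog.
Hypothesis nk : (n <= k)%N.
Hypothesis me : (m <= e)%N.

Local Notation X0 := ('X_ord0 : A).

(* [phi g j], [degF t g] and [degG t g] are the part of degree [j], [F_t] and
   [G_t] of the introduction. *)
Definition phi (g : A) (j : nat) : A :=
  if (j <= m)%N then pihomog xdeg j (X0 ^+ (n - m) * g) else pihomog xdeg j Sh.

Definition degF (t : K) (g : A) : A := \sum_(j < n.+1) t ^+ (m - j) *: phi g j.
Definition degG (t : K) (g : A) : A := \sum_(j < n.+1) t ^+ (j - m) *: phi g j.

(* [x^b d_i F_t], its part of degree [j] in the last three variables multiplied by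
   [t^(min j e)], divided by the largest possible power of [t]. *)
Definition wtl (t : K) (g : A) (i : 'I_4) (b : 'X_{1..4}) : A :=
  \sum_(j < n.+1) t ^+ wexp e m i (xdeg b) j *: ('X_[b] * (phi g j)^`M(i)).

Lemma phi_xhomog g j : phi g j \is j.-homog for xdeg.
Proof. by rewrite /phi; case: ifP => _; apply: pihomogP. Qed.

Lemma X0n_homog j : X0 ^+ j \is j.-homog.
Proof. by apply: homog_exp; rewrite dhomogX /= mdeg1. Qed.

Lemma pihomog_xdeg_homog d j (p : A) : p \is d.-homog -> pihomog xdeg j p \is d.-homog.
Proof.
move=> hp; apply/dhomogP => b; rewrite mcoeff_msupp mcoeff_pihomog; case: ifP => _; last by rewrite eqxx.
by rewrite -mcoeff_msupp => /(dhomog_mf hp).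
Qed.

Lemma phi_homog g j : g \is m.-homog -> phi g j \is n.-homog.
Proof.
move=> hg; rewrite /phi; case: ifP => _; apply: pihomog_xdeg_homog => //.
by rewrite -{2}(subnK mn); apply: dhomogM => //; apply: X0n_homog.
Qed.

Lemma xweight_wtl t g i b : g \is m.-homog -> mdeg b = (k - n.-1)%N ->
  xweight (fun j => t ^+ minn j e) ('X_[b] * (degF t g)^`M(i)) =
  t ^+ ((m - xo i) + minn (xdeg b) (e - m + xo i)) *: wtl t g i b.
Proof.
move=> hg db; rewrite /degF mderiv_sum mulr_sumr linear_sum /wtl scaler_sumr.
apply: eq_bigr => j _; rewrite mderivZ -scalerAr linearZ /= scalerA -exprD.
have [/andP[/eqP j0 i0]|ji] := boolP ((j == 0%N :> nat) && (i != ord0)).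
  rewrite (_ : (phi g j)^`M(i) = 0); first by rewrite mulr0 linear0 !scaler0.
  apply: mderiv_xhomog0 i0; have := phi_xhomog g j.
  by rewrite [X in X.-homog for xdeg]j0.
have ji' : (0 < j + (i == ord0))%N by move: ji; case: (eqVneq i ord0) => _ /=; [rewrite addn1|rewrite andbT addn0 lt0n].
have hx : 'X_[b] * (phi g j)^`M(i) \is (xdeg b + j - xo i).-homog for xdeg.
  have -> : (xdeg b + j - xo i = xdeg b + (j - xo i))%N.
    by move: ji'; rewrite /xo; case: eqP => _ /=; lia.
  apply: dhomogM; first by rewrite dhomogX.
  by apply: mderiv_xhomog; apply: phi_xhomog.
rewrite (xweight_homog _ _ hx); last first.
  have := xdeg_mdeg b; rewrite db; have := ltn_ord j; move: ji' m0 mn nk.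
  by rewrite /xo; case: eqP => _ /=; lia.
by rewrite !scalerA -!exprD [(_ + wexp _ _ _ _ _)%N]addnC wexpE.
Qed.

Definition wfam t g delta (T : 'I_delta -> A) (s : ('I_4 * 'X_{1..4 < k.+1}) + 'I_delta) : A :=
  match s with
  | inl im => if mdeg im.2 == (k - n.-1)%N then wtl t g im.1 im.2 else 0
  | inr l => T l
  end.

(** For nonzero [t] the rescaling is invertible on forms of degree [k] and takes the multiples of
    the derivatives of [F_t] to nonzero multiples of the [wtl t]. *)
Lemma corank_degF t g delta (T : 'I_delta -> A) : t != 0 -> g \is m.-homog ->
  (forall h, h \is k.-homog -> exists c, h = \sum_s c s *: wfam t g T s) ->
  corank_le (degF t g) k delta.
Proof.
move=> t0 hg H; pose a j := t ^+ minn j e; pose a' j := (t ^+ minn j e)^-1.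
exists (fun l => xweight a' (T l)) => h hh.
have aa h' : h' \is k.-homog -> xweight a' (xweight a h') = h'.
  by move=> hh'; rewrite xweight_mul xweight1 // => j; rewrite /a /a' mulVf // expf_neq0.
have hxh : xweight a h \is k.-homog.
  by apply: rpred_sum => j _; apply: rpredZ; apply: pihomog_xdeg_homog.
have [c Hc] := H _ hxh; exists (fun l => c (inr l)).
rewrite -{1}(aa _ hh) Hc big_sumType /= linearD /=.
have -> : xweight a' (\sum_(l < delta) c (inr l) *: T l) = \sum_(l < delta) c (inr l) *: xweight a' (T l).
  by rewrite linear_sum; apply: eq_bigr => l _; rewrite linearZ.
rewrite addrK linear_sum; apply: ideal_sum => [|[i b] _ /=]; first exact: genby_ideal.
have [J0 _ JM] := genby_ideal (fun i => (degF t g)^`M(i)).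
case: eqP => [db|_]; last by rewrite scaler0 linear0.
set r := ((m - xo i) + minn (xdeg b) (e - m + xo i))%N.
have -> : wtl t g i b = t ^- r *: xweight a ('X_[b] * (degF t g)^`M(i)).
  by rewrite xweight_wtl // scalerA mulVf ?scale1r // expf_neq0.
rewrite scalerA linearZ /= aa.
  rewrite -mul_mpolyC; apply: (JM); apply: JM.
  exact: (genby_gen (fun i => (degF t g)^`M(i))).
rewrite -[X in X.-homog](_ : (k - n.-1) + n.-1 = k)%N; last by lia.
apply: dhomogM; first by rewrite dhomogX /= db.
apply: mderiv_homog; apply: rpred_sum => j _; apply: rpredZ; exact: phi_homog.
Qed.

End Family.

Section Degenerate.
Variable K : numClosedFieldType.
Local Notation A := {mpoly K[4]}.
Local Notation X0 := ('X_ord0 : A).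
Variables (n m k e delta : nat) (Sh g : A) (T0 : 'I_delta -> A).
Hypothesis mn : (m <= n)%N.
Hypothesis m0 : (0 < m)%N.
Hypothesis hS : Sh \is n.-homog.
Hypothesis nk : (n <= k)%N.
Hypothesis me : (m <= e)%N.
Hypothesis hg : g \is m.-homog.

Local Notation phg := (phi n m Sh g).
Local Notation wt0 := (wtl e n m Sh 0 g).
Local Notation T := (fun l => X0 ^+ (k - e) * T0 l).
Definition spanned (h : A) := exists c, h = \sum_s c s *: wfam (k := k) e n m Sh 0 g T s.

Lemma spanned0 : spanned 0.
Proof. by exists (fun=> 0); rewrite big1 // => s _; rewrite scale0r. Qed.

Lemma spannedD a b : spanned a -> spanned b -> spanned (a + b).
Proof.
move=> [c ->] [c' ->]; exists (fun s => c s + c' s).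
by rewrite -big_split; apply: eq_bigr => s _; rewrite scalerDl.
Qed.

Lemma spannedZ x a : spanned a -> spanned (x *: a).
Proof.
move=> [c ->]; exists (fun s => x * c s).
by rewrite scaler_sumr; apply: eq_bigr => s _; rewrite scalerA.
Qed.

Lemma spannedB a b : spanned a -> spanned b -> spanned (a - b).
Proof. by move=> ha hb; rewrite -scaleN1r; apply: spannedD => //; apply: spannedZ. Qed.

Lemma spanned_sum (I : Type) (r : seq I) (P : pred I) (F : I -> A) :
  (forall i, P i -> spanned (F i)) -> spanned (\sum_(i <- r | P i) F i).
Proof. by move=> h; apply: big_ind => //; [exact: spanned0|exact: spannedD]. Qed.

Lemma spanned_gen s : spanned (wfam (k := k) e n m Sh 0 g T s).
Proof.
exists (fun s' => (s' == s)%:R); rewrite (bigD1 s) //= eqxx scale1r big1 ?addr0 // => s' /negPf ->.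
by rewrite scale0r.
Qed.

Lemma spanned_wtl i b : mdeg b = (k - n.-1)%N -> spanned (wt0 i b).
Proof.
move=> db; have lt : (mdeg b < k.+1)%N by rewrite db ltnS leq_subr.
by have := spanned_gen (inl (i, BMultinom lt)); rewrite /wfam /= db eqxx.
Qed.

Lemma spanned_T l : spanned (X0 ^+ (k - e) * T0 l).
Proof. exact: (spanned_gen (inr l)). Qed.

Lemma spanned_monomials (h : A) : (forall b, b \in msupp h -> spanned 'X_[b]) -> spanned h.
Proof.
move=> H; rewrite [h]mpolyE big_seq; apply: spanned_sum => b hb.
by apply: spannedZ; apply: H.
Qed.

Lemma spanned_mul (a p : A) : (forall b, b \in msupp a -> spanned ('X_[b] * p)) -> spanned (a * p).
Proof.
move=> H; rewrite {1}[a]mpolyE mulr_suml big_seq; apply: spanned_sum => b hb.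
by rewrite -scalerAl; apply: spannedZ; apply: H.
Qed.

Hypothesis Slow : forall j, (j < m)%N -> pihomog xdeg j Sh = 0.
Hypothesis lead : phg m = pihomog xdeg m Sh.

Lemma phi_ge j : (m <= j)%N -> phg j = pihomog xdeg j Sh.
Proof.
rewrite leq_eqVlt => /predU1P[<-//|mj].
by rewrite /phi leqNgt mj.
Qed.

Lemma wtl0E i b : wt0 i b = \sum_(j < n.+1 | wexp e m i (xdeg b) j == 0%N) 'X_[b] * (phg j)^`M(i).
Proof.
rewrite /wtl [RHS]big_mkcond; apply: eq_bigr => j _; rewrite expr0n.
by case: ifP => _; rewrite ?scale1r ?scale0r.
Qed.

Lemma dphi0 i : i != ord0 -> (phg 0)^`M(i) = 0.
Proof. by move=> i0; apply: mderiv_xhomog0 i0; apply: phi_xhomog. Qed.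

Lemma wtl_far i b : (e - m + xo i < xdeg b)%N -> wt0 i b = 'X_[b] * Sh^`M(i).
Proof.
move=> hb; rewrite {2}(pihomog_xdeg_sum hS) mderiv_sum mulr_sumr wtl0E big_mkcond.
apply: eq_bigr => j _; have [jm|mj] := ltnP j m.
  rewrite (Slow jm) mderiv0 mulr0; case: ifP => // hw.
  have [/andP[/eqP j0 i0]|ji] := boolP ((j == 0%N :> nat) && (i != ord0)).
    by rewrite j0 dphi0 // mulr0.
  move: hw; rewrite wexp_eq0 //; last by move: ji; case: (eqVneq i ord0) => _ /=; [rewrite addn1|rewrite andbT addn0 lt0n].
  by lia.
rewrite phi_ge // wexp_eq0 //; last by lia.
by rewrite hb mj !orbT.
Qed.

Lemma spanned_far i b : mdeg b = (k - n.-1)%N -> (e - m + xo i < xdeg b)%N ->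
  spanned ('X_[b] * Sh^`M(i)).
Proof. by move=> db hb; rewrite -wtl_far //; apply: spanned_wtl. Qed.

Variable (K1 : nat).
Hypothesis K1n : (n <= K1)%N.
Hypothesis HK1 : forall i, i != ord0 -> exists a : 'I_4 -> A,
  'X_i ^+ K1 = \sum_l a l * Sh^`M(l) /\ forall l, a l \is (K1 - n.-1).-homog.
Hypothesis Hlead : forall b : 'X_{1..4}, b ord0 = 0%N -> (e < mdeg b)%N -> exists a : 'I_4 -> A,
  [/\ a ord0 = 0, forall i, a i \is (mdeg b - m.-1).-homog,
      forall i, a i \is (mdeg b - m.-1).-homog for xdeg
    & X0 ^+ (n - m) * 'X_[b] = \sum_i a i * (phg m)^`M(i)].
Hypothesis kbig : (3 * K1 + (e + K1 + 2) + n <= k)%N.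

Lemma xo_le1 i : (xo i <= 1)%N.
Proof. by rewrite /xo; case: eqP. Qed.

(** Descending induction on [xdeg b]. If it is very large, some [x_i^K1] divides the monomial and is
    a combination of derivatives of [Sh]. Otherwise there is room for [x_0^(n-m)], and [Hlead]
    expresses the monomial by derivatives of the leading form; these differ from those of [Sh] by
    parts of larger [xdeg], covered by induction. *)
Lemma spanned_high b : mdeg b = k -> (e < xdeg b)%N -> spanned 'X_[b].
Proof.
have [N] := ubnP (k - xdeg b); elim: N b => // N IH b hN db eb.
have xb := xdeg_mdeg b; rewrite db in xb.
(* Above [3 * K1] some exponent reaches [K1]; the further [e + K1 + 2] keeps the cofactor of
   [x_i^K1] in the range of [spanned_far]. *)
have [big|small] := leqP (3 * K1 + (e + K1 + 2)) (xdeg b).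
  have [i Ki] : exists i : 'I_3, (K1 <= b (lift ord0 i))%N.
    apply: contrapT => /forallNP H; have : (xdeg b <= 3 * K1)%N; last by lia.
    have h i : (b (lift ord0 i) <= K1)%N by have /negP := H i; rewrite -ltnNge => /ltnW.
    by rewrite /xdeg !big_ord_recl big_ord0; have := h ord0; have := h (lift ord0 ord0);
      have := h (lift ord0 (lift ord0 ord0)); lia.
  set i' := lift ord0 i in Ki; have i0 : i' != ord0 by rewrite eq_sym neq_lift.
  have [a [ea ha]] := HK1 i0.
  have le : (U_(i') *+ K1 <= b)%MM by rewrite lem_mulU.
  have xc : (xdeg (b - U_(i') *+ K1) + K1 = xdeg b)%N.
    have xU c : xdeg (U_(i') *+ c) = c.
      by elim: c => [|c IHc]; rewrite ?mulm0n ?xdeg0 // mulmS xdegD xdegU /xo i0 IHc.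
    by rewrite -{2}(submK le) xdegD xU.
  have mc : (mdeg (b - U_(i') *+ K1) + K1 = k)%N.
    by rewrite -[RHS]db -[in RHS](submK le) mdegD mdegMn mdeg1 mul1n.
  rewrite -(submK le) mpolyXD -expX ea mulr_sumr; apply: spanned_sum => l _.
  rewrite mulrCA; apply: spanned_mul => c /(dhomog_mf (ha l)) /= dc.
  rewrite mulrA -mpolyXD; apply: spanned_far; first by rewrite mdegD dc; lia.
  by rewrite xdegD; have := xo_le1 l; lia.
pose r := (b ord0 - (n - m))%N; pose b1 := (b - U_(ord0) *+ b ord0)%MM.
have le0 : (U_(ord0) *+ b ord0 <= b)%MM by rewrite lem_mulU.
have b10 : b1 ord0 = 0%N by rewrite mnmBE mulmnE mnm1E eqxx mul1n subnn.
have db1 : mdeg b1 = xdeg b.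
  have := congr1 mdeg (submK le0); rewrite mdegD mdegMn mdeg1 mul1n -/b1 db; lia.
have [|a [a0 ha hxa ea]] := Hlead b10; first by rewrite db1.
rewrite db1 in ha hxa.
have -> : 'X_[b] = X0 ^+ r * (X0 ^+ (n - m) * 'X_[b1]) :> A.
  rewrite mulrA -exprD subnK; last by lia.
  by rewrite expX -mpolyXD addmC submK.
rewrite ea mulr_sumr; apply: spanned_sum => i _.
have [->|i0] := eqVneq i ord0; first by rewrite a0 mul0r mulr0; exact: spanned0.
have dphi : (phg m)^`M(i) = Sh^`M(i) - \sum_(j < n.+1 | (m < j)%N) (pihomog xdeg j Sh)^`M(i).
  have -> : Sh^`M(i) = \sum_(j < n.+1) (pihomog xdeg j Sh)^`M(i).
    by rewrite {1}(pihomog_xdeg_sum hS) mderiv_sum.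
  have mn' : (m < n.+1)%N by [].
  rewrite lead (bigID (fun j : 'I_n.+1 => (m < j)%N)) /= addrC addrK.
  rewrite (bigD1 (Ordinal mn')) -?leqNgt //= big1 ?addr0 // => j /andP[jm nj].
  rewrite Slow ?mderiv0 // ltn_neqAle leqNgt jm andbT.
  by apply: contraNneq nj => ej; apply/eqP/val_inj.
rewrite dphi !mulrBr; apply: spannedB.
  rewrite mulrA; apply: spanned_mul => c hc.
  have hra : X0 ^+ r * a i \is (r + (xdeg b - m.-1)).-homog.
    by apply: dhomogM => //; apply: X0n_homog.
  have hrx : X0 ^+ r * a i \is (0 + (xdeg b - m.-1)).-homog for xdeg.
    by apply: dhomogM => //; rewrite expX dhomogX /=; elim: r {hra hc} => [|r' IHr];
      rewrite ?mulm0n ?xdeg0 // mulmS xdegD xdegU.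
  have /= dc := dhomog_mf hra hc; have /= xc := dhomog_mf hrx hc.
  by apply: spanned_far; rewrite ?dc ?xc; have := xo_le1 i; lia.
rewrite !mulr_sumr; apply: spanned_sum => j mj.
apply: spanned_monomials => c hc.
have hh : X0 ^+ r * (a i * (pihomog xdeg j Sh)^`M(i)) \is (r + ((xdeg b - m.-1) + n.-1)).-homog.
  apply: dhomogM; first exact: X0n_homog.
  by apply: dhomogM => //; apply: mderiv_homog; apply: pihomog_xdeg_homog.
have hx : X0 ^+ r * (a i * (pihomog xdeg j Sh)^`M(i)) \is
    (0 + ((xdeg b - m.-1) + (j - xo i))).-homog for xdeg.
  apply: dhomogM.
    by rewrite expX dhomogX /=; elim: r {hh hc} => [|r' IHr]; rewrite ?mulm0n ?xdeg0 // mulmS xdegD xdegU.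
  by apply: dhomogM => //; apply: mderiv_xhomog; apply: pihomogP.
have /= dc := dhomog_mf hh hc; have /= xc := dhomog_mf hx hc.
have dck : mdeg c = k by rewrite dc; lia.
apply: IH => //; rewrite ?xc; move: hN; rewrite /xo i0; have := xdeg_mdeg c; lia.
Qed.

(* Up to powers of [x_0], the partial derivatives of [x_0^(n-m) g]. *)
Definition JX (i : 'I_4) : A := if i == ord0 then (n - m)%:R *: g + X0 * g^`M(ord0) else g^`M(i).

Lemma JX_homog i : JX i \is (m - xo i).-homog.
Proof.
rewrite /JX /xo; case: eqVneq => [_|i0] /=; last by rewrite subn1; apply: mderiv_homog.
rewrite subn0; apply: rpredD; first exact: rpredZ.
have -> : X0 * g^`M(ord0) \is m.-homog = (X0 * g^`M(ord0) \is (1 + m.-1).-homog).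
  by rewrite add1n prednK.
by apply: dhomogM; [rewrite dhomogX /= mdeg1|apply: mderiv_homog].
Qed.

Lemma mderivXn (i j : 'I_4) d : (('X_j : A) ^+ d)^`M(i) = (i == j)%:R *: (d%:R *: 'X_j ^+ d.-1).
Proof.
elim: d => [|d IH]; first by rewrite expr0 -mpolyC1 mderivC scale0r scaler0.
rewrite exprS mderivM IH mderiv_XU; case: eqP => _; rewrite ?mul0r ?scale0r ?mulr0 ?addr0 // !scale1r mul1r.
case: d {IH} => [|d]; first by rewrite scale0r mulr0 addr0 scale1r.
by rewrite -scalerAr -exprS -[X in X + _]scale1r -scalerDl -[in RHS]natr1 addrC.
Qed.

Lemma JX_deriv i : X0 ^+ (1 - xo i) * (X0 ^+ (n - m) * g)^`M(i) = X0 ^+ (n - m) * JX i.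
Proof.
rewrite /JX /xo; rewrite mderivM mderivXn; case: (eqVneq i ord0) => [->|i0] /=.
  rewrite scale1r subn0 expr1 !mulrDr; congr (_ + _); last by rewrite mulrCA.
  case: (n - m)%N => [|d]; first by rewrite !scale0r mul0r !mulr0.
  by rewrite -scalerAl -scalerAr -[in RHS]scalerAr mulrA -exprS.
by rewrite subnn expr0 mul1r scale0r mul0r add0r.
Qed.

Hypothesis HX : forall h, h \is e.-homog -> exists c : 'I_delta -> K, genby JX (h - \sum_l c l *: T0 l).
Hypothesis hT0 : forall l, T0 l \is e.-homog.

Lemma sum_phi_low i : \sum_(j < n.+1 | (j <= m)%N) (phg j)^`M(i) = (X0 ^+ (n - m) * g)^`M(i).
Proof.
have hG : X0 ^+ (n - m) * g \is n.-homog.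
  by rewrite -[X in X.-homog](subnK mn); apply: dhomogM => //; apply: X0n_homog.
rewrite [in RHS](pihomog_xdeg_sum hG) mderiv_sum big_mkcond; apply: eq_bigr => j _.
rewrite /phi; case: leqP => // mj.
suff -> : pihomog xdeg j (X0 ^+ (n - m) * g) = 0 by rewrite mderiv0.
apply/mpolyP => b; rewrite mcoeff0 mcoeff_pihomog; case: eqP => //= xb.
rewrite mulrC expX mcoeff_mulX; case: ifP => // le.
apply: dhomog_nemf_coeff hg _ => /=.
have := congr1 xdeg (submK le); rewrite xdegD => h; have := xdeg_mdeg (b - U_(ord0) *+ (n - m)).
have : xdeg (U_(ord0) *+ (n - m)) = 0%N.
  by elim: (n - m)%N => [|d IHd]; rewrite ?mulm0n ?xdeg0 // mulmS xdegD xdegU.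
by lia.
Qed.

(** Below the threshold of [wexp_eq0] the limit is a multiple of a derivative of [x_0^(n-m) g]. At
    the threshold it has further parts [j > m], whose degree exceeds [e], so that [spanned_high]
    removes them. *)
Lemma spanned_JX i c : mdeg c = (e - (m - xo i))%N -> spanned (X0 ^+ (k - e) * ('X_[c] * JX i)).
Proof.
(* By [JX_deriv], the power of [x_0] that turns a derivative of [x_0^(n-m) g] into [x_0^(k-e)] times
   [JX i]. *)
move=> dc; pose r := (k - e - (n - m) + (1 - xo i))%N; pose b := (c + U_(ord0) *+ r)%MM.
have xr j : xdeg (U_(ord0) *+ j) = 0%N.
  by elim: j => [|d IHd]; rewrite ?mulm0n ?xdeg0 // mulmS xdegD xdegU.
have xb : xdeg b = xdeg c by rewrite xdegD xr addn0.
have xi := xo_le1 i.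
have db : mdeg b = (k - n.-1)%N by rewrite mdegD dc mdegMn mdeg1 mul1n /r; lia.
have xle : (xdeg c <= e - m + xo i)%N by have := xdeg_mdeg c; lia.
have E : 'X_[b] * (X0 ^+ (n - m) * g)^`M(i) = X0 ^+ (k - e) * ('X_[c] * JX i).
  rewrite mpolyXD -expX /r exprD -!mulrA JX_deriv [RHS]mulrCA; congr (_ * _).
  by rewrite mulrA -exprD subnK //; lia.
rewrite -E -sum_phi_low mulr_sumr.
have Ew : wt0 i b = \sum_(j < n.+1 | (j <= m)%N) 'X_[b] * (phg j)^`M(i) +
    \sum_(j < n.+1 | (m < j)%N && (xdeg b == e - m + xo i)%N) 'X_[b] * (phg j)^`M(i).
  rewrite wtl0E big_mkcond [X in _ = X + _]big_mkcond [X in _ = _ + X]big_mkcond -big_split.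
  apply: eq_bigr => j _ /=.
  have [/andP[/eqP j0 i0]|ji] := boolP ((j == 0%N :> nat) && (i != ord0)).
    by rewrite j0 dphi0 // mulr0 !if_same addr0.
  rewrite wexp_eq0 //; last by move: ji; case: (eqVneq i ord0) => _ /=; [rewrite addn1|rewrite andbT addn0 lt0n].
  have [jm|mj] := leqP j m.
    have -> : [|| (xdeg b < e - m + xo i) && true, xdeg b == (e - m + xo i) | (e - m + xo i < xdeg b) && (m <= j)]%N by lia.
    by rewrite addr0.
  have -> : [|| (xdeg b < e - m + xo i) && false, xdeg b == (e - m + xo i) | (e - m + xo i < xdeg b) && (m <= j)]%N = (xdeg b == (e - m + xo i)%N) by lia.
  by rewrite add0r.
have -> : \sum_(j < n.+1 | (j <= m)%N) 'X_[b] * (phg j)^`M(i) = wt0 i b -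
    \sum_(j < n.+1 | (m < j)%N && (xdeg b == e - m + xo i)%N) 'X_[b] * (phg j)^`M(i).
  by rewrite Ew addrK.
apply: spannedB; first exact: spanned_wtl.
apply: spanned_sum => j /andP[mj /eqP xbe]; apply: spanned_monomials => c' hc'.
have hh : 'X_[b] * (phg j)^`M(i) \is ((k - n.-1) + n.-1).-homog.
  by apply: dhomogM; [rewrite dhomogX /= db|apply: mderiv_homog; apply: phi_homog].
have hx : 'X_[b] * (phg j)^`M(i) \is ((e - m + xo i) + (j - xo i)).-homog for xdeg.
  by apply: dhomogM; [rewrite dhomogX /= xbe|apply: mderiv_xhomog; apply: phi_xhomog].
have /= dc' := dhomog_mf hh hc'; have /= xc' := dhomog_mf hx hc'.
by apply: spanned_high; lia.
Qed.

Lemma spanned_low b : mdeg b = k -> (xdeg b <= e)%N -> spanned 'X_[b].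
Proof.
move=> db xb; have bE := xdeg_mdeg b.
have le : (U_(ord0) *+ (k - e) <= b)%MM by rewrite lem_mulU; lia.
rewrite -(submK le) addmC mpolyXD -expX; set b1 := (b - _)%MM.
have db1 : mdeg b1 = e.
  have := congr1 mdeg (submK le); rewrite mdegD mdegMn mdeg1 mul1n -/b1 db; lia.
have hb1 : ('X_[b1] : A) \is e.-homog by rewrite dhomogX /= db1.
have [c Hc] := HX hb1.
have hb2 : ('X_[b1] - \sum_l c l *: T0 l : A) \is e.-homog.
  by apply: rpredB => //; apply: rpred_sum => l _; apply: rpredZ; apply: hT0.
have [a [ea ha]] := genby_homog JX_homog hb2 Hc.
rewrite -['X_[b1]](subrK (\sum_l c l *: T0 l)) ea mulrDr; apply: spannedD.
  rewrite mulr_sumr; apply: spanned_sum => i _.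
  have [hai _] := ha i.
  rewrite mulrCA; apply: spanned_mul => c' /(dhomog_mf hai) /= dc'.
  by rewrite mulrCA; apply: spanned_JX.
rewrite mulr_sumr; apply: spanned_sum => l _; rewrite -scalerAr; apply: spannedZ.
exact: spanned_T.
Qed.

Lemma degenerate_span h : h \is k.-homog -> spanned h.
Proof.
move=> hh; apply: spanned_monomials => b /(dhomog_mf hh) /= db.
by have [xb|xb] := leqP (xdeg b) e; [apply: spanned_low|apply: spanned_high].
Qed.

End Degenerate.

(** * Newton arcs *)

Lemma polyfn_comp (K : numFieldType) P Q (phi : ('I_P -> K) -> K) (F : 'I_P -> ('I_Q -> K) -> K) :
  polyfn phi -> (forall i, polyfn (F i)) -> polyfn (fun v => phi (fun i => F i v)).
Proof.
move=> [c Hc] /choice[b Hb]; exists (c \mPo [tuple b i | i < P]) => v.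
rewrite Hc comp_mpoly_meval; apply: meval_eq => i.
by rewrite tnth_mktuple Hb.
Qed.

Lemma mpolyfnM (K : numFieldType) P n (F G : ('I_P -> K) -> {mpoly K[n]}) :
  mpolyfn F -> mpolyfn G -> mpolyfn (fun v => F v * G v).
Proof.
move=> hF hG m; apply: polyfn_ext (fun v => mcoeffM (F v) (G v) m) _.
by apply: polyfn_sum => k; apply: polyfn_ext (polyfnM (hF k.1) (hG k.2)).
Qed.

Lemma mpolyfn_mderiv (K : numFieldType) P n (F : ('I_P -> K) -> {mpoly K[n]}) i :
  mpolyfn F -> mpolyfn (fun v => (F v)^`M(i)).
Proof.
move=> hF m; pose c : K := (m i).+1%:R.
apply: (@polyfn_ext _ _ _ (fun v => c * (F v)@_(m + U_(i)))).
  by move=> v; rewrite mcoeff_deriv mulr_natl.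
exact: (polyfnM (polyfn_const P c) (hF (m + U_(i))%MM)).
Qed.

Lemma mpolyfn_pihomog (K : numFieldType) P n (mf : measure n) k (F : ('I_P -> K) -> {mpoly K[n]}) :
  mpolyfn F -> mpolyfn (fun v => pihomog mf k (F v)).
Proof.
move=> hF m; apply: polyfn_ext (fun v => mcoeff_pihomog mf k (F v) m) _.
by case: eqP => _; [exact: hF|exact: polyfn_const].
Qed.

Lemma polyfn_meval (K : numFieldType) P n d (F : ('I_P -> K) -> {mpoly K[n]})
    (y : 'I_n -> ('I_P -> K) -> K) :
  (forall v, F v \is d.-homog) -> mpolyfn F -> (forall i, polyfn (y i)) ->
  polyfn (fun v => (F v).@[fun i => y i v]).
Proof.
move=> hd hF hy.
have E v : (F v).@[fun i => y i v] =
    \sum_(b : 'X_{1..n < d.+1}) (F v)@_b * \prod_(i < n) y i v ^+ (b : 'X_{1..n}) i.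
  have sz : (msize (F v) <= d.+1)%N.
    rewrite mmeasureE; apply/bigmax_leqP_seq => b hb _.
    by rewrite (dhomog_mf (hd v) hb).
  rewrite {1}(mpolywE sz) meval_sum; apply: eq_bigr => b _.
  by rewrite mevalZ mevalX.
apply: polyfn_ext E _; apply: polyfn_sum => b; apply: polyfnM => //.
by apply: polyfn_prod => i; apply: polyfnX.
Qed.

Lemma meval_line (K : fieldType) n (f : {mpoly K[n]}) y d : exists rho : {poly K}, forall c,
  f.@[fun i => y i + c * d i] = f.@[y] + c * \sum_j f^`M(j).@[y] * d j + c ^+ 2 * rho.[c].
Proof.
elim/mpoly_ring_ind: f => [a|i|f g [r Hr] [s Hs]|f g [r Hr] [s Hs]].
- exists 0 => c; rewrite !mevalC horner0 mulr0 addr0 big1 ?mulr0 ?addr0 // => j _.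
  by rewrite mderivC meval0 mul0r.
- exists 0 => c; rewrite !mevalXU horner0 mulr0 addr0 (bigD1 i) //= mderiv_XU eqxx.
  rewrite meval1 mul1r big1 ?addr0 // => j ji.
  by rewrite mderiv_XU (negPf ji) meval0 mul0r.
- exists (r + s) => c; rewrite !mevalD Hr Hs hornerD.
  under [in RHS]eq_bigr do rewrite mderivD mevalD mulrDl.
  by rewrite big_split /=; ring.
set df := \sum_j f^`M(j).@[y] * d j; set dg := \sum_j g^`M(j).@[y] * d j.
exists (f.@[y] *: s + g.@[y] *: r + (df%:P + 'X * r) * (dg%:P + 'X * s)) => c.
have -> : \sum_j (f * g)^`M(j).@[y] * d j = df * g.@[y] + f.@[y] * dg.
  rewrite /df /dg mulr_suml mulr_sumr -big_split /=; apply: eq_bigr => j _.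
  by rewrite mderivM mevalD !mevalM; ring.
rewrite !mevalM Hr Hs !(hornerD, hornerM, hornerZ, hornerC, hornerX) -/df -/dg.
by ring.
Qed.

Section Arcs.
Variables (K : numClosedFieldType) (n : nat).
Hypothesis Kbig : large_fibers K.

Definition arc_eval (p : 'I_n -> {poly K}) (f : {mpoly K[n]}) : {poly K} := (map_mpoly polyC f).@[p].

Lemma arc_evalD p f g : arc_eval p (f + g) = arc_eval p f + arc_eval p g.
Proof. by rewrite /arc_eval raddfD mevalD. Qed.

Lemma arc_evalM p f g : arc_eval p (f * g) = arc_eval p f * arc_eval p g.
Proof. by rewrite /arc_eval rmorphM mevalM. Qed.

Lemma arc_evalC p c : arc_eval p c%:MP = c%:P.
Proof. by rewrite /arc_eval map_mpolyC mevalC. Qed.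

Lemma arc_evalX p i : arc_eval p 'X_i = p i.
Proof. by rewrite /arc_eval map_mpolyX mevalXU. Qed.

Lemma arc_eval_exp p f k : arc_eval p (f ^+ k) = arc_eval p f ^+ k.
Proof. by rewrite /arc_eval !rmorphXn. Qed.

Lemma arc_eval0 p f : exists c, arc_eval p f = (f.@[fun i => (p i).[0]])%:P + 'X * c.
Proof.
have H (q : {poly K}) : exists c, q = (q.[0])%:P + 'X * c.
  have : root (q - (q.[0])%:P) 0 by rewrite /root hornerD hornerN hornerC subrr.
  by case/factor_theorem => c; rewrite subr0 => e; exists c; rewrite mulrC -e addrC subrK.
have [c e] := H (arc_eval p f); exists c; rewrite {1}e; congr (_%:P + _).
elim/mpoly_ring_ind: f {c e} => [a|i|f g Hf Hg|f g Hf Hg].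
- by rewrite arc_evalC hornerC mevalC.
- by rewrite arc_evalX mevalXU.
- by rewrite arc_evalD hornerD Hf Hg mevalD.
by rewrite arc_evalM hornerM Hf Hg mevalM.
Qed.

(** The product rule for [arc_step], with [Z] for ['X ^+ N] and [f0], [g0] for the constant
    terms. *)
Fact arc_ring (A : comNzRingType) (f f0 df e c g g0 dg e' c' X Z : A) :
  f = f0 + X * e -> g = g0 + X * e' ->
  (f + X * Z * (df + X * c)) * (g + X * Z * (dg + X * c')) =
  f * g + X * Z * (df * g0 + f0 * dg +
    X * (df * e' + e * dg + c * g + f * c' + Z * (df + X * c) * (dg + X * c'))).
Proof. move=> -> ->; ring. Qed.

Lemma arc_step p d N f : exists c, arc_eval (fun i => p i + 'X ^+ N.+1 * (d i)%:P) f =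
  arc_eval p f + 'X ^+ N.+1 * ((\sum_j f^`M(j).@[fun i => (p i).[0]] * d j)%:P + 'X * c).
Proof.
rewrite exprS; elim/mpoly_ring_ind: f => [a|i|f g [r Hr] [s Hs]|f g [r Hr] [s Hs]].
- exists 0; rewrite !arc_evalC mulr0 addr0 big1 ?mulr0 ?addr0 // => j _.
  by rewrite mderivC meval0 mul0r.
- exists 0; rewrite !arc_evalX mulr0 addr0 (bigD1 i) //= mderiv_XU eqxx.
  rewrite meval1 mul1r big1 ?addr0 // => j ji.
  by rewrite mderiv_XU (negPf ji) meval0 mul0r.
- exists (r + s); rewrite !arc_evalD Hr Hs.
  under [in RHS]eq_bigr do rewrite mderivD mevalD mulrDl.
  by rewrite big_split /= polyCD addrACA -mulrDr addrACA -mulrDr.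
have [e Hf] := arc_eval0 p f; have [e' Hg] := arc_eval0 p g.
eexists; rewrite !arc_evalM Hr Hs (arc_ring _ _ _ _ _ Hf Hg) -!polyCM -polyCD.
congr (_ + _ * (_%:P + 'X * _)).
rewrite mulr_suml mulr_sumr -big_split /=; apply: eq_bigr => j _.
by rewrite mderivM mevalD !mevalM; ring.
Qed.

Variables (I : finType) (E : I -> {mpoly K[n]}) (b : 'I_n -> K) (tau : 'I_n).
Hypothesis Eb : forall s, (E s).@[b] = 0.
Hypothesis surj : forall r : I -> K, exists d : 'I_n -> K,
  d tau = 0 /\ forall s, \sum_j (E s)^`M(j).@[b] * d j = r s.

Lemma arc_exists N : exists p : 'I_n -> {poly K},
  [/\ forall i, (p i).[0] = b i, p tau = (b tau)%:P + 'X
    & forall s, exists c, arc_eval p (E s) = 'X ^+ N.+1 * c].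
Proof.
elim: N => [|N [p [p0 pt pE]]].
  exists (fun i => (b i)%:P + (i == tau)%:R * 'X); split=> [i||s].
  - by rewrite hornerD hornerC hornerM hornerX mulr0 addr0.
  - by rewrite eqxx mul1r.
  have [c e] := arc_eval0 (fun i => (b i)%:P + (i == tau)%:R * 'X) (E s); exists c.
  rewrite e (meval_eq (v2 := b)) ?Eb ?add0r // => i.
  by rewrite hornerD hornerC hornerM hornerX mulr0 addr0.
have /choice[c Hc] := pE.
have [d [dt Hd]] := surj (fun s => - (c s).[0]).
exists (fun i => p i + 'X ^+ N.+1 * (d i)%:P); split=> [i||s].
- by rewrite hornerD p0 hornerM hornerXn expr0n mul0r addr0.
- by rewrite pt dt mulr0 addr0.
have [c' e] := arc_step p d N (E s).
have [c2 e2] : exists c2, c s = ((c s).[0])%:P + 'X * c2.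
  have : root (c s - ((c s).[0])%:P) 0 by rewrite /root hornerD hornerN hornerC subrr.
  by case/factor_theorem => c2; rewrite subr0 => h; exists c2; rewrite mulrC -h addrC subrK.
exists (c2 + c'); rewrite e Hc -mulrDr {1}e2.
have -> : \sum_j (E s)^`M(j).@[fun i => (p i).[0]] * d j = - (c s).[0].
  by rewrite -Hd; apply: eq_bigr => j _; congr (_ * _); apply: meval_eq.
by rewrite polyCN addrACA subrr add0r -mulrDr mulrA -exprSr.
Qed.

(* Newton's method produces arcs [s |-> p s], [p tau = s], solving the equations
   to any order; along them no power of ['X_tau * Q] can vanish to a high enough
   order to lie in the ideal. *)
Lemma smooth_point_deform (Q : {mpoly K[n]}) : b tau = 0 -> Q.@[b] != 0 ->
  exists v, [/\ forall s, (E s).@[v] = 0, v tau != 0 & Q.@[v] != 0].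
Proof.
move=> bt Qb; have [|v [Hv]] := nullstellensatz (h := 'X_tau * Q) Kbig (genby_ideal E).
  (* Along this arc the left side of [ea] has order exactly [k] and the right side order at least
     [k + 1]. *)
  move=> k [a ea]; have [p [p0 pt pE]] := arc_exists k.
  have /choice[c Hc] := pE.
  have := congr1 (arc_eval p) ea; rewrite arc_eval_exp arc_evalM arc_evalX pt bt add0r.
  have -> : arc_eval p (\sum_s a s * E s) = 'X ^+ k.+1 * \sum_s arc_eval p (a s) * c s.
    rewrite (big_morph (arc_eval p) (arc_evalD p) (id1 := 0)); last by rewrite -mpolyC0 arc_evalC.
    by rewrite mulr_sumr; apply: eq_bigr => s _; rewrite arc_evalM Hc mulrCA.
  rewrite exprMn exprSr -mulrA => /(mulfI (_ : 'X ^+ k != 0)); rewrite expf_neq0 ?polyX_eq0 //.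
  move=> /(_ isT) /(congr1 (horner^~ 0)); rewrite hornerM hornerX mul0r horner_exp.
  have [q ->] := arc_eval0 p Q; rewrite hornerD hornerC hornerM hornerX mul0r addr0.
  rewrite (meval_eq (v2 := b)) // => /eqP; rewrite expf_eq0 (negPf Qb) andbF //.
rewrite mevalM mevalXU mulf_eq0 negb_or => /andP[vt Qv]; exists v; split=> // s.
by apply: Hv; apply: genby_gen.
Qed.

End Arcs.

(** * The limit of the Jacobian ideals *)

Fact scale_combination (K : fieldType) (V : lmodType K) (a b c d : K) (x y : V) :
  a * b = c * d -> a + c = 1 -> y = a *: (b *: x + y) + (- c) *: (d *: x - y).
Proof.
move=> ab ac; rewrite !scalerDr !scalerN !scaleNr opprK !scalerA ab addrACA subrr add0r.
by rewrite -scalerDl ac scale1r.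
Qed.

Section InitialForm.
Variable K : numClosedFieldType.
Hypothesis Kbig : large_fibers K.
Local Notation A := {mpoly K[4]}.
Local Notation X0 := ('X_ord0 : A).

Lemma hvec_eval_inj (p q : A) : (forall c w, p.@[hvec c w] = q.@[hvec c w]) -> p = q.
Proof.
move=> H; apply: mpoly_eval_inj => // v.
by rewrite !(meval_eq _ (hvecE v)).
Qed.

Lemma top_eval d (p : A) c w : p \is d.-homog -> (pihomog xdeg d p).@[hvec c w] = p.@[hvec 0 w].
Proof.
move=> hp; rewrite (pihomog_xdeg_eval _ _ _ hp) subnn expr0 mul1r.
rewrite (homog_expand 0 _ hp) big_ord_recr /= subnn expr0 mul1r big1 ?add0r // => j _.
by rewrite expr0n subn_eq0 leqNgt ltn_ord mul0r.
Qed.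

Lemma pihomog_top_mul d r (p : A) : p \is d.-homog -> pihomog xdeg d (X0 ^+ r * p) = X0 ^+ r * pihomog xdeg d p.
Proof.
move=> hp; apply: hvec_eval_inj => c w.
have hG : X0 ^+ r * p \is (r + d).-homog by apply: dhomogM => //; apply: X0n_homog.
have E (h : A) : h \is d.-homog -> (pihomog mdeg d (dehom (X0 ^+ r * h))).@[w] = h.@[hvec 0 w].
  move=> hh; rewrite /dehom rmorphM rmorphXn /= comp_mpolyXU -tnth_nth tnth_mktuple unlift_none.
  by rewrite expr1n mul1r -/(dehom h) -(top_eval 1 w hh) (pihomog_xdeg_eval _ _ _ hh) subnn mul1r.
rewrite (pihomog_xdeg_eval _ _ _ hG) addnK E //.
by rewrite mevalM rmorphXn /= mevalXU hvec0 top_eval.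
Qed.

Lemma mderiv_top d (p : A) i : p \is d.-homog -> i != ord0 ->
  (pihomog xdeg d p)^`M(i) = pihomog xdeg d.-1 p^`M(i).
Proof.
move=> hp i0; apply/mpolyP => m; rewrite mcoeff_deriv !mcoeff_pihomog mcoeff_deriv /= xdegD xdegU /xo i0.
case: d hp => [|d] hp /=; last by rewrite addn1 eqSS; case: eqP => // _; rewrite mul0rn.
rewrite addn1 /= mul0rn; case: eqP => // _; rewrite (dhomog_nemf_coeff hp) ?mul0rn //=.
by rewrite mdegD mdeg1 addn1.
Qed.

Lemma mderiv_top0 d (p : A) : p \is d.-homog -> (pihomog xdeg d p)^`M(ord0) = 0.
Proof.
move=> hp; apply/mpolyP => m; rewrite mcoeff_deriv !mcoeff_pihomog /= xdegD xdegU /xo eqxx addn0 mcoeff0.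
case: eqP => [xm|_]; last by rewrite mul0rn.
rewrite (dhomog_nemf_coeff hp) ?mul0rn //= mdegD mdeg1; have := xdeg_mdeg m; lia.
Qed.

Variables (n m : nat) (Sh : A).
Hypothesis mn : (m <= n)%N.
Local Notation phg g := (phi n m Sh g).

Lemma phi_top g : g \is m.-homog -> phg g m = X0 ^+ (n - m) * pihomog xdeg m g.
Proof. by move=> hg; rewrite /phi leqnn pihomog_top_mul. Qed.

Lemma phi_top_eval g c w : g \is m.-homog -> (phg g m).@[hvec c w] = c ^+ (n - m) * g.@[hvec 0 w].
Proof. by move=> hg; rewrite phi_top // mevalM rmorphXn /= mevalXU hvec0 top_eval. Qed.

Lemma phi_top_deriv g i : g \is m.-homog -> i != ord0 ->
  (phg g m)^`M(i) = X0 ^+ (n - m) * pihomog xdeg m.-1 g^`M(i).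
Proof.
move=> hg i0; rewrite phi_top // mderivM mderivXn (negPf i0) scale0r mul0r add0r.
by rewrite mderiv_top.
Qed.

Lemma phi_top_deriv_eval g i c w : g \is m.-homog -> i != ord0 ->
  (phg g m)^`M(i).@[hvec c w] = c ^+ (n - m) * g^`M(i).@[hvec 0 w].
Proof.
move=> hg i0; rewrite phi_top_deriv // mevalM rmorphXn /= mevalXU hvec0 top_eval //.
exact: mderiv_homog.
Qed.

Lemma phi_top_deriv0_eval g c w : g \is m.-homog ->
  (phg g m)^`M(ord0).@[hvec c w] = (n - m)%:R * c ^+ (n - m).-1 * g.@[hvec 0 w].
Proof.
move=> hg; rewrite phi_top // mderivM mderiv_top0 // mulr0 addr0 mderivXn eqxx scale1r.
by rewrite -scalerAl mevalZ mevalM rmorphXn /= mevalXU hvec0 top_eval // mulrA.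
Qed.

Section Converse.
Variables (e k delta : nat) (g : A) (T1 : 'I_delta -> A).
Hypothesis m0 : (0 < m)%N.
Hypothesis me : (m <= e)%N.
Hypothesis nk : (n <= k)%N.
Hypothesis ek : (e <= k)%N.
Hypothesis hS : Sh \is n.-homog.
Hypothesis hg : g \is m.-homog.
Hypothesis hT1 : forall l, T1 l \is (e.-1).-homog.
Hypothesis span : forall h, h \is k.-homog ->
  exists c, h = \sum_s c s *: wfam (k := k) e n m Sh 0 g (fun l => X0 ^+ (k - e) * (X0 * T1 l)) s.

(* A singular point [0 : w] of g = 0 would give a functional
   [h |-> (pihomog xdeg e h) (1, w)] killing the whole family. *)
Lemma span_off_plane w : (forall i, g^`M(i).@[hvec 0 w] = 0) -> forall i, w i = 0.
Proof.
move=> Hw i; apply/eqP/negPn/negP => wi.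
have gw : g.@[hvec 0 w] = 0.
  by have [_ h] := singular_at_homog (hvec 0 w) hg m0; have [] := h Hw.
pose L (h : A) := (pihomog xdeg e h).@[hvec 1 w].
have LD a b : L (a + b) = L a + L b by rewrite /L raddfD mevalD.
have LZ c a : L (c *: a) = c * L a by rewrite /L linearZ mevalZ.
have L0 : L 0 = 0 by rewrite /L raddf0 meval0.
have LX j h : h \is j.-homog for xdeg -> L h = (j == e)%:R * h.@[hvec 1 w].
  move=> hh; rewrite /L; case: eqVneq => [<-|je]; first by rewrite pihomog_dE // mul1r.
  by rewrite (pihomog_ne0 _ hh) // meval0 mul0r.
(* The factor [x_0] in front of [T1] keeps the degree in the last three variables below [e]. *)
have LT l : L (X0 ^+ (k - e) * (X0 * T1 l)) = 0.
  rewrite mulrA -exprSr /L (_ : pihomog _ _ _ = 0) ?meval0 //.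
  apply/mpolyP => b; rewrite mcoeff0 mcoeff_pihomog; case: eqP => // xb.
  rewrite mulrC expX mcoeff_mulX; case: ifP => // le.
  apply: dhomog_nemf_coeff (hT1 l) _ => /=.
  have := congr1 xdeg (submK le); rewrite xdegD => h; have := xdeg_mdeg (b - U_(ord0) *+ (k - e).+1).
  have : xdeg (U_(ord0) *+ (k - e).+1) = 0%N.
    by elim: (k - e).+1 => [|d IHd]; rewrite ?mulm0n ?xdeg0 // mulmS xdegD xdegU.
  by move: m0 me ek (xb : xdeg b = e); lia.
have Lw j b : mdeg b = (k - n.-1)%N -> L (wtl e n m Sh 0 g j b) = 0.
  move=> db; rewrite /wtl (big_morph L LD L0) big1 // => r _.
  rewrite LZ expr0n.
  have [/andP[/eqP r0 j0]|jr] := boolP ((r == 0%N :> nat) && (j != ord0)).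
    rewrite (_ : (phg g r)^`M(j) = 0) ?mulr0 ?L0 ?mulr0 //.
    by apply: mderiv_xhomog0 j0; rewrite -[X in X.-homog for xdeg]r0; apply: phi_xhomog.
  have jr' : (0 < r + (j == ord0))%N by move: jr; case: (eqVneq j ord0) => _ /=; [rewrite addn1|rewrite andbT addn0 lt0n].
  case: eqP => [wz|_]; last by rewrite mul0r.
  have hx : 'X_[b] * (phg g r)^`M(j) \is (xdeg b + (r - xo j)).-homog for xdeg.
    apply: dhomogM; first by rewrite dhomogX.
    by apply: mderiv_xhomog; apply: phi_xhomog.
  rewrite (LX _ _ hx) mul1r; case: eqP => [E|_]; last by rewrite mul0r.
  (* In all three cases of [wexp_eq0], a surviving part of degree exactly [e] comes from the leading
     form. *)
  have rm : r = m :> nat.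
    move/eqP: wz; rewrite wexp_eq0 //; move: jr' E me m0; rewrite /xo; case: (eqVneq j ord0) => _ /=; lia.
  rewrite mul1r mevalM [X in phi _ _ _ _ X]rm.
  have [->|j0] := eqVneq j ord0.
    by rewrite phi_top_deriv0_eval // gw mulr0 mulr0.
  by rewrite phi_top_deriv_eval // Hw !mulr0.
pose h : A := X0 ^+ (k - e) * 'X_(lift ord0 i) ^+ e.
have hh : h \is k.-homog.
  rewrite -[X in X.-homog](subnK ek); apply: dhomogM; first exact: X0n_homog.
  by apply: homog_exp; rewrite dhomogX /= mdeg1.
have hhx : h \is e.-homog for xdeg.
  have xU (l : 'I_4) d : xdeg (U_(l) *+ d) = (xo l * d)%N.
    by elim: d => [|d IHd]; rewrite ?mulm0n ?xdeg0 ?muln0 // mulmS xdegD xdegU IHd mulnS.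
  rewrite -[X in X.-homog for xdeg](add0n e); apply: dhomogM.
    by rewrite expX dhomogX /= xU.
  have i0 : lift ord0 i != ord0 by rewrite eq_sym neq_lift.
  by rewrite expX dhomogX /= xU /xo i0 mul1n.
have [c Hc] := span hh.
have : L h = 0.
  rewrite Hc (big_morph L LD L0) big1 // => -[[j b]|l] _; rewrite LZ /=; last by rewrite LT mulr0.
  by case: eqP => [db|_]; rewrite ?Lw ?L0 ?mulr0.
rewrite (LX _ _ hhx) eqxx mul1r mevalM !rmorphXn /= !mevalXU hvec0 hvecS expr1n mul1r.
by move/eqP; rewrite expf_eq0 (negPf wi) andbF.
Qed.
End Converse.

Section Setup.
Variables (delta : nat) (g : A) (q : 'I_delta -> 'I_4 -> K).
Hypothesis m0 : (0 < m)%N.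
Hypothesis hS : Sh \is n.-homog.
Hypothesis hg : g \is m.-homog.
Hypothesis Slow : forall j, (j < m)%N -> pihomog xdeg j Sh = 0.
Hypothesis lead : phg g m = pihomog xdeg m Sh.
Hypothesis Ssing : forall v, (forall i, Sh^`M(i).@[v] = 0) -> forall i, i != ord0 -> v i = 0.
Hypothesis Csm : forall w, (forall i, i != ord0 -> g^`M(i).@[hvec 0 w] = 0) -> forall i, w i = 0.
Hypothesis q0 : forall l, exists i, q l i != 0.
Hypothesis qne : forall l l', l != l' -> ~ propor (q l) (q l').
Hypothesis nod : forall l, nodal_at g (q l).
Hypothesis only : forall v, (exists i, v i != 0) -> (forall i, g^`M(i).@[v] = 0) -> exists l, propor (q l) v.

(** As the plane section is smooth, [x_0] and the derivatives [d_i g] with [i] nonzero have no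
    common zero. Restriction to [x_0 = 0] drops [x_0] from the relation obtained, and taking top
    parts of the coefficients extends it off the plane. *)
Lemma lead_ideal : exists e0, forall b : 'X_{1..4}, b ord0 = 0%N -> (e0 <= mdeg b)%N ->
  exists a : 'I_4 -> A,
  [/\ a ord0 = 0, forall i, a i \is (mdeg b - m.-1).-homog,
      forall i, a i \is (mdeg b - m.-1).-homog for xdeg
    & X0 ^+ (n - m) * 'X_[b] = \sum_i a i * (phg g m)^`M(i)].
Proof.
pose J (i : 'I_4) : A := if i == ord0 then X0 else g^`M(i).
pose dJ (i : 'I_4) := if i == ord0 then 1%N else m.-1.
have hJ i : J i \is (dJ i).-homog.
  rewrite /J /dJ; case: eqP => _; first by rewrite dhomogX /= mdeg1.
  exact: mderiv_homog.
have [|e0 He0] := projective_nullstellensatz Kbig (genby_ideal J).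
  move=> v Hv; have v0 : v ord0 = 0 by have := Hv _ (genby_gen J ord0); rewrite /J eqxx mevalXU.
  have e := hvecE v; rewrite v0 in e.
  have w0 : forall i, v (lift ord0 i) = 0.
    apply: (Csm (w := fun i => v (lift ord0 i))) => i i0; have := Hv _ (genby_gen J i); rewrite /J (negPf i0) => E; rewrite -[RHS]E.
    by apply: meval_eq => j; rewrite [RHS]e.
  by move=> i; rewrite e /hvec; case: unlift.
exists (e0 + m)%N => b b0 eb.
have hb : ('X_[b] : A) \is (mdeg b).-homog by rewrite dhomogX.
have [|a [ea ha]] := genby_homog hJ hb (He0 b _); first by lia.
pose d := (mdeg b - m.-1)%N.
exists (fun i => if i == ord0 then 0 else pihomog xdeg d (a i)); split.
- by rewrite eqxx.
- move=> i; case: (eqVneq i ord0) => [_|i0]; first exact: dhomog0.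
  by have [h _] := ha i; move: h; rewrite /dJ (negPf i0) -/d; apply: pihomog_xdeg_homog.
- by move=> i; case: (eqVneq i ord0) => _; [apply: dhomog0|apply: pihomogP].
apply: hvec_eval_inj => c w; rewrite meval_sum mevalM rmorphXn /= mevalXU hvec0.
have -> : ('X_[b] : A).@[hvec c w] = ('X_[b] : A).@[hvec 0 w].
  rewrite !mevalX; apply: eq_bigr => j _; rewrite /hvec.
  by case: unliftP => [//|->]; rewrite b0 !expr0.
rewrite {1}ea meval_sum mulr_sumr; apply: eq_bigr => i _; rewrite !mevalM.
have [->|i0] := eqVneq i ord0; first by rewrite /J eqxx meval0 mul0r mevalXU hvec0 !mulr0.
rewrite phi_top_deriv_eval // mulrCA; congr (_ * _); last by rewrite /J (negPf i0).
by rewrite top_eval //; have [h _] := ha i; move: h; rewrite /dJ (negPf i0).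
Qed.

(** The derivatives of [Sh] vanish together only on the line of [[1:0:0:0]], where the other
    coordinates are [0]. One exponent serves all coordinates, and its summand [n] prevents
    truncation. *)
Lemma frame_nilpotent : exists K0, (n <= K0)%N /\ forall i, i != ord0 -> exists a : 'I_4 -> A,
  'X_i ^+ K0 = \sum_l a l * Sh^`M(l) /\ forall l, a l \is (K0 - n.-1).-homog.
Proof.
pose J l := Sh^`M(l); have [J0 JD JM] := genby_ideal J.
have /choice[kk Hk] : forall i : 'I_4, exists k, i != ord0 -> genby J ('X_i ^+ k).
  move=> i; have [->|i0] := eqVneq i ord0; first by exists 0%N.
  apply: contrapT => /forallNP H.
  have [|v [Hv]] := nullstellensatz (h := 'X_i) Kbig (genby_ideal J).
    by move=> k Jk; apply: (H k).
  rewrite mevalXU Ssing ?eqxx // => l; apply: Hv; exact: genby_gen.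
exists (\sum_i kk i + n)%N; split; first by rewrite leq_addl.
move=> i i0; set K0 := (\sum_i kk i + n)%N.
have hX : ('X_i : A) ^+ K0 \is K0.-homog by apply: homog_exp; rewrite dhomogX /= mdeg1.
have JX : genby J ('X_i ^+ K0).
  have le : (kk i <= K0)%N by rewrite /K0 (bigD1 i) //= -addnA leq_addr.
  by rewrite -(subnK le) exprD; apply: JM; apply: Hk.
have [a [ea ha]] := genby_homog (d := fun=> n.-1) (fun l => mderiv_homog l hS) hX JX.
by exists a; split=> // l; have [] := ha l.
Qed.

Lemma node_off_plane l : q l ord0 != 0.
Proof.
apply: contraTneq isT => ql0; have [i /eqP] := q0 l; case.
have e := hvecE (q l); rewrite ql0 in e.
rewrite e /hvec; case: unliftP => // j _; move: j; apply: (Csm (w := fun i => q l (lift ord0 i))) => j _.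
by have [E _] := nod l; rewrite -[RHS](E j); apply: meval_eq => r; rewrite [RHS]e.
Qed.

(** The [JX i] cut out exactly the nodes of [g], with reduced structure, so [corank_nodes] applies;
    smoothness of the section excludes zeros on [x_0 = 0]. *)
Lemma JX_span : exists T0 : 'I_delta -> A, exists a, (forall l, T0 l \is (a).-homog) /\
  exists e0, forall e h, (e0 <= e)%N -> h \is e.-homog -> exists c : 'I_delta -> K,
    genby (JX n m g) (h - \sum_l c l *: (X0 ^+ (e - a) * T0 l)).
Proof.
have [T0 HT0] := choice (fun j => interpolation q0 qne j (k := delta) (ltac:(by rewrite card_ord))).
exists T0, delta; split; first by move=> l; have [] := HT0 l.
have nz : (n%:R : K) != 0 by rewrite pnatr_eq0; move: m0 mn; lia.
have mz : (m%:R : K) != 0 by rewrite pnatr_eq0; move: m0; lia.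
have JXE i v : (JX n m g i).@[v] = if i == ord0 then (n - m)%:R * g.@[v] + v ord0 * g^`M(ord0).@[v] else g^`M(i).@[v].
  by rewrite /JX; case: eqP => // _; rewrite mevalD mevalZ mevalM mevalXU.
have gq l : g.@[q l] = 0.
  by have [_ h] := singular_at_homog (q l) hg m0; have [ng _] := nod l; have [] := h ng.
apply: (@corank_nodes _ _ Kbig _ _ (fun i => m - xo i)%N _ q).
- by move=> i; apply: JX_homog.
- move=> v Hv; have [vne|] := pselect (exists i, v i != 0); last first.
    by move/forallNP => v0; left=> i; apply/eqP/negPn/negP/v0.
  right; have dg i : i != ord0 -> g^`M(i).@[v] = 0 by move=> i0; have := Hv i; rewrite JXE (negPf i0).
  have J0 := Hv ord0; rewrite JXE eqxx in J0.
  (* Where the other derivatives vanish, Euler's formula turns [JX ord0] into [n] times [g]. *)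
  have eu := euler_eval v hg; rewrite big_ord_recl big1 ?addr0 in eu; last first.
    by move=> i _; rewrite dg ?mul0r // eq_sym neq_lift.
  have gv : g.@[v] = 0.
    have en : (n%:R : K) = (n - m)%:R + m%:R by rewrite -natrD subnK.
    have : n%:R * g.@[v] = 0 by rewrite en mulrDl [m%:R * _]mulr_natl -eu [_ * v ord0]mulrC.
    by move/eqP; rewrite mulf_eq0 (negPf nz) => /eqP.
  have v0 : v ord0 != 0.
    apply: contraTneq isT => v0; have [i /eqP] := vne; case.
    have e := hvecE v; rewrite v0 in e; rewrite e /hvec; case: unliftP => // j _; move: j.
    by apply: (Csm (w := fun i => v (lift ord0 i))) => j j0; rewrite -[RHS](dg j j0); apply: meval_eq => r; rewrite [RHS]e.
  apply: only => // i; have [->|i0] := eqVneq i ord0; last exact: dg.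
  by move: J0; rewrite gv mulr0 add0r => /eqP; rewrite mulf_eq0 (negPf v0) => /eqP.
- move=> l i; rewrite JXE; have [ng _] := nod l.
  by case: eqP => _; rewrite ?ng // gq !mulr0 addr0.
- move=> l; have [h [hq Hh]] := nodal_colon hg (q0 l) (nod l).
  (* Multiplication by [x_0] sends every derivative of [g] into the ideal of the [JX i]; for [d_0 g]
     this is Euler's formula once more. *)
  exists (X0 * h); split; first by rewrite mevalM mevalXU mulf_neq0 // node_off_plane.
  move=> b f hf fq; have := Hh b f hf fq; rewrite -mulrA; move: (h * f) => p.
  have [J0 JD JM] := genby_ideal (JX n m g).
  apply: (genby_min (P := fun p => genby (JX n m g) (X0 * p))).
    split=> [|x y hx hy|a x hx]; first by rewrite mulr0.
    - by rewrite mulrDr; apply: JD.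
    - by rewrite mulrCA; apply: JM.
  have Ji i : i != ord0 -> genby (JX n m g) g^`M(i).
    by move=> i0; have := genby_gen (JX n m g) i; rewrite {2}/JX (negPf i0).
  move=> i; have [->|i0] := eqVneq i ord0; last by apply: JM; apply: Ji.
  have eu := euler_homog hg; rewrite big_ord_recl -scaler_nat in eu.
  set s := \sum_(i < 3) _ in eu.
  have hs : genby (JX n m g) s.
    apply: ideal_sum => [|j _]; first exact: genby_ideal.
    by apply: JM; apply: Ji; rewrite eq_sym neq_lift.
  have -> : X0 * g^`M(ord0) = (m%:R / n%:R) *: JX n m g ord0 + (- ((n - m)%:R / n%:R)) *: s.
    have -> : s = m%:R *: g - X0 * g^`M(ord0) by rewrite -eu addrC addKr.
    rewrite /JX eqxx natrB //; set y := X0 * _; move: y => y.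
    by apply: scale_combination; field.
  by apply: (JD); rewrite -mul_mpolyC; apply: (JM) => //; apply: genby_gen.
- by rewrite dhomogX /= mdeg1.
- by move=> l; rewrite mevalXU node_off_plane.
- by move=> l; have [] := HT0 l.
- by move=> l l'; have [_ ->] := HT0 l; rewrite eq_sym.
Qed.

Lemma degenerate_family : exists e k (T1 : 'I_delta -> A),
  [/\ (m <= e)%N && (e <= k)%N, (n <= k)%N && (delta < k)%N, forall l, T1 l \is (e.-1).-homog
   & forall h, h \is k.-homog ->
     exists c, h = \sum_s c s *: wfam (k := k) e n m Sh 0 g (fun l => X0 ^+ (k - e) * (X0 * T1 l)) s].
Proof.
have [T0 [a [hT0 [e0 HX]]]] := JX_span.
have [e1 Hl] := lead_ideal.
have [K0 [nK0 HK0]] := frame_nilpotent.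
(* The successor gives [e > a], so that a factor [x_0] can be taken out of [x_0^(e-a) T0], as
   [span_off_plane] requires; [delta] in [k] serves the corank criterion. *)
pose e := (e0 + e1 + m + a).+1; pose k := (3 * K0 + (e + K0 + 2) + n + delta).+1.
pose T1 l := X0 ^+ (e.-1 - a) * T0 l.
have ET l : X0 * T1 l = X0 ^+ (e - a) * T0 l by rewrite /T1 mulrA -exprS; congr (_ ^+ _ * _); rewrite /e; lia.
have hT1 l : T1 l \is (e.-1).-homog.
  rewrite -[X in X.-homog](_ : (e.-1 - a) + a = e.-1)%N; last by rewrite /e; lia.
  by apply: dhomogM => //; apply: X0n_homog.
exists e, k, T1; split=> //.
- by rewrite /k /e; apply/andP; split; lia.
- by rewrite /k; apply/andP; split; lia.
have nk : (n <= k)%N by rewrite /k; lia.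
have me : (m <= e)%N by rewrite /e; lia.
have kb : (3 * K0 + (e + K0 + 2) + n <= k)%N by rewrite /k; lia.
have hT l : X0 * T1 l \is e.-homog.
  rewrite -[X in X.-homog](_ : 1 + e.-1 = e)%N; last by rewrite /e; lia.
  by apply: dhomogM => //; rewrite dhomogX /= mdeg1.
move=> h hh; apply: (degenerate_span mn m0 hS nk me hg Slow lead nK0 HK0 _ kb _ hT hh).
  by move=> b b0 eb; apply: Hl => //; move: eb; rewrite /e; lia.
move=> f hf; have [|c Hc] := HX e f _ hf; first by rewrite /e; lia.
by exists c; under eq_bigr do rewrite ET.
Qed.
End Setup.
End InitialForm.

(** * Smoothing the degenerate surface *)

Section NodalImage.
Variables (K : fieldType) (n : nat).
Local Notation A := {mpoly K[n]}.

(** The Hessian is symmetric with kernel spanned by [y], so by a rank count its image is the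
    orthogonal complement of [y]. *)
Lemma nodal_image (f : A) d y s : f \is d.-homog -> (exists i, y i != 0) -> nodal_at f y ->
  \sum_i s i * y i = 0 -> exists eta, forall i, \sum_l f^`M(i)^`M(l).@[y] * eta l = s i.
Proof.
move=> hf [i0 yi0] [fy fh] sy.
pose H : 'M[K]_n := \matrix_(i, j) f^`M(i)^`M(j).@[y].
pose Y : 'cV[K]_n := \col_i y i.
have rY : \rank Y = 1%N.
  rewrite -mxrank_tr rank_rV; have -> // : Y^T != 0.
  by apply/rV0Pn; exists i0; rewrite !mxE.
have HY : (H <= kermx Y)%MS.
  apply/sub_kermxP/colP => i; rewrite !mxE.
  have := euler_eval y (mderiv_homog i hf); rewrite fy mul0rn => E; rewrite -[RHS]E.
  by apply: eq_bigr => j _; rewrite !mxE.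
have rH : (\rank (kermx Y) <= \rank H)%N.
  rewrite mxrank_ker rY; suff : (\rank (kermx H) <= 1)%N by rewrite mxrank_ker; have := rank_leq_row H; lia.
  have : (kermx H <= Y^T)%MS.
    apply/row_subP => r; have /sub_kermxP := row_sub r (kermx H).
    move: (row r _) => v vH; have [|c Hc] := fh (fun l => v 0 l).
      move=> i; have /rowP/(_ i) := vH; rewrite !mxE => e; rewrite -[RHS]e.
      by apply: eq_bigr => l _; rewrite !mxE mulrC mderiv_comm.
    rewrite (_ : v = c *: Y^T) ?scalemx_sub //.
    by apply/rowP => l; rewrite !mxE -Hc.
  by move/mxrankS; rewrite mxrank_tr rY.
have eHY : (H == kermx Y)%MS by rewrite -(mxrank_leqif_eq HY) eqn_leq rH mxrankS.
have : (\row_i s i <= H)%MS.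
  rewrite (eqmxP eHY); apply/sub_kermxP/rowP => j; rewrite !mxE -[RHS]sy.
  by apply: eq_bigr => i _; rewrite !mxE.
case/submxP => D e; exists (fun l => D 0 l) => i; have /rowP/(_ i) := e.
by rewrite !mxE => ->; apply: eq_bigr => l _; rewrite !mxE mulrC mderiv_comm.
Qed.

Lemma nodal_mul (c f : A) y : c.@[y] != 0 -> f.@[y] = 0 -> nodal_at f y -> nodal_at (c * f) y.
Proof.
move=> cy f0 [fy fh]; split=> [i|v Hv].
  by rewrite mderivM mevalD !mevalM f0 fy !mulr0 addr0.
apply: fh => i; apply: (mulfI cy); rewrite mulr0 -[RHS](Hv i) mulr_sumr.
apply: eq_bigr => l _; rewrite mderivM mderivD !mderivM !mevalD !mevalM f0 !fy.
by ring.
Qed.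

End NodalImage.

Lemma line_coef (K : numFieldType) (a b c : K) (r s : {poly K}) :
  (forall t, a + t * b + t ^+ 2 * r.[t] = t * c + t ^+ 2 * s.[t]) -> b = c.
Proof.
move=> H; pose p := a%:P + b *: 'X + 'X^2 * r - (c *: 'X + 'X^2 * s).
have p0 : p = 0.
  apply/eqP/negPn/negP => /exists_nonroot[t]; rewrite /p !hornerE => /eqP; apply.
  by rewrite [b * t]mulrC [c * t]mulrC H subrr.
have := congr1 (fun q : {poly K} => q`_1) p0.
rewrite /p !(coefN, coefD, coefZ, coefX, coefC, coefXnM) /= ?coef0 => h.
by apply/eqP; rewrite -subr_eq0 -[X in _ == X]h; apply/eqP; ring.
Qed.

Section Core.
Variable K : numClosedFieldType.
Hypothesis Kbig : large_fibers K.
Local Notation A := {mpoly K[4]}.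
Local Notation X0 := ('X_ord0 : A).
Variables (n m : nat) (Sh : A).
Hypothesis mn : (m <= n)%N.
Hypothesis m0 : (0 < m)%N.
Hypothesis hS : Sh \is n.-homog.
Variables (P : nat) (C : 'I_P -> A).
Hypothesis hC : forall p, C p \is m.-homog.

Definition lin_fam (v : 'I_P -> K) : A := \sum_p v p *: C p.
Local Notation phg g := (phi n m Sh g).

Lemma lin_fam_homog v : lin_fam v \is m.-homog.
Proof. by apply: rpred_sum => p _; apply: rpredZ; apply: hC. Qed.

Lemma lin_fam_line v w c : lin_fam (fun p => v p + c * w p) = lin_fam v + c *: lin_fam w.
Proof.
rewrite /lin_fam scaler_sumr -big_split; apply: eq_bigr => p _ /=.
by rewrite scalerDl scalerA.
Qed.

Lemma mpolyfn_lin_fam N (u : 'I_P -> ('I_N -> K) -> K) : (forall p, polyfn (u p)) ->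
  mpolyfn (fun v => lin_fam (fun p => u p v)).
Proof. by move=> hu; apply: mpolyfn_sum => p; apply: mpolyfnZ => //; apply: mpolyfn_const. Qed.

Lemma mpolyfn_phi N (u : 'I_P -> ('I_N -> K) -> K) j : (forall p, polyfn (u p)) ->
  mpolyfn (fun v => phg (lin_fam (fun p => u p v)) j).
Proof.
move=> hu; case jm : (j <= m)%N; last first.
  by apply: mpolyfn_ext (mpolyfn_const _ (pihomog xdeg j Sh)) => v; rewrite /phi jm.
apply: (mpolyfn_ext (G := fun v => pihomog xdeg j (X0 ^+ (n - m) * lin_fam (fun p => u p v)))).
  by move=> v; rewrite /phi jm.
by apply: mpolyfn_pihomog; apply: mpolyfnM (mpolyfn_const _ _) (mpolyfn_lin_fam hu).
Qed.

Lemma mpolyfn_degF N t (u : 'I_P -> ('I_N -> K) -> K) : polyfn t -> (forall p, polyfn (u p)) ->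
  mpolyfn (fun v => degF n m Sh (t v) (lin_fam (fun p => u p v))).
Proof.
move=> ht hu; apply: mpolyfn_sum => j; apply: mpolyfnZ; first exact: polyfnX.
exact: mpolyfn_phi.
Qed.

Lemma mpolyfn_degG N t (u : 'I_P -> ('I_N -> K) -> K) : polyfn t -> (forall p, polyfn (u p)) ->
  mpolyfn (fun v => degG n m Sh (t v) (lin_fam (fun p => u p v))).
Proof.
move=> ht hu; apply: mpolyfn_sum => j; apply: mpolyfnZ; first exact: polyfnX.
exact: mpolyfn_phi.
Qed.

Lemma degF_homog t v : degF n m Sh t (lin_fam v) \is n.-homog.
Proof. by apply: rpred_sum => j _; apply: rpredZ; apply: phi_homog => //; apply: lin_fam_homog. Qed.

Lemma degG_homog t v : degG n m Sh t (lin_fam v) \is n.-homog.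
Proof. by apply: rpred_sum => j _; apply: rpredZ; apply: phi_homog => //; apply: lin_fam_homog. Qed.

Lemma degF0 g : phg g m = pihomog xdeg m Sh -> (forall j, (j < m)%N -> pihomog xdeg j Sh = 0) ->
  degF n m Sh 0 g = Sh.
Proof.
move=> lead Slow; rewrite [RHS](pihomog_xdeg_sum hS); apply: eq_bigr => j _.
rewrite expr0n; have [jm|mj|jm] := ltngtP j m.
- by rewrite subn_eq0 leqNgt jm scale0r Slow.
- by rewrite subn_eq0 ltnW // scale1r /phi leqNgt mj.
by rewrite jm subnn scale1r lead.
Qed.

Lemma degG0 g : g \is m.-homog -> degG n m Sh 0 g = X0 ^+ (n - m) * g.
Proof.
move=> hg; have hG : X0 ^+ (n - m) * g \is n.-homog.
  by rewrite -[X in X.-homog](subnK mn); apply: dhomogM => //; apply: X0n_homog.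
have high j : (m < j)%N -> pihomog xdeg j (X0 ^+ (n - m) * g) = 0.
  move=> mj; apply/mpolyP => b; rewrite mcoeff0 mcoeff_pihomog; case: eqP => //= xb.
  rewrite mulrC expX mcoeff_mulX; case: ifP => // le.
  apply: dhomog_nemf_coeff hg _ => /=.
  have := congr1 xdeg (submK le); rewrite xdegD => h; have := xdeg_mdeg (b - U_(ord0) *+ (n - m)).
  have : xdeg (U_(ord0) *+ (n - m)) = 0%N.
    by elim: (n - m)%N => [|d IHd]; rewrite ?mulm0n ?xdeg0 // mulmS xdegD xdegU.
  by lia.
rewrite [RHS](pihomog_xdeg_sum hG); apply: eq_bigr => j _.
rewrite expr0n subn_eq0; case: leqP => jm; first by rewrite scale1r /phi jm.
by rewrite scale0r high.
Qed.

Lemma xhomog_scale d j (p : A) t c w : p \is d.-homog -> p \is j.-homog for xdeg ->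
  p.@[hvec c (fun i => t * w i)] = t ^+ j * p.@[hvec c w].
Proof.
move=> hp hx; rewrite -(pihomog_dE hx) !(pihomog_xdeg_eval _ _ _ hp).
by rewrite (meval_scale _ _ (pihomogP _ _ _)) mulrCA.
Qed.

Definition dilation (t : K) : 'M[K]_4 := diag_mx (\row_i if i == ord0 then 1 else t).

Lemma vmul_dilation t c w : vmul (hvec c w) (dilation t) =1 hvec c (fun i => t * w i).
Proof.
move=> j; rewrite /vmul (bigD1 j) //= big1 ?addr0 => [|i ij].
  rewrite !mxE eqxx mulr1n; case: (unliftP ord0 j) => [k ->|->]; last by rewrite eqxx !hvec0 mulr1.
  rewrite !hvecS; have -> : (lift ord0 k == ord0) = false by rewrite eq_sym (negPf (neq_lift _ _)).
  by rewrite mulrC.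
by rewrite !mxE (negPf ij) mulr0n mulr0.
Qed.

Lemma dilation_unit t : t != 0 -> dilation t \in unitmx.
Proof.
move=> t0; rewrite unitmxE det_diag unitfE; apply/prodf_neq0 => i _; rewrite mxE.
by case: (i == ord0); rewrite ?oner_neq0.
Qed.

Lemma degF_dilation t v : lsubst (dilation t) (degF n m Sh t (lin_fam v)) = t ^+ m *: degG n m Sh t (lin_fam v).
Proof.
apply: hvec_eval_inj => // c w; rewrite meval_lsubst (meval_eq _ (vmul_dilation t c w)) mevalZ.
rewrite /degF /degG !meval_sum mulr_sumr; apply: eq_bigr => j _; rewrite !mevalZ.
rewrite (xhomog_scale _ _ _ (phi_homog mn hS _ (lin_fam_homog v)) (phi_xhomog _ _ _ _ _)).
by rewrite !mulrA -!exprD; congr (_ ^+ _ * _); lia.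
Qed.

Variables (e k delta : nat) (T1 : 'I_delta -> A).
Hypothesis me : (m <= e)%N.
Hypothesis ek : (e <= k)%N.
Hypothesis nk : (n <= k)%N.
Hypothesis dk : (delta < k)%N.
Hypothesis hT1 : forall l, T1 l \is (e.-1).-homog.
Local Notation Tk := (fun l => X0 ^+ (k - e) * (X0 * T1 l)).
Definition family_spans t g := forall h : A, h \is k.-homog ->
  exists c, h = \sum_s c s *: wfam (k := k) e n m Sh t g Tk s.

(** The rescaled family is polynomial in [t], so [t = 0] is an ordinary parameter value and spanning
    there spreads to an open set of pairs [(t, v)]. *)
Lemma family_spans_open v0 : family_spans 0 (lin_fam v0) ->
  exists D : {mpoly K[P.+1]}, D.@[hvec 0 v0] != 0 /\
    forall t v, D.@[hvec t v] != 0 -> family_spans t (lin_fam v).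
Proof.
move=> span0.
pose W s (v : 'I_P.+1 -> K) := wfam (k := k) e n m Sh (v ord0) (lin_fam (fun p => v (lift ord0 p))) Tk s.
have WE t v s : W s (hvec t v) = wfam (k := k) e n m Sh t (lin_fam v) Tk s.
  rewrite /W hvec0 (_ : lin_fam (fun p => hvec t v (lift ord0 p)) = lin_fam v) //.
  by apply: eq_bigr => p _; rewrite hvecS.
have [||h hh|D [D0 HD]] := @polyfn_span K P.+1 4 k _ W (hvec 0 v0).
- move=> [[i b]|l] v; rewrite /W /=; last first.
    rewrite -[X in X.-homog](subnK ek); apply: dhomogM; first exact: X0n_homog.
    rewrite -[X in X.-homog](_ : 1 + e.-1 = e)%N; last by rewrite add1n prednK // (leq_trans m0).
    by apply: dhomogM => //; rewrite dhomogX /= mdeg1.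
  case: eqP => [db|_]; last exact: dhomog0.
  set g := lin_fam _; have hg : g \is m.-homog by apply: lin_fam_homog.
  have ht j : 'X_[b] * (phg g j)^`M(i) \is k.-homog.
    rewrite -[X in X.-homog](_ : (k - n.-1) + n.-1 = k)%N; last by lia.
    apply: dhomogM; first by rewrite dhomogX /= db.
    by apply: mderiv_homog; apply: phi_homog.
  by apply: rpred_sum => j _; apply: rpredZ; apply: ht.
- move=> [[i b]|l]; rewrite /W /=; last exact: mpolyfn_const.
  case: eqP => [db|_]; last exact: mpolyfn_const.
  apply: mpolyfn_sum => j; apply: mpolyfnZ; first by apply: polyfnX; apply: polyfn_var.
  apply: mpolyfnM; first exact: mpolyfn_const.
  by apply: mpolyfn_mderiv; apply: mpolyfn_phi => p; apply: polyfn_var.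
- by have [c ->] := span0 h hh; exists c; apply: eq_bigr => s _; rewrite WE.
exists D; split; first exact: D0.
move=> t v /HD H h hh; have [c Hc] := H h hh.
by exists c; rewrite Hc; apply: eq_bigr => s _; rewrite WE.
Qed.

End Core.

Section Smoothing.
Variable K : numClosedFieldType.
Hypothesis Kbig : large_fibers K.
Local Notation A := {mpoly K[4]}.
Local Notation X0 := ('X_ord0 : A).
Variables (n m : nat) (Sh : A).
Hypothesis mn : (m <= n)%N.
Hypothesis m0 : (0 < m)%N.
Hypothesis hS : Sh \is n.-homog.
Variables (P : nat) (C : 'I_P -> A).
Hypothesis hC : forall p, C p \is m.-homog.
Hypothesis Csurj : forall h : A, h \is m.-homog -> exists v, h = lin_fam C v.
Variables (delta : nat) (v1 : 'I_P -> K) (y : 'I_delta -> 'I_4 -> K) (eh : 'I_delta -> A).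
Hypothesis nod : forall l, nodal_at (lin_fam C v1) (y l).
Hypothesis y0 : forall l, y l ord0 != 0.
Hypothesis heh : forall l, eh l \is m.-homog.
Hypothesis ehd : forall l l', (eh l).@[y l'] = (l == l')%:R.

(** The unknowns in one affine space: [t], the coefficients of [g], and four coordinates for each of
    the [delta] points. *)
Local Notation idx := ('I_P.+1 + 'I_delta * 'I_4)%type.
Local Notation N := #|{: idx}|.
Let par (u : 'I_N -> K) (i : 'I_P.+1) : K := u (enum_rank (inl i : idx)).
Let pt (u : 'I_N -> K) (l : 'I_delta) (j : 'I_4) : K := u (enum_rank (inr (l, j) : idx)).
Let mk (a : 'I_P.+1 -> K) (z : 'I_delta -> 'I_4 -> K) (s : 'I_N) : K :=
  match enum_val s with inl i => a i | inr lj => z lj.1 lj.2 end.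
Let fam u := lin_fam C (fun p => par u (lift ord0 p)).
Let eqs (s : 'I_delta * 'I_4) u := (degG n m Sh (par u ord0) (fam u))^`M(s.2).@[pt u s.1].

Lemma par_mk a z i : par (mk a z) i = a i.
Proof. by rewrite /par /mk enum_rankK. Qed.

Lemma pt_mk a z l j : pt (mk a z) l j = z l j.
Proof. by rewrite /pt /mk enum_rankK. Qed.

Lemma polyfn_par i : polyfn (par^~ i). Proof. exact: polyfn_var. Qed.
Lemma polyfn_pt l j : polyfn (fun u => pt u l j). Proof. exact: polyfn_var. Qed.

Lemma polyfn_eqs s : polyfn (eqs s).
Proof.
apply: (@polyfn_meval _ _ _ n.-1 (fun u => (degG n m Sh (par u ord0) (fam u))^`M(s.2)) (fun j u => pt u s.1 j)).
- by move=> u; apply: mderiv_homog; apply: degG_homog.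
- apply: mpolyfn_mderiv; apply: (@mpolyfn_degG _ _ _ _ _ _ _ (fun u => par u ord0)).
    exact: polyfn_par.
  by move=> p; apply: polyfn_par.
by move=> i; apply: polyfn_pt.
Qed.

Let base := mk (hvec 0 v1) y.

Lemma fam_base c w : fam (fun s => base s + c * w s) = lin_fam C v1 + c *: fam w.
Proof.
rewrite /fam -lin_fam_line; apply: eq_bigr => p _; congr (_ *: _).
by rewrite {1}/par -/(par base _) -/(par w _) /base par_mk hvecS.
Qed.

(** In a direction [(0, w, eta)] the equations change by the gradient of [G] at the nodes plus the
    Hessian of [F] applied to [eta]. The latter reaches any vector orthogonal to the node, and by
    Euler's formula the remaining condition only prescribes the value of [G] there, which the dual
    forms [eh] provide. *)
Lemma eqs_surjective (r : 'I_delta * 'I_4 -> K) : exists d : 'I_N -> K,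
  par d ord0 = 0 /\ forall s, exists rho : {poly K}, forall c,
    eqs s (fun i => base i + c * d i) = c * r s + c ^+ 2 * rho.[c].
Proof.
have nz : (n%:R : K) != 0 by rewrite pnatr_eq0; move: m0 mn; lia.
pose F := X0 ^+ (n - m) * lin_fam C v1.
have hF : F \is n.-homog.
  by rewrite -[X in X.-homog](subnK mn); apply: dhomogM; [apply: X0n_homog|apply: lin_fam_homog].
have yne l : exists i, y l i != 0 by exists ord0.
have gy l : (lin_fam C v1).@[y l] = 0.
  have [_ h] := singular_at_homog (y l) (lin_fam_homog hC v1) m0.
  by have [ng _] := nod l; have [] := h ng.
have cy l : (X0 ^+ (n - m)).@[y l] != 0 by rewrite rmorphXn /= mevalXU expf_neq0.
have nF l : nodal_at F (y l) by apply: nodal_mul.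
(* Euler's formula prescribes [n] times the value of [G] at [y l]; this divides out [n] and the
   factor [x_0^(n-m)]. *)
pose al l := (\sum_i r (l, i) * y l i) / (n%:R * y l ord0 ^+ (n - m)).
have hal : \sum_l al l *: eh l \is m.-homog by apply: rpred_sum => l _; apply: rpredZ; apply: heh.
have [w Hw] := Csurj hal.
pose G := X0 ^+ (n - m) * lin_fam C w.
have hG : G \is n.-homog.
  by rewrite -[X in X.-homog](subnK mn); apply: dhomogM; [apply: X0n_homog|apply: lin_fam_homog].
have Gy l : n%:R * G.@[y l] = \sum_i r (l, i) * y l i.
  rewrite mevalM rmorphXn /= mevalXU -Hw meval_sum (bigD1 l) //= mevalZ ehd eqxx mulr1 big1 ?addr0.
    by rewrite mulrA mulrC divfK // mulf_neq0 // expf_neq0.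
  by move=> l' /negPf ll'; rewrite mevalZ ehd ll' mulr0.
have /choice[eta Heta] : forall l, exists eta, forall i,
    \sum_j F^`M(i)^`M(j).@[y l] * eta j = r (l, i) - G^`M(i).@[y l].
  move=> l; apply: (nodal_image hF (yne l) (nF l)).
  under eq_bigr do rewrite mulrBl.
  by rewrite sumrB (euler_eval _ hG) -mulr_natl Gy subrr.
exists (mk (hvec 0 w) eta); split; first by rewrite par_mk hvec0.
move=> [l i]; rewrite /eqs /=.
have [rF HF] := meval_line F^`M(i) (y l) (eta l).
have [rG HG] := meval_line G^`M(i) (y l) (eta l).
exists (rF + (\sum_j G^`M(i)^`M(j).@[y l] * eta l j)%:P + 'X * rG) => c.
have -> : par (fun s => base s + c * mk (hvec 0 w) eta s) ord0 = 0.
  by rewrite {1}/par -/(par base _) -/(par (mk _ _) _) !par_mk !hvec0 mulr0 addr0.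
have fw : fam (mk (hvec 0 w) eta) = lin_fam C w.
  by apply: eq_bigr => p _; rewrite par_mk hvecS.
rewrite fam_base fw degG0 //; last by apply: rpredD; [|apply: rpredZ]; apply: lin_fam_homog.
rewrite mulrDr -scalerAr -/F -/G mderivD mderivZ.
rewrite (meval_eq (v2 := fun j => y l j + c * eta l j)); last first.
  by move=> j; rewrite {1}/pt -/(pt base _ _) -/(pt (mk _ _) _ _) !pt_mk.
rewrite mevalD mevalZ HF HG Heta; have [-> _] := nF l.
rewrite !(hornerD, hornerM, hornerX, hornerC).
by ring.
Qed.

Lemma singular_deform (Q : {mpoly K[P.+1]}) : Q.@[hvec 0 v1] != 0 ->
  exists t v (z : 'I_delta -> 'I_4 -> K),
  [/\ t != 0, Q.@[hvec t v] != 0,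
      forall l i, (degG n m Sh t (lin_fam C v))^`M(i).@[z l] = 0,
      forall l, z l ord0 != 0
    & \matrix_(l, l') (eh l).@[z l'] \in unitmx].
Proof.
move=> Q0; have /choice[E HE] := polyfn_eqs.
(* The determinant keeps the conditions at the moved points independent, and the product keeps these
   points off the plane [x_0 = 0]. *)
have [Qt HQ] : polyfn (fun u => Q.@[par u] * (\det (\matrix_(l, l') (eh l).@[pt u l']) * \prod_l pt u l ord0)).
  apply: polyfnM; last apply: polyfnM; last by apply: polyfn_prod => l; apply: polyfn_pt.
    apply: (@polyfn_comp _ _ _ (fun v => Q.@[v]) (fun i u => par u i)); first by exists Q.
    by move=> i; apply: polyfn_par.
  apply: polyfn_sum => s; apply: polyfnM; first exact: polyfn_const.
  apply: polyfn_prod => l.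
  have [||j|c Hc] := @polyfn_meval _ _ _ m (fun=> eh l) (fun j u => pt u (s l) j).
  - by move=> _; apply: heh.
  - exact: mpolyfn_const.
  - exact: polyfn_pt.
  by exists c => u; rewrite mxE -Hc.
have ptb l : pt base l =1 y l by move=> j; rewrite /base pt_mk.
have parb : par base =1 hvec 0 v1 by move=> j; rewrite /base par_mk.
have Eb s : (E s).@[base] = 0.
  rewrite -HE /eqs parb hvec0 (_ : fam base = lin_fam C v1); last first.
    by apply: eq_bigr => p _; rewrite parb hvecS.
  rewrite degG0 //; last exact: lin_fam_homog.
  rewrite (meval_eq _ (ptb s.1)).
  have gy l : (lin_fam C v1).@[y l] = 0.
    have [_ h] := singular_at_homog (y l) (lin_fam_homog hC v1) m0.
    by have [ng _] := nod l; have [] := h ng.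
  by have [ng _] := nod s.1; rewrite mderivM mevalD !mevalM ng gy !mulr0 addr0.
have [|||u [Eu tu Qu]] := @smooth_point_deform K N Kbig _ E base (enum_rank (inl ord0 : idx)) Eb _ Qt.
- move=> r; have [d [d0 Hd]] := eqs_surjective r; exists d; split=> // s.
  have [rho Hr] := Hd s; have [rho' Hr'] := meval_line (E s) base d.
  apply: (@line_coef _ 0 _ _ rho' rho) => c.
  by rewrite -Hr HE Hr' Eb.
- by rewrite -/(par base ord0) parb hvec0.
- rewrite -HQ !mulf_neq0 //.
  + by rewrite (meval_eq _ parb).
  + rewrite (_ : \matrix_(l, l') _ = 1%:M) ?det1 ?oner_neq0 //.
    by apply/matrixP => l l'; rewrite !mxE (meval_eq _ (ptb l')) ehd.
  by apply/prodf_neq0 => l _; rewrite ptb.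
exists (par u ord0), (fun p => par u (lift ord0 p)), (pt u).
move: Qu; rewrite -HQ !mulf_eq0 !negb_or => /and3P[Qu du pu]; split=> //.
- by rewrite -(meval_eq _ (hvecE (par u))).
- by move=> l i; have := Eu (l, i); rewrite -HE.
- by move=> l; have /prodf_neq0 := pu; apply.
by rewrite unitmxE unitfE.
Qed.

End Smoothing.

Section Smoothing.
Variable K : numClosedFieldType.
Hypothesis Kbig : large_fibers K.
Local Notation A := {mpoly K[4]}.
Local Notation X0 := ('X_ord0 : A).
Variables (n m : nat) (Sh : A).
Hypothesis mn : (m <= n)%N.
Hypothesis m0 : (0 < m)%N.
Hypothesis hS : Sh \is n.-homog.
Variables (P : nat) (C : 'I_P -> A).
Hypothesis hC : forall p, C p \is m.-homog.
Hypothesis Csurj : forall h : A, h \is m.-homog -> exists v, h = lin_fam C v.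
Variables (e k delta : nat) (T1 : 'I_delta -> A).
Hypothesis me : (m <= e)%N.
Hypothesis ek : (e <= k)%N.
Hypothesis nk : (n <= k)%N.
Hypothesis dk : (delta < k)%N.
Hypothesis hT1 : forall l, T1 l \is (e.-1).-homog.
Variable D : {mpoly K[P.+1]}.
Hypothesis Dspan : forall t v, D.@[hvec t v] != 0 -> family_spans n m Sh e k T1 t (lin_fam C v).

(** The dilation carries the singular points of [G_t] to singular points of [F_t], together with the
    dual forms multiplied by [x_0^(n-m)]. The corank bound then shows that these are nodes and the
    only singular points. *)
Lemma smoothing (Q : {mpoly K[P.+1]}) (v1 : 'I_P -> K) (y : 'I_delta -> 'I_4 -> K) (eh : 'I_delta -> A) :
  D.@[hvec 0 v1] != 0 -> Q.@[hvec 0 v1] != 0 ->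
  (forall l, exists i, y l i != 0) -> (forall l, nodal_at (lin_fam C v1) (y l)) ->
  (forall l, eh l \is m.-homog) -> (forall l l', (eh l).@[y l'] = (l == l')%:R) ->
  exists t v (z : 'I_delta -> 'I_4 -> K) (ef : 'I_delta -> A),
  [/\ Q.@[hvec t v] != 0,
      (forall l, exists i, z l i != 0) /\ (forall l l', l != l' -> ~ propor (z l) (z l')),
      forall l, nodal_at (degF n m Sh t (lin_fam C v)) (z l),
      forall x, (exists i, x i != 0) -> (forall i, (degF n m Sh t (lin_fam C v))^`M(i).@[x] = 0) ->
        exists l, propor (z l) x
    & forall j, ef j \is n.-homog /\ forall l, (ef j).@[z l] = (l == j)%:R].
Proof.
move=> Dv1 Qv1 yne nod heh ehd.
have yl0 l : y l ord0 != 0.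
  apply: contraTneq isT => yl0; have [i /eqP] := yne l; case.
  have E := hvecE (y l); rewrite yl0 in E; rewrite E /hvec; case: unliftP => // j _; move: j.
  apply: (span_off_plane Kbig mn m0 me nk ek hS (lin_fam_homog hC v1) hT1 (Dspan Dv1)) => i'.
  by have [ny _] := nod l; rewrite -[RHS](ny i'); apply: meval_eq => r; rewrite [RHS]E.
have QD : (Q * D).@[hvec 0 v1] != 0 by rewrite mevalM mulf_neq0.
have [t [v [z' [t0 QDv Gz z0 uE]]]] := singular_deform Kbig mn m0 hS hC Csurj nod yl0 heh ehd QD.
move: QDv; rewrite mevalM mulf_eq0 negb_or => /andP[Qv Dv].
set g := lin_fam C v in Gz *; have hg : g \is m.-homog by apply: lin_fam_homog.
pose N := dilation t; have uN : N \in unitmx by apply: dilation_unit.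
pose z l := vmul (z' l) N; pose F := degF n m Sh t g.
have zsing l : forall i, F^`M(i).@[z l] = 0.
  have [_ h] := sing_lsubst F (z' l) uN; apply: h => i.
  by rewrite degF_dilation // mderivZ mevalZ Gz mulr0.
set E := \matrix_(l, l') _ in uE.
(* Inverting the matrix [E] of values makes the [eh] dual at the moved points again; the scalar
   compensates [x_0^(n-m)]. *)
pose ef j := lsubst (invmx N) ((z' j ord0 ^+ (n - m))^-1 *: (X0 ^+ (n - m) * \sum_l invmx E j l *: eh l)).
have hef j : ef j \is n.-homog.
  have hu : X0 ^+ (n - m) * \sum_l invmx E j l *: eh l \is n.-homog.
    rewrite -[X in X.-homog](subnK mn); apply: dhomogM; first exact: X0n_homog.
    by apply: rpred_sum => l _; apply: rpredZ; apply: heh.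
  by apply: lsubst_homog; apply: rpredZ.
have efz j l : (ef j).@[z l] = (l == j)%:R.
  rewrite /ef meval_lsubst (meval_eq _ (vmulK (z' l) uN)) mevalZ mevalM rmorphXn /= mevalXU.
  have -> : (\sum_l' invmx E j l' *: eh l').@[z' l] = (j == l)%:R.
    have /matrixP/(_ j l) := mulVmx uE; rewrite !mxE => <-; rewrite meval_sum.
    by apply: eq_bigr => l' _; rewrite mevalZ mxE.
  by rewrite [l == j]eq_sym; case: eqVneq => [->|_]; rewrite ?mulr0 // mulr1 mulVf // expf_neq0.
have zne l : exists i, z l i != 0.
  exists ord0; rewrite /z (vmul_ext N (hvecE (z' l))) vmul_dilation hvec0 z0 //.
have znp l l' : l != l' -> ~ propor (z l) (z l').
  move=> ll' [c Hc]; have := efz l' l'; rewrite (meval_eq _ Hc) (meval_scale _ _ (hef l')) efz.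
  by rewrite (negPf ll') mulr0 eqxx => /esym/eqP; rewrite oner_eq0.
have cork : corank_le F k delta := corank_degF mn m0 hS nk me t0 hg (Dspan Dv).
exists t, v, z, ef; split=> //.
- by move=> l; apply: (corank_nodal cork dk zne znp zsing).
- by move=> x x0 Hx; apply: (corank_only_sing cork dk zne znp zsing).
Qed.

End Smoothing.

(** * Sets of nodes *)

Section NodeSets.
Variable K : numClosedFieldType.
Hypothesis Kbig : large_fibers K.
Local Notation A := {mpoly K[4]}.

(** The Severi condition in terms of representatives in [K^4], on which linear substitutions act
    directly. *)
Definition nodes_of (f : A) delta (q : 'I_delta -> 'I_4 -> K) :=
  [/\ forall l, exists i, q l i != 0, forall l l', l != l' -> ~ propor (q l) (q l'),
      forall l, nodal_at f (q l)
    & forall v, (exists i, v i != 0) -> (forall i, f^`M(i).@[v] = 0) -> exists l, propor (q l) v].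

Definition duals_at d delta (q : 'I_delta -> 'I_4 -> K) (e : 'I_delta -> A) :=
  forall j, e j \is d.-homog /\ forall l, (e j).@[q l] = (l == j)%:R.

Lemma vmul_neq0 n (N : 'M[K]_n) v : N \in unitmx -> (exists i, v i != 0) -> exists i, vmul v N i != 0.
Proof.
move=> uN [i vi]; apply: contrapT => /forallNP H; move/eqP: vi; apply.
rewrite -(vmulK v uN) /vmul big1 // => j _.
by have /negP/negPn/eqP := H j; rewrite /vmul => ->; rewrite mul0r.
Qed.

Lemma propor_vmul n (N : 'M[K]_n) v w : N \in unitmx -> propor (vmul v N) (vmul w N) -> propor v w.
Proof.
move=> uN [c Hc]; exists c; apply: (vmul_inj uN) => j.
by rewrite Hc vmulZ.
Qed.

Lemma nodal_scaler n b (f : {mpoly K[n]}) q : b != 0 -> nodal_at f q -> nodal_at (b *: f) q.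
Proof.
move=> b0 [fq fh]; split=> [i|v Hv]; first by rewrite mderivZ mevalZ fq mulr0.
apply: fh => i; apply: (mulfI b0); rewrite mulr0 -[RHS](Hv i) mulr_sumr.
by apply: eq_bigr => l _; rewrite !mderivZ mevalZ mulrA.
Qed.

Lemma nodes_of_lsubst (N : 'M[K]_4) b f delta (q : 'I_delta -> 'I_4 -> K) : N \in unitmx -> b != 0 ->
  nodes_of f q -> nodes_of (b *: lsubst N f) (fun l => vmul (q l) (invmx N)).
Proof.
move=> uN b0 [q0 qne nod only]; have uV : invmx N \in unitmx by rewrite unitmx_inv.
split=> [l|l l' ll'|l|v v0 Hv].
- exact: vmul_neq0.
- by move/(propor_vmul uV); apply: qne.
- apply: nodal_scaler => //; apply: nodal_lsubst => //.
  have -> : vmul (vmul (q l) (invmx N)) N = q l by apply/funext; apply: vmulKV.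
  exact: nod.
have [|l [c Hc]] := only _ (vmul_neq0 uN v0).
  apply/(sing_lsubst f v uN) => i; apply: (mulfI b0).
  by rewrite mulr0 -mevalZ -mderivZ.
exists l; apply: (propor_vmul uN); exists c => i; rewrite Hc; congr (_ * _).
by rewrite vmulKV.
Qed.

Lemma duals_at_lsubst (N : 'M[K]_4) d delta (q : 'I_delta -> 'I_4 -> K) e : N \in unitmx ->
  duals_at d q e -> duals_at d (fun l => vmul (q l) (invmx N)) (fun j => lsubst N (e j)).
Proof.
move=> uN He j; have [hj ej] := He j; split; first exact: lsubst_homog.
by move=> l; rewrite meval_lsubst (meval_eq _ (vmulKV (q l) uN)) ej.
Qed.

Lemma severi_nodes d delta (Y : linsys K 3 d) : (0 < d)%N -> severi d delta Y ->
  exists q : 'I_delta -> 'I_4 -> K, nodes_of (rep Y : A) q /\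
   (h1_ideal_zero d (sing_locus Y) -> exists e, duals_at d q e).
Proof.
move=> d0 /severi_points[q [qne Hq nod]]; exists (fun l => pcoords (q l)); split.
  split=> // [l|]; first exact: pcoords_neq0.
  exact: sing_only.
by move=> /(dual_of_h1 Hq qne (fun l => pcoords_neq0 (q l))).
Qed.

Lemma nodes_severi d delta (Y : linsys K 3 d) (q : 'I_delta -> 'I_4 -> K) e : (0 < d)%N ->
  nodes_of (rep Y : A) q -> duals_at d q e -> severi d delta Y /\ h1_ideal_zero d (sing_locus Y).
Proof.
move=> d0 [q0 qne nod only] He; have hY := dhomog_is_dhomog (rep Y).
have /choice[x Hx] : forall l, exists x : Proj K 3, exists2 c, c != 0 & pcoords x =1 fun i => c * q l i.
  by move=> l; have [x [_ h]] := mkvpoint (q0 l); exists x.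
have nodx l : nodal_at (rep Y : A) (pcoords (x l)).
  by have [c c0 Hc] := Hx l; apply: nodal_scale hY c0 Hc (nod l).
have Hs z : sing_locus Y z <-> exists l, z = x l.
  split=> [[_ hz]|[l ->]].
    have [l [c Hc]] := only _ (pcoords_neq0 z) hz; exists l; apply/esym/pcoords_propor.
    have [c' c0 Hc'] := Hx l; exists (c / c') => i.
    by rewrite Hc Hc' mulrA divfK.
  by apply/(singular_at_homog _ hY) => //; have [] := nodx l.
have xinj : injective x.
  move=> l l' xl; apply/eqP/negPn/negP => /qne; apply.
  have [c c0 Hc] := Hx l; have [c' c0' Hc'] := Hx l'; rewrite -xl in Hc'.
  by exists (c / c') => i; apply: (mulfI c0'); rewrite -Hc' Hc mulrA [c' * _]mulrC divfK.
split; first exact: (severi_of_points d0 xinj Hs nodx).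
apply: (h1_of_dual Hs (fun l => pcoords_neq0 (x l))).
have /choice[c Hc] : forall l, exists c, c != 0 /\ pcoords (x l) =1 fun i => c * q l i.
  by move=> l; have [c c0 h] := Hx l; exists c.
exists (fun j => (c j ^- d) *: e j) => j; have [hj ej] := He j; split; first exact: rpredZ.
move=> l; have [c0 hc] := Hc l; rewrite mevalZ (meval_eq _ hc) (meval_scale _ _ hj) ej.
by case: eqVneq => [->|_]; rewrite ?mulr0 // mulr1 mulVf // expf_neq0 //; have [] := Hc j.
Qed.

Lemma polyfn_coord d N (F : ('I_N -> K) -> dhomog 4 K d) p :
  mpolyfn (fun u => F u : A) -> polyfn (fun u => coord (vbasis fullv) p (F u)).
Proof.
move=> hF.
pose B (b : 'X_{1..4 < d.+1}) : dhomog 4 K d :=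
  if pselect (('X_[b] : A) \is d.-homog) is left h then DHomog h else 0.
have E u : F u = \sum_(b : 'X_{1..4 < d.+1}) (F u : A)@_b *: B b.
  apply: val_inj; rewrite [RHS]raddf_sum /=.
  have sz : (msize (F u : A) <= d.+1)%N.
    rewrite mmeasureE; apply/bigmax_leqP_seq => b hb _.
    by rewrite (dhomog_mf (dhomog_is_dhomog (F u)) hb).
  rewrite [LHS](mpolywE sz); apply: eq_bigr => b _ /=; rewrite /B.
  case: pselect => [//|nh]; rewrite (dhomog_nemf_coeff (dhomog_is_dhomog (F u))) ?scale0r //.
  by apply: contra_notN nh => /eqP /= db; rewrite dhomogX /= db.
apply: (@polyfn_ext _ _ _ (fun u => \sum_(b : 'X_{1..4 < d.+1}) (F u : A)@_b * coord (vbasis fullv) p (B b))).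
  by move=> u; rewrite {1}E linear_sum; apply: eq_bigr => b _; rewrite linearZ.
by apply: polyfn_sum => b; apply: polyfnM; [apply: hF|apply: polyfn_const].
Qed.

End NodeSets.

(** * The exceptional curve in different frames *)

Section Cone.
Variable K : numClosedFieldType.
Hypothesis Kbig : large_fibers K.
Local Notation A := {mpoly K[4]}.
Local Notation X0 := ('X_ord0 : A).

Lemma row_inj_unit n (N : 'M[K]_n) :
  (forall w, (forall i, vmul w N i = 0) -> forall i, w i = 0) -> N \in unitmx.
Proof.
move=> H; rewrite -row_free_unit -kermx_eq0; apply/eqP/row_matrixP => r; rewrite row0.
apply/rowP => i; rewrite [RHS]mxE; apply: (H (fun i => row r (kermx N) 0 i)) => j.
have /sub_kermxP := row_sub r (kermx N); move: (row r _) => v /rowP/(_ j).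
by rewrite !mxE.
Qed.

Lemma smooth_curve m (C : linsys K 2 m) (f : {mpoly K[3]}) c : (0 < m)%N -> c != 0 ->
  f = c *: (rep C : {mpoly K[3]}) -> sing_locus C = classical_sets.set0 ->
  forall w, (forall i, f^`M(i).@[w] = 0) -> forall i, w i = 0.
Proof.
move=> m0 c0 ef C0 w Hw i; apply/eqP/negPn/negP => wi.
have [|x [_ [d d0 Hx]]] := @mkvpoint K 2 w; first by exists i.
have hC := dhomog_is_dhomog (rep C).
have : sing_locus C x.
  apply/(singular_at_homog _ hC) => // j; rewrite (meval_eq _ Hx) (meval_scale _ _ (mderiv_homog j hC)).
  by apply: (mulfI c0); rewrite mulrCA -mevalZ -mderivZ -ef Hw !mulr0.
by rewrite C0.
Qed.

Lemma vmul_block (B : 'M[K]_4) a c w : (forall j, B ord0 (lift ord0 j) = 0) -> B ord0 ord0 = a ->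
  vmul (hvec c w) B =1 hvec (c * a + \sum_i w i * B (lift ord0 i) ord0)
    (vmul w (\matrix_(i < 3, j < 3) B (lift ord0 i) (lift ord0 j))).
Proof.
move=> B0 Ba j; rewrite /vmul big_ord_recl hvec0.
under eq_bigr do rewrite hvecS.
case: (unliftP ord0 j) => [l ->|->]; rewrite ?hvec0 ?hvecS ?Ba // B0 mulr0 add0r.
by apply: eq_bigr => i _; rewrite mxE.
Qed.

(* Comparing the lowest powers of [s] in the expansions of [Sh' (1, s w)]. *)
Lemma initial_frame_change n m (Sh Sh' : A) (B : 'M[K]_4) a : (m <= n)%N ->
  Sh \is n.-homog -> Sh' = lsubst B Sh -> (forall j, B ord0 (lift ord0 j) = 0) -> B ord0 ord0 = a ->
  (forall j, (j < m)%N -> pihomog mdeg j (dehom Sh) = 0) ->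
  (forall j, (j < m)%N -> pihomog mdeg j (dehom Sh') = 0) ->
  pihomog mdeg m (dehom Sh') = a ^+ (n - m) *:
    lsubst (\matrix_(i < 3, j < 3) B (lift ord0 i) (lift ord0 j)) (pihomog mdeg m (dehom Sh)).
Proof.
move=> mn hS eS B0 Ba low low'; set N := \matrix_(_, _) _.
have hS' : Sh' \is n.-homog by rewrite eS; apply: lsubst_homog.
apply: mpoly_eval_inj => // w; rewrite mevalZ meval_lsubst.
set L := \sum_i w i * B (lift ord0 i) ord0.
pose f j := (pihomog mdeg j (dehom Sh)).@[vmul w N]; pose f' j := (pihomog mdeg j (dehom Sh')).@[w].
pose p : {poly K} := \sum_(j < n.+1 | (m <= j)%N) 'X^(j - m) * ((f' j)%:P - (a%:P + L *: 'X) ^+ (n - j) * (f j)%:P).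
have E s : s ^+ m * p.[s] = 0.
  have e : Sh'.@[hvec 1 (fun i => s * w i)] = Sh.@[hvec (a + L * s) (fun i => s * vmul w N i)].
    rewrite eS meval_lsubst; apply: meval_eq => j; rewrite (vmul_block _ _ B0 Ba) mul1r.
    rewrite /hvec; case: unlift => [l|]; first by rewrite vmulZ.
    by rewrite /L mulr_suml; congr (_ + _); apply: eq_bigr => i _; ring.
  rewrite !(homog_expand _ _ hS') (homog_expand _ _ hS) in e.
  transitivity (\sum_(j < n.+1) (s ^+ j * f' j - (a + L * s) ^+ (n - j) * (s ^+ j * f j))).
    rewrite /p horner_sum mulr_sumr big_mkcond; apply: eq_bigr => j _.
    case: leqP => mj; last by rewrite /f /f' low // low' // !meval0 !mulr0 subrr.
    by rewrite !hornerE /= -exprD subnKC // mulrBr mulrA [s ^+ j * (_ ^+ _)]mulrC.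
  rewrite sumrB; apply/eqP; rewrite subr_eq0; apply/eqP.
  have e1 : \sum_(j < n.+1) s ^+ j * f' j =
      \sum_(j < n.+1) 1 ^+ (n - j) * (pihomog mdeg j (dehom Sh')).@[fun i => s * w i].
    by apply: eq_bigr => j _; rewrite expr1n mul1r (meval_scale _ _ (pihomogP _ _ _)).
  rewrite e1 e; apply: eq_bigr => j _.
  by rewrite (meval_scale _ _ (pihomogP _ _ _)).
have p0 : 'X^m * p = 0.
  apply/eqP/negPn/negP => /exists_nonroot[s]; rewrite hornerM hornerXn E eqxx //.
have : p.[0] = 0.
  have /eqP := p0; rewrite mulf_eq0 expf_eq0 polyX_eq0 andbF /= => /eqP ->; exact: horner0.
have mn' : (m < n.+1)%N by [].
rewrite /p horner_sum (bigD1 (Ordinal mn')) //= big1 ?addr0 => [|j /andP[mj jm]]; last first.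
  have jm' : (m < j)%N by rewrite ltn_neqAle mj andbT; apply: contraNneq jm => e; apply/eqP/val_inj.
  by rewrite hornerM hornerXn expr0n subn_eq0 leqNgt jm' mul0r.
rewrite !hornerE /= subnn expr0 mul1r => /eqP.
by rewrite subr_eq0 => /eqP.
Qed.

(** [ordinary_singularity] comes with its own frame and curve; this transfers smoothness to the
    initial form in the frame of [exceptional_curve]. The block of [B] on the last three coordinates
    is invertible because [B] is and fixes the point. *)
Lemma smooth_frame_change n m (Sh Sh' : A) (B : 'M[K]_4) a : (m <= n)%N ->
  Sh \is n.-homog -> Sh' = lsubst B Sh -> (forall j, B ord0 (lift ord0 j) = 0) -> B ord0 ord0 = a ->
  a != 0 -> B \in unitmx ->
  (forall j, (j < m)%N -> pihomog mdeg j (dehom Sh) = 0) ->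
  (forall j, (j < m)%N -> pihomog mdeg j (dehom Sh') = 0) ->
  (forall w, (forall i, (pihomog mdeg m (dehom Sh'))^`M(i).@[w] = 0) -> forall i, w i = 0) ->
  forall w, (forall i, (pihomog mdeg m (dehom Sh))^`M(i).@[w] = 0) -> forall i, w i = 0.
Proof.
move=> mn hS eS B0 Ba a0 uB low low' sm w Hw.
have E := initial_frame_change mn hS eS B0 Ba low low'; set N := \matrix_(_, _) _ in E.
have uN : N \in unitmx.
  apply: row_inj_unit => v Hv i.
  set L := \sum_i v i * B (lift ord0 i) ord0.
  have h : vmul (hvec 0 v) B =1 vmul (hvec (L / a) (fun=> 0)) B.
    move=> j; rewrite !(vmul_block _ _ B0 Ba) -/N -/L mul0r add0r divfK //.
    rewrite [X in hvec (_ + X)]big1 ?addr0 => [|l _]; last by rewrite mul0r.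
    rewrite /hvec; case: unlift => [l|//]; rewrite Hv /vmul big1 // => l' _.
    by rewrite mul0r.
  by have := vmul_inj uB h (lift ord0 i); rewrite !hvecS.
have Hv : forall i, vmul w (invmx N) i = 0.
  apply: sm => i; rewrite E mderivZ mevalZ.
  have [h _] := sing_lsubst (pihomog mdeg m (dehom Sh)) (vmul w (invmx N)) uN.
  by rewrite h ?mulr0 // => j; rewrite (meval_eq _ (vmulKV w uN)).
move=> i; rewrite -(vmulKV w uN i) /vmul big1 // => j _.
by have := Hv j; rewrite /vmul => ->; rewrite mul0r.
Qed.

Lemma frame_ratio (p : Proj K 3) (M M' : 'M[K]_4) : frame_at p M -> frame_at p M' ->
  exists a, [/\ a != 0, (M' *m invmx M) ord0 ord0 = a & forall j, (M' *m invmx M) ord0 (lift ord0 j) = 0].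
Proof.
move=> [uM eM] [uM' eM'].
have [a ea] : exists a, row ord0 M' = a *: row ord0 M.
  by apply/vlineP; rewrite eM -eM' memv_line.
have a0 : a != 0.
  apply: contraTneq uM' => a0; rewrite -row_free_unit -kermx_eq0; apply/negP => /eqP k0.
  have : (delta_mx 0 ord0 : 'rV[K]_4) = 0.
    apply/eqP; rewrite -submx0 -k0; apply/sub_kermxP.
    by rewrite -rowE ea a0 scale0r.
  by move/rowP/(_ ord0); rewrite !mxE !eqxx => /eqP; rewrite oner_eq0.
have r j : (M' *m invmx M) ord0 j = a * (ord0 == j)%:R.
  have -> : (M' *m invmx M) ord0 j = (row ord0 M' *m invmx M) 0 j by rewrite -row_mul [RHS]mxE.
  by rewrite ea -scalemxAl -row_mul mulmxV // !mxE.
exists a; split=> //; first by rewrite r eqxx mulr1.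
by move=> j; rewrite r (negPf (neq_lift _ _)) mulr0.
Qed.

End Cone.

(** * Regular surfaces tending to S *)

Lemma irreducible_meets (T : topologicalType) (W U V : set T) : irreducible_set W ->
  open U -> open V -> (exists2 x, W x & U x) -> (exists2 x, W x & V x) ->
  exists x, [/\ W x, U x & V x].
Proof.
move=> [_ irr] oU oV [x Wx Ux] [y Wy Vy]; apply: contrapT => H.
have cU : closed (~` U)%classic by rewrite -openC setCK.
have cV : closed (~` V)%classic by rewrite -openC setCK.
have [|WU|WV] := irr _ _ cU cV; last 2 first.
- by case: (WU x Wx).
- by case: (WV y Wy).
move=> z Wz; have [Uz|nUz] := pselect (U z); [right=> Vz|by left].
by apply: H; exists z.
Qed.

Section Main.
Variable K : numClosedFieldType.
Hypothesis Kbig : large_fibers K.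
Local Notation A := {mpoly K[4]}.
Local Notation X0 := ('X_ord0 : A).

Lemma sing_degree_pos d (Y : linsys K 3 d) x : sing_locus Y x -> (0 < d)%N.
Proof.
move=> [fx _]; rewrite lt0n; apply/negP => /eqP d0.
have hf := dhomog_is_dhomog (rep Y); set f : A := rep Y in fx hf.
have fC : f = (f.@[fun=> 0])%:MP by rewrite -pihomog_mdeg0 pihomog_dE // -[X in X.-homog]d0.
have f0 : f = 0 by move: fx; rewrite fC mevalC => ->; rewrite mpolyC0.
by move: (rep_neq0 Y) => /eqP; apply; apply: val_inj.
Qed.

Lemma nodal_neq0 (f : A) q : (exists i, q i != 0) -> nodal_at f q -> f != 0.
Proof.
move=> [i qi] [_ fh]; apply/eqP => f0.
have H v : propor q v.
  by apply: fh => j; rewrite f0 big1 // => l _; rewrite !mderiv0 meval0 mul0r.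
have [j ij] : exists j : 'I_4, j != i by exists (lift i ord0); rewrite eq_sym neq_lift.
have [c Hc] := H (fun l => (l == j)%:R).
have /esym/eqP := Hc i; rewrite [i == j]eq_sym (negPf ij) mulf_eq0 (negPf qi) orbF => /eqP c0.
by have := Hc j; rewrite eqxx c0 mul0r => /eqP; rewrite oner_eq0.
Qed.

Lemma regular_in_closure (n m delta : nat) (hdelta : (0 < delta)%N)
  (S : linsys K 3 n) (p : Proj K 3) (Ssing : sing_locus S = [set p]%classic)
  (Sord : ordinary_singularity S p m) (C : linsys K 2 m) (hC : exceptional_curve S p C)
  (hX : exists X : linsys K 3 m, plane_section X C /\
     exists2 W, regular_component delta W & W X) :
  closure [set Y : linsys K 3 n | severi n delta Y /\ h1_ideal_zero n (sing_locus Y)]%classic S.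
Proof.
have hF := dhomog_is_dhomog (rep S); set F : A := rep S in hF.
have [M [frM [loc0 low] [c0 c0n eC]]] := hC; have uM : M \in unitmx by case: frM.
pose Sh := lsubst M F; have hS : Sh \is n.-homog by apply: lsubst_homog.
have eloc M' : local_equation S M' = dehom (lsubst M' F) by rewrite -affsub_dehom.
rewrite eloc -/Sh in loc0 low eC; set loc := pihomog mdeg m (dehom Sh) in loc0 eC.
have mn : (m <= n)%N.
  by rewrite leqNgt; apply: contra_neqN loc0; apply: pihomog_dehom_big.
have [X [[P0 [fP [c1 c1n eX]]] [W [[Wsub Wirr _] [U1 [oU1 [X1 [U1X1 WX1]] U1h]]] WX]]] := hX.
have sX : severi m delta X := Wsub _ WX.
have m0 : (0 < m)%N.
  by have [q [_ Hq _]] := severi_points sX; apply: (sing_degree_pos (x := q (Ordinal hdelta))); apply/Hq; exists (Ordinal hdelta).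
have n0 : (0 < n)%N by apply: leq_trans mn.
have [N uN NP] := frame_complete fP.
(* The initial form of [S] is [c0] times, and the plane section of [X] is [c1] times, the chosen
   equation of [C]. *)
pose kap := c0 / c1; have kap0 : kap != 0 by rewrite mulf_neq0 // invr_neq0.
pose Cb (r : 'I_(\dim (fullv : {vspace dhomog 4 K m}))) : A :=
  kap *: lsubst N (((vbasis fullv)`_r : dhomog 4 K m) : A).
have hCb r : Cb r \is m.-homog by apply: rpredZ; apply: lsubst_homog; apply: dhomog_is_dhomog.
have famE v : lin_fam Cb v = kap *: lsubst N (hform v : A).
  rewrite hform_mpoly (raddf_sum (lsubst N)) /= scaler_sumr; apply: eq_bigr => r _.
  by rewrite /Cb [in RHS]linearZ /= !scalerA [v r * _]mulrC.
have Csurj (h : A) : h \is m.-homog -> exists v, h = lin_fam Cb v.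
  move=> hh; have hh' : kap^-1 *: lsubst (invmx N) h \is m.-homog by apply: rpredZ; apply: lsubst_homog.
  exists (fun r => coord (vbasis fullv) r (DHomog hh')); rewrite famE hform_coord /=.
  by rewrite linearZ /= lsubstK // scalerA divff // scale1r.
pose vX := hcoords X; pose g := lin_fam Cb vX.
have gE : g = kap *: lsubst N (rep X : A) by rewrite /g famE hform_hcoords.
have hg : g \is m.-homog by apply: lin_fam_homog.
have gloc w : g.@[hvec 0 w] = loc.@[w].
  rewrite gE mevalZ meval_lsubst eC mevalZ.
  have /(congr1 (fun f : {mpoly K[3]} => f.@[w])) := eX; rewrite mevalZ comp_mpoly_meval => e.
  rewrite /kap -[c0 / c1 * _]mulrA; congr (_ * _); apply: (mulfI c1n); rewrite mulrA divff // mul1r -e.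
  apply: meval_eq => j; rewrite tnth_mktuple meval_sum /vmul big_ord_recl hvec0 mul0r add0r.
  by apply: eq_bigr => i _; rewrite hvecS mevalZ mevalXU NP mulrC.
have Slow j : (j < m)%N -> pihomog xdeg j Sh = 0.
  move=> jm; apply: hvec_eval_inj => // c w.
  by rewrite (pihomog_xdeg_eval _ _ _ hS) low // !meval0 mulr0.
have lead : phi n m Sh g m = pihomog xdeg m Sh.
  apply: hvec_eval_inj => // c w.
  by rewrite phi_top_eval // (pihomog_xdeg_eval _ _ _ hS) gloc.
have Ssing' v : (forall i, Sh^`M(i).@[v] = 0) -> forall i, i != ord0 -> v i = 0.
  move=> Hv i i0; have [vne|/forallNP v0] := pselect (exists i, v i != 0); last first.
    by apply/eqP/negPn/negP/v0.
  have Hv' : forall i, F^`M(i).@[vmul v M] = 0 by apply/(sing_lsubst F v uM).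
  have [x [sx [c Hc]]] := sing_point_of n0 (vmul_neq0 uM vne) Hv'.
  have xp : x = p by move: sx; rewrite Ssing.
  have [d d0 Hd] := frame_row0 frM.
  have e : vmul v M =1 vmul (hvec (c * d) (fun=> 0)) M.
    move=> j; rewrite Hc xp Hd /vmul big_ord_recl hvec0 big1 ?addr0 ?mulrA // => l _.
    by rewrite hvecS mul0r.
  rewrite (vmul_inj uM e i); case: (unliftP ord0 i) i0 => [l ->|->]; by rewrite ?hvecS ?eqxx.
have locsm w : (forall i, loc^`M(i).@[w] = 0) -> forall i, w i = 0.
  have [[C' [M' [frM' [_ low'] [c' c'0 eC']]] Csm'] _] := Sord.
  have uM' : M' \in unitmx by case: frM'.
  have [a [a0 Ba B0]] := frame_ratio frM frM'.
  have eS : lsubst M' F = lsubst (M' *m invmx M) Sh by rewrite (lsubst_mul Kbig) mulmxKV.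
  rewrite eloc in low' eC'.
  apply: (smooth_frame_change Kbig mn hS eS B0 Ba a0 _ low low').
    by rewrite unitmx_mul uM' unitmx_inv.
  by apply: (smooth_curve m0 c'0 eC' Csm').
have Csm w : (forall i, i != ord0 -> g^`M(i).@[hvec 0 w] = 0) -> forall i, w i = 0.
  move=> Hw; apply: locsm => i.
  pose Z : 'M[K]_(3, 4) := \matrix_(r, j) (j == lift ord0 r)%:R.
  have vZ (u : 'I_3 -> K) : vmul u Z =1 hvec 0 u.
    move=> j; rewrite /vmul; case: (unliftP ord0 j) => [l ->|->].
      rewrite hvecS (bigD1 l) //= mxE eqxx mulr1 big1 ?addr0 // => r rl.
      by rewrite mxE (inj_eq lift_inj) eq_sym (negPf rl) mulr0.
    by rewrite hvec0 big1 // => r _; rewrite mxE (negPf (neq_lift _ _)) mulr0.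
  have -> : loc = lsubst Z g.
    by apply: mpoly_eval_inj => // u; rewrite meval_lsubst (meval_eq _ (vZ u)) gloc.
  rewrite mderiv_lsubst meval_sum big1 // => j _; rewrite mevalZ meval_lsubst (meval_eq _ (vZ w)) mxE.
  by case: eqVneq => [->|_]; rewrite ?mul0r // mul1r Hw // eq_sym neq_lift.
have [qX [nX _]] := severi_nodes m0 sX.
have [q0 qne nod only] : nodes_of g (fun l => vmul (qX l) (invmx N)) by rewrite gE; apply: nodes_of_lsubst.
have [e [k [T1 [/andP[me ek] /andP[nk dk] hT1 span0]]]] :=
  degenerate_family Kbig mn m0 hS hg Slow lead Ssing' Csm q0 qne nod only.
have [D0 [D0X Dspan]] := family_spans_open mn m0 hS hCb me ek nk dk hT1 span0.
move=> U nU; have [V [oV SV] VU] : exists2 V, open_nbhs S V & (V `<=` U)%classic by move: nU; rewrite nbhsE.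
have [DV [kV [hDV DVS DVV]]] := open_nonvanishingP oV SV.
pose FF t v := lsubst (invmx M) (degF n m Sh t (lin_fam Cb v)).
have hFF t v : FF t v \is n.-homog by apply: lsubst_homog; apply: degF_homog.
pose FE t v : dhomog 4 K n := DHomog (hFF t v).
(* [Q] is the equation [DV] evaluated on [F_t], put back in the original coordinates: where it is
   nonzero, the surface lies in the given neighbourhood of [S]. *)
have [Q HQ] : polyfn (fun u : 'I_(\dim (fullv : {vspace dhomog 4 K m})).+1 -> K =>
    DV.@[fun r => coord (vbasis fullv) r (FE (u ord0) (fun r => u (lift ord0 r)))]).
  apply: (@polyfn_comp _ _ _ (fun v => DV.@[v])
    (fun r u => coord (vbasis fullv) r (FE (u ord0) (fun r => u (lift ord0 r))))); first by exists DV.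
  move=> r; apply: polyfn_coord => /=.
  apply: (@mpolyfn_linear _ _ _ _ (lsubst (invmx M)) n.+1).
    move=> u; rewrite mmeasureE; apply/bigmax_leqP_seq => b hb _.
    by rewrite (dhomog_mf (degF_homog mn hS hCb _ _) hb).
  apply: (@mpolyfn_degF _ _ _ _ _ _ _ (fun u => u ord0)) => [|r']; exact: polyfn_var.
have HQ' t v : Q.@[hvec t v] = DV.@[fun r => coord (vbasis fullv) r (FE t v)].
  rewrite -HQ; apply: meval_eq => r; congr (coord _ _ _); apply: val_inj => /=.
  by rewrite /FF hvec0; congr (lsubst _ (degF _ _ _ _ _)); apply: eq_bigr => l _; rewrite hvecS.
have QX : Q.@[hvec 0 vX] != 0.
  rewrite HQ' (meval_eq (v2 := hcoords S)) // => r; congr (coord _ _ _); apply: val_inj => /=.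
  by rewrite /FF degF0 // lsubstKV.
(* At [t = 0] the conditions involve only the equation of [X], so they can be moved within [W]. *)
have [R HR] : polyfn (fun v => (D0 * Q).@[hvec 0 v]).
  apply: (@polyfn_comp _ _ _ (fun v => (D0 * Q).@[v]) (fun i v => hvec 0 v i)); first by exists (D0 * Q).
  by move=> i; rewrite /hvec; case: unlift => [r|]; [apply: polyfn_var|apply: polyfn_const].
have RX : R.@[hcoords X] != 0 by rewrite -HR mevalM mulf_neq0.
have [j [HX Hj]] := homog_component RX.
(* Regularity and the nonvanishing are nonempty open conditions on the irreducible [W], so some [X']
   satisfies both. *)
have [X' [WX' U1X' HX']] : exists X', [/\ W X', U1 X' & (pihomog mdeg j R).@[hcoords X'] != 0].
  apply: (irreducible_meets Wirr oU1 (open_nonvanishing (pihomogP mdeg j R))).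
    by exists X1.
  by exists X.
(* The nonvanishing of the homogeneous part gives that of [D0 * Q] only after rescaling the equation
   of [X'] by some [c]. *)
have [c [cn0]] := Hj _ HX'; set v1 := (fun i => _); rewrite -HR mevalM mulf_eq0 negb_or => /andP[Dv1 Qv1].
have sX' : severi m delta X' := Wsub _ WX'.
have [q' [nq' /(_ (U1h _ U1X' WX'))[e' He']]] := severi_nodes m0 sX'.
have gE1 : lin_fam Cb v1 = (kap * c) *: lsubst N (rep X' : A).
  by rewrite famE /v1 hformZ hform_hcoords /= linearZ /= scalerA.
have [y0 yne ynod _] : nodes_of (lin_fam Cb v1) (fun l => vmul (q' l) (invmx N)).
  by rewrite gE1; apply: nodes_of_lsubst => //; rewrite mulf_neq0.
have hy := duals_at_lsubst uN He'.
have [|l l'|t [v [z [ef [Qv [z0 zne] znod zonly hef]]]]] :=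
  smoothing Kbig mn m0 hS hCb Csurj me ek nk dk hT1 Dspan Dv1 Qv1 y0 ynod (eh := fun j => lsubst N (e' j)).
- by move=> l; have [] := hy l.
- by have [_ ->] := hy l; rewrite eq_sym.
have nz : nodes_of (degF n m Sh t (lin_fam Cb v)) z by split.
have uV : invmx M \in unitmx by rewrite unitmx_inv.
(* A form with a node is not zero, so it defines a point of the linear system. *)
have FE0 : FE t v != 0.
  have [z0' _ znod' _] := nodes_of_lsubst uV (oner_neq0 K) nz.
  have := nodal_neq0 (z0' (Ordinal hdelta)) (znod' (Ordinal hdelta)).
  rewrite scale1r; apply: contraNneq => h; apply/eqP.
  by rewrite -[LHS]/((FE t v : dhomog 4 K n) : A) h raddf0.
have [Y [_ [c2 c20 eY]]] := mkpoint FE0.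
have nY : nodes_of (rep Y : A) (fun l => vmul (z l) (invmx (invmx M))).
  by rewrite eY; apply: nodes_of_lsubst.
exists Y; split.
  exact: nodes_severi n0 nY (duals_at_lsubst uV hef).
apply/VU/DVV.
have hY : hcoords Y =1 fun r => c2 * coord (vbasis fullv) r (FE t v).
  by move=> r; rewrite /hcoords eY linearZ.
by rewrite (meval_eq _ hY) (meval_scale _ _ hDV) -HQ' mulf_neq0 // expf_neq0.
Qed.

Lemma exists_regular_component n delta (S : linsys K 3 n) : (0 < n)%N ->
  closure [set Y : linsys K 3 n | severi n delta Y /\ h1_ideal_zero n (sing_locus Y)]%classic S ->
  exists2 W : set (linsys K 3 n), regular_component delta W & closure W S.
Proof.
move=> n0 /irreducible_in_closure[B [BV irrB BS]].
have [|W [[Wsub Wirr Wmax] BW]] := @irreducible_component_exists _ _ (severi n delta) B _ irrB.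
  by move=> Y /BV[].
exists W; last exact: (closureS BW) BS.
split; first by split.
have [[Y BY] _] := irrB; have [sY hY] := BV _ BY.
have [U [oU UY Uh]] := regular_locus_open Kbig n0 sY hY.
exists U; split=> //; first by exists Y; split=> //; apply: BW.
by move=> Z UZ WZ; apply: Uh => //; apply: Wsub.
Qed.

End Main.

Theorem theorem3p8 (R : realType) (n m delta : nat) (hdelta : (0 < delta)%N)
  (S : linsys R[i] 3 n) (p : Proj R[i] 3)
  (Ssing : sing_locus S = [set p]%classic)
  (Sord : ordinary_singularity S p m)
  (C : linsys R[i] 2 m) (hC : exceptional_curve S p C)
  (hX : exists X : linsys R[i] 3 m, plane_section X C /\
     exists2 W, regular_component delta W & W X) :
  exists2 W : set (linsys R[i] 3 n), regular_component delta W & closure W S.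
Proof.
have n0 : (0 < n)%N by apply: (sing_degree_pos (Y := S) (x := p)); rewrite Ssing.
apply: (exists_regular_component (@complex_large_fibers R) n0).
exact: (regular_in_closure (@complex_large_fibers R) hdelta Ssing Sord hC hX).
Qed.
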